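(* Let $G$ be a compact connected Lie group with Lie algebra $\mathfrak{g}$ acting on the symplectic manifold $(M,\omega)$, and let $(\omega,g,\mathbf{J})$ be a $G$-invariant compatible triple on $(M,\omega)$. Let $\mathrm{d}\lambda = f\,\mathrm{d}V_g$ be a $G$-invariant measure on $M$, where $f$ is smooth and bounded. Suppose that: (1) $\|\xi_M\|_{L^2_\lambda}<\infty$ for all $\xi\in\mathfrak{g}$; (2) every smooth closed $1$-form $\alpha$ in $L^2_\lambda$ decomposes as an $L^2_\lambda$-orthogonal sum $\alpha=\mathbf{d}h+\chi$, where $h,\mathbf{d}h\in L^2_\lambda$ and $\chi\in L^2_\lambda$ is $\lambda$-harmonic; (3) each cohomology class in $H^1(M)$ has a unique $\lambda$-harmonic representative in $L^2_\lambda$; (4) $\mathbf{J}$ preserves the space of $L^2_\lambda$ harmonic (that is, $\lambda$-harmonic) $1$-forms; (5) the $G$-action has fixed points on every connected component of $M$. Then the $G$-action is Hamiltonian.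
   Context: A compatible triple $(\omega,g,\mathbf{J})$ on a symplectic manifold $(M,\omega)$ consists of the symplectic form $\omega$, a Riemannian metric $g$ and an almost complex structure $\mathbf{J}$ with $g(\cdot,\cdot)=\omega(\cdot,\mathbf{J}\cdot)$; it is $G$-invariant if $G$ preserves $\omega$, $g$ and $\mathbf{J}$. $\mathrm{d}V_g$ is the measure associated to the Riemannian volume. For $\xi\in\mathfrak{g}$, the infinitesimal generator is the vector field $\xi_M(x)=\frac{d}{dt}\big|_{t=0}\exp(t\xi)\cdot x$. All group actions are by symplectomorphisms, i.e. diffeomorphisms preserving $\omega$. The action is Hamiltonian if there is a smooth equivariant map $\mu:M\to\mathfrak{g}^*$, called the momentum map, such that $\mathbf{i}_{\xi_M}\omega:=\omega(\xi_M,\cdot)=\mathbf{d}\langle\mu,\xi\rangle$ for all $\xi\in\mathfrak{g}$, where $\langle\cdot,\cdot\rangle$ is the duality pairing between $\mathfrak{g}^*$ and $\mathfrak{g}$. $L^2_\lambda$ denotes the Hilbert space of functions (or $1$-forms, or vector fields, with pointwise norms taken with respect to $g$) that are square integrable with respect to $\mathrm{d}\lambda$, with norm $\|\cdot\|_{L^2_\lambda}$. $\delta_\lambda$ is the formal adjoint of the de Rham differential $\mathbf{d}$ determined by the measure $\mathrm{d}\lambda$. A $1$-form in $L^2_\lambda$ is $\lambda$-harmonic if it lies in the common null space of $\mathbf{d}$ and $\delta_\lambda$. $H^1(M)$ is the first de Rham cohomology group of $M$ with real coefficients. $\mathbf{J}$ acts on $1$-forms in the usual way via its action on tangent vectors.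 *)

(* Defs.v *)
From mathcomp Require Export all_boot all_order all_algebra.
From mathcomp Require Export all_classical all_reals all_analysis.
Export Order.TTheory GRing.Theory Num.Theory.
Export numFieldNormedType.Exports.

Set Implicit Arguments.
Unset Strict Implicit.
Unset Printing Implicit Defensive.

Local Open Scope classical_set_scope.
Local Open Scope ring_scope.

(* C^k on the open set U; only used with finite-dimensional V, where
   continuity of all the directional derivatives is continuity of 'd f. *)
Fixpoint Ck (R : realType) (V W : normedModType R) (k : nat)
    (U : set V) (f : V -> W) : Prop :=
  match k with
  | 0 => forall x, U x -> {for x, continuous f}
  | k'.+1 => (forall x, U x -> differentiable f x) /\
             forall v : V, Ck k' U (fun x => 'D_v f x)
  end.

Definition smooth_on (R : realType) (V W : normedModType R)
    (U : set V) (f : V -> W) : Prop := forall k, Ck k U f.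

(* cmap and cinv are total; only their values on cdom and cmap @` cdom matter. *)
Record chart (R : realType) (n : nat) (M : topologicalType) := Chart {
  cdom : set M;
  cmap : M -> 'rV[R]_n;
  cinv : 'rV[R]_n -> M;
  cdom_open : open cdom;
  cimg_open : open (cmap @` cdom);
  cmapK : forall x, cdom x -> cinv (cmap x) = x;
  cmap_continuous : forall x, cdom x -> {for x, continuous cmap};
  cinv_continuous : forall y, (cmap @` cdom) y -> {for y, continuous cinv}
}.

Definition cimg (R : realType) (n : nat) (M : topologicalType)
  (c : chart R n M) : set 'rV[R]_n := cmap c @` cdom c.

(* Smooth n-manifolds without boundary.  chart_at x is a chosen chart around x:
   the tangent space T_x M is the model space 'rV[R]_n, a vector being
   identified with its coordinates in chart_at x.  A different choice of
   chart_at gives canonically isomorphic tangent spaces.  The carrier is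
   nonempty because measurable types are pointed. *)
Record manifold (R : realType) (n : nat) := Manifold {
  carrier :> ptopologicalType;
  carrier_hausdorff : hausdorff_space carrier;
  carrier_second_countable : @second_countable carrier;
  atlas : set (chart R n carrier);
  atlas_compat : forall c c', atlas c -> atlas c' ->
    smooth_on (cmap c @` (cdom c `&` cdom c')) (cmap c' \o cinv c);
  chart_at : carrier -> chart R n carrier;
  chart_at_atlas : forall x, atlas (chart_at x);
  chart_at_dom : forall x, cdom (chart_at x) x
}.

Definition smooth_fun (R : realType) (m : nat) (M : manifold R m)
    (W : normedModType R) (F : M -> W) : Prop :=
  forall c, @atlas R m M c -> smooth_on (cimg c) (F \o cinv c).

Definition smooth_curve (R : realType) (m : nat) (M : manifold R m)
    (gam : R -> M) : Prop :=
  continuous gam /\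
  forall c, @atlas R m M c -> smooth_on (gam @^-1` cdom c) (cmap c \o gam).

Definition smooth_map (R : realType) (m n : nat) (M : manifold R m)
    (N : manifold R n) (F : M -> N) : Prop :=
  continuous F /\
  forall c d, @atlas R m M c -> @atlas R n N d ->
    smooth_on [set y | cimg c y /\ cdom d (F (cinv c y))]
              (cmap d \o F \o cinv c).

(* F : M x N -> P is smooth for the product manifold structure on M x N *)
Definition smooth_map2 (R : realType) (m n p : nat) (M : manifold R m)
    (N : manifold R n) (P : manifold R p) (F : M -> N -> P) : Prop :=
  continuous (fun z : M * N => F z.1 z.2) /\
  forall c c' d, @atlas R m M c -> @atlas R n N c' -> @atlas R p P d ->
    smooth_on [set y : 'rV[R]_m * 'rV[R]_n | [/\ cimg c y.1, cimg c' y.2 &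
                      cdom d (F (cinv c y.1) (cinv c' y.2))]]
              (fun y => cmap d (F (cinv c y.1) (cinv c' y.2))).

(* T_x F : v |-> v *m tangent_map F x, from T_x M to T_(F x) N *)
Definition tangent_map (R : realType) (m n : nat) (M : manifold R m)
    (N : manifold R n) (F : M -> N) (x : M) : 'M[R]_(m, n) :=
  jacobian (cmap (chart_at (F x)) \o F \o cinv (chart_at x))
           (cmap (chart_at x) x).

Definition velocity (R : realType) (m : nat) (M : manifold R m)
    (gam : R -> M) (t : R) : 'rV[R]_m :=
  derive1 (fun s => cmap (chart_at (gam t)) (gam s)) t.

(* Row i is the coordinate vector d/dy_i of the chart c at the point
   x = cinv c y, as an element of T_x M. *)
Definition frame (R : realType) (m : nat) (M : manifold R m)
    (c : chart R m M) (y : 'rV[R]_m) : 'M[R]_m :=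
  jacobian (cmap (chart_at (cinv c y)) \o cinv c) y.

(* Tensor fields, pointwise in T_x M = 'rV_m: a 1-form is a field of columns,
   with alpha_x(v) = v *m alpha x; a bilinear form B is a field of matrices,
   with B_x(v, w) = v *m B x *m w^T; an endomorphism is v |-> v *m J x. *)
Definition form1 (R : realType) (m : nat) (M : manifold R m) := M -> 'cV[R]_m.
Definition bilinear_field (R : realType) (m : nat) (M : manifold R m) :=
  M -> 'M[R]_m.
Definition endo_field (R : realType) (m : nat) (M : manifold R m) :=
  M -> 'M[R]_m.

Definition pairing (R : realType) (m : nat) (v : 'rV[R]_m) (a : 'cV[R]_m) : R :=
  (v *m a) 0 0.

Definition bil (R : realType) (m : nat) (B : 'M[R]_m) (v w : 'rV[R]_m) : R :=
  (v *m B *m w^T) 0 0.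

Definition form1_in (R : realType) (m : nat) (M : manifold R m)
    (c : chart R m M) (alpha : form1 M) (y : 'rV[R]_m) : 'cV[R]_m :=
  frame c y *m alpha (cinv c y).

Definition bilinear_in (R : realType) (m : nat) (M : manifold R m)
    (c : chart R m M) (B : bilinear_field M) (y : 'rV[R]_m) : 'M[R]_m :=
  frame c y *m B (cinv c y) *m (frame c y)^T.

Definition endo_in (R : realType) (m : nat) (M : manifold R m)
    (c : chart R m M) (J : endo_field M) (y : 'rV[R]_m) : 'M[R]_m :=
  frame c y *m J (cinv c y) *m invmx (frame c y).

Definition smooth_form1 (R : realType) (m : nat) (M : manifold R m)
    (alpha : form1 M) : Prop :=
  forall c, @atlas R m M c -> smooth_on (cimg c) (form1_in c alpha).

Definition smooth_bilinear (R : realType) (m : nat) (M : manifold R m)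
    (B : bilinear_field M) : Prop :=
  forall c, @atlas R m M c -> smooth_on (cimg c) (bilinear_in c B).

Definition smooth_endo (R : realType) (m : nat) (M : manifold R m)
    (J : endo_field M) : Prop :=
  forall c, @atlas R m M c -> smooth_on (cimg c) (endo_in c J).

Definition partial (R : realType) (m : nat) (i : 'I_m) (u : 'rV[R]_m -> R)
  (y : 'rV[R]_m) : R := 'D_(delta_mx 0 i) u y.

Definition d0 (R : realType) (m : nat) (M : manifold R m) (h : M -> R) :
    form1 M :=
  fun x => \col_i partial i (h \o cinv (chart_at x)) (cmap (chart_at x) x).

(* (d alpha)_ij = d_i alpha_j - d_j alpha_i in the coordinates of c *)
Definition d1_in (R : realType) (m : nat) (M : manifold R m)
    (c : chart R m M) (alpha : form1 M) (y : 'rV[R]_m) (i j : 'I_m) : R :=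
  partial i (fun z => form1_in c alpha z j 0) y -
  partial j (fun z => form1_in c alpha z i 0) y.

(* (d B)_ijk in the coordinates of c, for an alternating B *)
Definition d2_in (R : realType) (m : nat) (M : manifold R m)
    (c : chart R m M) (B : bilinear_field M) (y : 'rV[R]_m)
    (i j k : 'I_m) : R :=
  partial i (fun z => bilinear_in c B z j k) y +
  partial j (fun z => bilinear_in c B z k i) y +
  partial k (fun z => bilinear_in c B z i j) y.

Definition closed_form1 (R : realType) (m : nat) (M : manifold R m)
    (alpha : form1 M) : Prop :=
  smooth_form1 alpha /\
  forall c y i j, @atlas R m M c -> cimg c y -> d1_in c alpha y i j = 0.

Definition exact_form1 (R : realType) (m : nat) (M : manifold R m)
    (alpha : form1 M) : Prop :=
  exists2 h : M -> R, smooth_fun h & alpha = d0 h.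

Definition de_rham_H1 (R : realType) (m : nat) (M : manifold R m) :
    set (set (form1 M)) :=
  [set C | exists2 alpha : form1 M, closed_form1 alpha &
     C = [set beta : form1 M | closed_form1 beta /\
            exact_form1 ((fun x => beta x - alpha x) : form1 M)]].

Record symplectic_form (R : realType) (m : nat) (M : manifold R m)
    (omega : bilinear_field M) : Prop := {
  symp_smooth : smooth_bilinear omega;
  symp_alt : forall x v, bil (omega x) v v = 0;
  symp_nondeg : forall x v, (forall w, bil (omega x) v w = 0) -> v = 0;
  symp_closed : forall c y i j k,
    @atlas R m M c -> cimg c y -> d2_in c omega y i j k = 0
}.

Record riemannian_metric (R : realType) (m : nat) (M : manifold R m)
    (g : bilinear_field M) : Prop := {
  metric_smooth : smooth_bilinear g;
  metric_sym : forall x v w, bil (g x) v w = bil (g x) w v;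
  metric_pos : forall x v, v != 0 -> 0 < bil (g x) v v
}.

Record almost_complex (R : realType) (m : nat) (M : manifold R m)
    (J : endo_field M) : Prop := {
  ac_smooth : smooth_endo J;
  ac_square : forall x, J x *m J x = - 1%:M
}.

Definition compatible_triple (R : realType) (m : nat) (M : manifold R m)
    (omega g : bilinear_field M) (J : endo_field M) : Prop :=
  [/\ symplectic_form omega, riemannian_metric g, almost_complex J &
      forall x v w, bil (g x) v w = bil (omega x) v (w *m J x)].

(* Lebesgue integral over R^n of a nonnegative Borel function, as an iterated
   integral (Tonelli). *)
Fixpoint leb_int (R : realType) (n : nat) : ('rV[R]_n -> \bar R) -> \bar R :=
  match n return ('rV[R]_n -> \bar R) -> \bar R with
  | 0 => fun u => u 0
  | n'.+1 => fun u => (\int[@lebesgue_measure R]_(t in [set: R])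
      leb_int (fun y : 'rV[R]_n' => u (row_mx (t%:M : 'M[R]_1) y)))%E
  end.

Notation borel M := (g_sigma_algebraType (@open M)).

(* vol is dV_g: in a chart, sqrt(det g_ij) times Lebesgue measure.  This
   determines vol, M being covered by countably many charts. *)
Definition riemannian_volume (R : realType) (m : nat) (M : manifold R m)
    (g : bilinear_field M) (vol : {measure set (borel M) -> \bar R}) : Prop :=
  forall c (A : set M), @atlas R m M c -> @measurable _ (borel M) A ->
    A `<=` cdom c ->
    vol A = leb_int (fun y =>
      (\1_(cmap c @` A) y * Num.sqrt (\det (bilinear_in c g y)))%:E).

Definition norm_vect (R : realType) (m : nat) (M : manifold R m)
    (g : bilinear_field M) (X : M -> 'rV[R]_m) (x : M) : R :=
  Num.sqrt (bil (g x) (X x) (X x)).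

(* the inner product induced by g on T*_x M, with matrix (g x)^-1 *)
Definition inner_form1 (R : realType) (m : nat) (M : manifold R m)
    (g : bilinear_field M) (alpha beta : form1 M) (x : M) : R :=
  ((alpha x)^T *m invmx (g x) *m beta x) 0 0.

Definition norm_form1 (R : realType) (m : nat) (M : manifold R m)
    (g : bilinear_field M) (alpha : form1 M) (x : M) : R :=
  Num.sqrt (inner_form1 g alpha alpha x).

(* L2norm is only applied to smooth or continuous, hence Borel, functions. *)
Definition L2norm (R : realType) (m : nat) (M : manifold R m)
    (lam : {measure set (borel M) -> \bar R})
    (u : M -> R) : \bar R :=
  Lnorm lam 2%:E (fun x : borel M => (u x)%:E).

Definition L2_fun (R : realType) (m : nat) (M : manifold R m)
    (lam : {measure set (borel M) -> \bar R})
    (u : M -> R) : Prop := (L2norm lam u < +oo)%E.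

Definition L2_vect (R : realType) (m : nat) (M : manifold R m)
    (lam : {measure set (borel M) -> \bar R}) (g : bilinear_field M)
    (X : M -> 'rV[R]_m) : Prop := (L2norm lam (norm_vect g X) < +oo)%E.

Definition L2_form1 (R : realType) (m : nat) (M : manifold R m)
    (lam : {measure set (borel M) -> \bar R}) (g : bilinear_field M)
    (alpha : form1 M) : Prop := (L2norm lam (norm_form1 g alpha) < +oo)%E.

Definition L2_inner (R : realType) (m : nat) (M : manifold R m)
    (lam : {measure set (borel M) -> \bar R}) (g : bilinear_field M)
    (alpha beta : form1 M) : \bar R :=
  (\int[lam]_x (inner_form1 g alpha beta x)%:E)%E.

(* u = delta_lam alpha, for the formal adjoint delta_lam of d on functions *)
Definition is_codiff (R : realType) (m : nat) (M : manifold R m)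
    (lam : {measure set (borel M) -> \bar R}) (g : bilinear_field M)
    (alpha : form1 M) (u : M -> R) : Prop :=
  forall phi : M -> R, smooth_fun phi ->
    compact (closure [set x : M | phi x != 0]) ->
    L2_inner lam g (d0 phi) alpha = (\int[lam]_x (phi x * u x)%:E)%E.

Definition harmonic (R : realType) (m : nat) (M : manifold R m)
    (lam : {measure set (borel M) -> \bar R}) (g : bilinear_field M)
    (alpha : form1 M) : Prop :=
  closed_form1 alpha /\ is_codiff lam g alpha (fun=> 0).

(* J acting on 1-forms: (J alpha)(v) = alpha(J v) *)
Definition J_form1 (R : realType) (m : nat) (M : manifold R m)
    (J : endo_field M) (alpha : form1 M) : form1 M :=
  fun x => J x *m alpha x.

Record lieGroup (R : realType) (k : nat) := LieGroup {
  lie_manifold :> manifold R k;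
  gmul : lie_manifold -> lie_manifold -> lie_manifold;
  gone : lie_manifold;
  ginv : lie_manifold -> lie_manifold;
  gmulA : associative gmul;
  gmul1 : left_id gone gmul;
  gmulV : left_inverse gone ginv gmul;
  gmul_smooth : smooth_map2 gmul;
  ginv_smooth : smooth_map ginv
}.
Arguments gone {R k l}.

(* The Lie algebra of G is the tangent space 'rV[R]_k at gone.  e is the
   exponential map: t |-> e (t *: xi) is the one-parameter subgroup with initial
   velocity xi.  Every Lie group has exactly one such e. *)
Definition is_exponential (R : realType) (k : nat) (G : lieGroup R k)
    (e : 'rV[R]_k -> G) : Prop :=
  forall xi : 'rV[R]_k,
    [/\ smooth_curve (fun t : R => e (t *: xi)),
        forall s t : R, e ((s + t) *: xi) = gmul (e (s *: xi)) (e (t *: xi)) &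
        velocity (fun t : R => e (t *: xi)) 0 = xi].

(* xi |-> xi *m Ad a *)
Definition Ad (R : realType) (k : nat) (G : lieGroup R k) (a : G) : 'M[R]_k :=
  tangent_map (fun b : G => gmul (gmul a b) (ginv a)) gone.

Record smooth_action (R : realType) (k m : nat) (G : lieGroup R k)
    (M : manifold R m) (act : G -> M -> M) : Prop := {
  act_smooth : smooth_map2 act;
  act1 : forall x, act gone x = x;
  actM : forall a b x, act (gmul a b) x = act a (act b x)
}.

Definition inf_generator (R : realType) (k m : nat) (G : lieGroup R k)
    (M : manifold R m) (e : 'rV[R]_k -> G) (act : G -> M -> M)
    (xi : 'rV[R]_k) (x : M) : 'rV[R]_m :=
  velocity (fun t : R => act (e (t *: xi)) x) 0.

Definition preserves_bilinear (R : realType) (m : nat) (M : manifold R m)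
    (F : M -> M) (B : bilinear_field M) : Prop :=
  forall x v w, bil (B (F x)) (v *m tangent_map F x) (w *m tangent_map F x) =
                bil (B x) v w.

Definition preserves_endo (R : realType) (m : nat) (M : manifold R m)
    (F : M -> M) (J : endo_field M) : Prop :=
  forall x (v : 'rV[R]_m), v *m J x *m tangent_map F x = v *m tangent_map F x *m J (F x).

Definition invariant_triple (R : realType) (k m : nat) (G : lieGroup R k)
    (M : manifold R m) (act : G -> M -> M)
    (omega g : bilinear_field M) (J : endo_field M) : Prop :=
  forall a : G, [/\ preserves_bilinear (act a) omega,
    preserves_bilinear (act a) g & preserves_endo (act a) J].

Definition invariant_measure (R : realType) (k m : nat) (G : lieGroup R k)
    (M : manifold R m) (act : G -> M -> M)
    (lam : {measure set (borel M) -> \bar R}) : Prop :=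
  forall (a : G) (A : set M), @measurable _ (borel M) A ->
    lam (act a @^-1` A) = lam A.

(* mu takes values in the dual 'cV_k of the Lie algebra; equivariance is with
   respect to the coadjoint action, <Ad*_a nu, xi> = <nu, Ad_(a^-1) xi>. *)
Record momentum_map (R : realType) (k m : nat) (G : lieGroup R k)
    (M : manifold R m) (e : 'rV[R]_k -> G) (act : G -> M -> M)
    (omega : bilinear_field M) (mu : M -> 'cV[R]_k) : Prop := {
  mu_smooth : smooth_fun mu;
  mu_equivariant : forall (a : G) x xi,
    pairing xi (mu (act a x)) = pairing (xi *m Ad (ginv a)) (mu x);
  mu_generator : forall xi x v,
    bil (omega x) (inf_generator e act xi x) v =
    pairing v (d0 (fun z => pairing xi (mu z)) x)
}.

Definition hamiltonian (R : realType) (k m : nat) (G : lieGroup R k)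
    (M : manifold R m) (e : 'rV[R]_k -> G) (act : G -> M -> M)
    (omega : bilinear_field M) : Prop :=
  exists mu : M -> 'cV[R]_k, momentum_map e act omega mu.

(* Main.v *)
(** Fix [xi] in the Lie algebra and let [X] be its infinitesimal generator, with
    flow [phi_t].  By Cartan's formula [i_X omega] is closed, and its pointwise norm
    is that of [X], so that [i_X omega = dh + chi] with [chi] harmonic.  Pointwise
    [<i_X omega, chi> = (J chi)(X)], and [J chi] is again harmonic.

    If [beta] is a harmonic L^2 form, then so is [phi_t^* beta], and
    [phi_t^* beta - beta = d h_t] where [h_t x] is the integral of [beta X] along the
    orbit of [x] up to time [t]; hence [phi_t^* beta = beta] by uniqueness of harmonic
    representatives.  So [h_t] is constant on connected components; it vanishes at the
    fixed points, hence everywhere, and [beta X = 0].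

    Therefore [<dh, chi> = - |chi|^2] pointwise and [chi] vanishes almost everywhere.
    Uniqueness of harmonic representatives also forces nonempty open sets to have
    positive measure, since the differential of a bump function supported in a null set
    would be an exact harmonic form; so [chi = 0] and [i_X omega = dh].  Normalising the
    potentials to vanish at one fixed point per component makes the momentum map
    equivariant. *)
From HB Require Import structures.
Require Import Defs.
From mathcomp Require Import ring lra measurable_realfun.

Set Implicit Arguments.
Unset Strict Implicit.
Unset Printing Implicit Defensive.

Local Open Scope classical_set_scope.
Local Open Scope ring_scope.

(** * Calculus of C^k maps *)

(** No calculus of Lie derivatives is set up. Closed forms are pulled back along the map
    [(t, y) |-> phi_t (c^-1 y)], defined on the line times the image of a chart [c]. For a closed
    1-form, equality of mixed derivatives of the pullback yields the differential of [h_t]; for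
    [omega], invariance kills the [t]-derivative term in the closedness relation, and what remains
    at [t = 0] is the closedness of [i_X omega]. Tangent vectors are read in a chart that jumps from
    point to point, so every derivative of a map into [M] is computed in one fixed chart and
    corrected by [frame]. Integrals over [M] are treated for arbitrary integrands, as suprema over
    simple functions below the positive and negative parts; invariance of the measure then
    transports norms and codifferentials without any measurability of the integrands. The primitives
    [h_t] are controlled for [t >= 0] only, which suffices because every point is [phi_1] of some
    other point. *)

Lemma near_eq_diff (R : numFieldType) (V W : normedModType R) (f g : V -> W) x :
  {near x, f =1 g} -> differentiable f x -> differentiable g x.
Proof.
move=> fg df.
have E : g \o shift x = cst (g x) + 'd f x +o_ (0 : V) id.
  apply/eqaddoP => e e0.
  have := diff_locally df; move/eqaddoP => /(_ e e0).
  have : \forall y \near (0 : V), f (y + x) = g (y + x).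
    by rewrite (near_shift x)/=; near do rewrite /= sub0r addrNK//.
  move=> H1 H2; near=> y.
  have -> : (g \o shift x - (cst (g x) + 'd f x)) y =
      (f \o shift x - (cst (f x) + 'd f x)) y.
    have E1 : f (y + x) = g (y + x) by near: y.
    rewrite -![(_ - _ : _ -> _) _]/(_ - _).
    rewrite -![(_ + _ : _ -> _) _]/(_ + _) /=.
    by rewrite -E1 /cst (nbhs_singleton fg).
  by near: y.
have C : continuous ('d f x) by exact: diff_continuous.
have D := diff_unique C E.
by apply/diff_locallyP; rewrite D.
Unshelve. all: by end_near. Qed.

Lemma open_near (T : topologicalType) (U : set T) (x : T) (P : T -> Prop) :
  open U -> U x -> (forall y, U y -> P y) -> \forall y \near x, P y.
Proof.
move=> oU Ux H; have : nbhs x U by apply: open_nbhs_nbhs; split.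
by apply: filterS.
Qed.

Lemma derive_open_eq (R : realType) (V W : normedModType R) (U : set V)
    (f g : V -> W) x v : open U -> U x -> (forall y, U y -> f y = g y) ->
  'D_v f x = 'D_v g x.
Proof.
by move=> oU Ux fg; apply: near_eq_derive; exact: (open_near oU Ux).
Qed.

Section Ck_theory.
Variable R : realType.
Implicit Types V W X : normedModType R.

Lemma derive_comp V W X (f : W -> X) (g : V -> W) x v :
  differentiable g x -> differentiable f (g x) ->
  'D_v (f \o g) x = 'd f (g x) ('D_v g x).
Proof.
move=> dg df; have dfg := differentiable_comp dg df.
by rewrite (deriveE _ dfg) (diff_comp dg df) /= (deriveE _ dg).
Qed.

Lemma derive_lin_comp V W X (l : W -> X) (g : V -> W) x v :
  (forall w, is_diff w l l) -> differentiable g x ->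
  'D_v (l \o g) x = l ('D_v g x).
Proof.
by move=> dl dg; have [dlx vl] := dl (g x); rewrite derive_comp// vl.
Qed.

Lemma CkS V W k (U : set V) (f : V -> W) : Ck k.+1 U f =
  ((forall x, U x -> differentiable f x) /\ forall v, Ck k U (fun x => 'D_v f x)).
Proof. by []. Qed.

Lemma Ck_sub V W k (U U' : set V) (f : V -> W) : U `<=` U' -> Ck k U' f -> Ck k U f.
Proof.
move=> UU'; elim: k f => [|k IH] f /=; first by move=> H x /UU'; exact: H.
by case=> H1 H2; split=> [x /UU'|v]; [exact: H1|exact: IH].
Qed.

(** Each clause of [Ck] at a point concerns [f] near that point in the whole ambient space, so a
    witness set [U'] only has to contain the point and may change with it. *)
Lemma Ck_local V W k (U : set V) (f : V -> W) :
  (forall x, U x -> exists2 U', U' x & Ck k U' f) -> Ck k U f.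
Proof.
elim: k f => [|k IH] f H /=.
  by move=> x Ux; have [U' U'x] := H x Ux; apply.
split=> [x Ux|v].
  by have [U' U'x [H1 _]] := H x Ux; exact: H1.
by apply: IH => x Ux; have [U' U'x [_ H1]] := H x Ux; exists U' => //; exact: H1.
Qed.

Lemma Ck_eq V W k (U : set V) (f g : V -> W) : open U ->
  (forall x, U x -> f x = g x) -> Ck k U f -> Ck k U g.
Proof.
move=> oU; elim: k f g => [|k IH] f g fg /=.
  move=> H x Ux.
  have Hx : f @ x --> g x by rewrite -(fg x Ux); exact: H.
  apply: cvg_trans Hx; apply: near_eq_cvg.
  by apply: (open_near oU Ux) => y Uy; rewrite fg.
case=> H1 H2; split=> [x Ux|v].
  by apply: near_eq_diff (H1 x Ux); exact: (open_near oU Ux).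
apply: IH (H2 v) => x Ux.
exact: (derive_open_eq v oU Ux fg).
Qed.

Lemma CkW V W k (U : set V) (f : V -> W) : Ck k.+1 U f -> Ck k U f.
Proof.
elim: k f => [|k IH] f.
  by case=> H _ x Ux; exact/differentiable_continuous/H.
by rewrite CkS => -[H1 H2]; split=> // v; exact: IH.
Qed.

Lemma Ck_cst V W k (U : set V) (w : W) : Ck k U (fun=> w).
Proof.
elim: k w => [|k IH] w /=; first by move=> x _; exact: cst_continuous.
split=> [x _|v]; first exact: differentiable_cst.
have -> : (fun x : V => 'D_v (fun=> w) x) = (fun=> 0).
  by apply/funext => x; exact: derive_cst.
exact: IH.
Qed.

Lemma Ck_linear V W X k (U : set V) (l : W -> X) (f : V -> W) :
  open U -> (forall w, is_diff w l l) -> Ck k U f -> Ck k U (l \o f).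
Proof.
move=> oU dl; elim: k f => [|k IH] f /=.
  move=> H x Ux; apply: continuous_comp; first exact: H.
  by apply: differentiable_continuous; exact: (@ex_diff _ _ _ _ _ _ _ (dl _)).
case=> H1 H2; split=> [x Ux|v].
  apply: differentiable_comp; first exact: H1.
  exact: (@ex_diff _ _ _ _ _ _ _ (dl _)).
apply: Ck_eq (IH _ (H2 v)) => // x Ux /=.
by rewrite derive_lin_comp//; exact: H1.
Qed.

Lemma Ck_add V W k (U : set V) (f g : V -> W) : open U ->
  Ck k U f -> Ck k U g -> Ck k U (fun x => f x + g x).
Proof.
move=> oU; elim: k f g => [|k IH] f g.
  by move=> /= H1 H2 x Ux; apply: continuousD; [exact: H1|exact: H2].
rewrite !CkS => -[H1 H2] [H3 H4]; split=> [x Ux|v].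
  by apply: differentiableD; [exact: H1|exact: H3].
apply: Ck_eq (IH _ _ (H2 v) (H4 v)) => // x Ux.
by rewrite -deriveD//; apply: diff_derivable; [exact: H1|exact: H3].
Qed.

Lemma Ck_opp V W k (U : set V) (f : V -> W) : open U ->
  Ck k U f -> Ck k U (fun x => - f x).
Proof.
move=> oU; elim: k f => [|k IH] f.
  by move=> /= H1 x Ux; apply: continuousN; exact: H1.
rewrite !CkS => -[H1 H2]; split=> [x Ux|v].
  by apply: differentiableN; exact: H1.
apply: Ck_eq (IH _ (H2 v)) => // x Ux.
by rewrite -deriveN//; apply: diff_derivable; exact: H1.
Qed.

Lemma Ck_sum V W k (U : set V) (I : finType) (f : I -> V -> W) : open U ->
  (forall i, Ck k U (f i)) -> Ck k U (fun x => \sum_i f i x).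
Proof.
move=> oU H; elim: (index_enum I) => [|i r IH].
  have -> : (fun x => \sum_(i <- [::]) f i x) = (fun=> 0).
    by apply/funext => x; rewrite big_nil.
  exact: Ck_cst.
have -> : (fun x => \sum_(j <- i :: r) f j x) =
    (fun x => f i x + \sum_(j <- r) f j x).
  by apply/funext => x; rewrite big_cons.
exact: Ck_add.
Qed.

Lemma Ck_mul V k (U : set V) (f g : V -> R) : open U ->
  Ck k U f -> Ck k U g -> Ck k U (fun x => f x * g x).
Proof.
move=> oU; elim: k f g => [|k IH] f g.
  by move=> /= H1 H2 x Ux; apply: continuousM; [exact: H1|exact: H2].
move=> Hf Hg; have Wf := CkW Hf; have Wg := CkW Hg.
move: Hf Hg; rewrite !CkS => -[H1 H2] [H3 H4]; split=> [x Ux|v].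
  by apply: differentiableM; [exact: H1|exact: H3].
apply: Ck_eq (Ck_add oU (IH _ _ Wf (H4 v)) (IH _ _ Wg (H2 v))) => // x Ux.
have df : derivable f x v by apply: diff_derivable; exact: H1.
have dg : derivable g x v by apply: diff_derivable; exact: H3.
by symmetry; exact: (deriveM df dg).
Qed.

(** In the chain rule the outer differential is evaluated in a direction that varies with the point,
    whereas [Ck] speaks of fixed directions; expanding along a fixed finite family bridges the two.
    Asking that a coordinate be its own differential makes it linear and continuous at once. *)
Record fbasis W := FBasis {
  fb_idx : finType;
  fb_vec : fb_idx -> W;
  fb_coord : fb_idx -> W -> R;
  fb_diff : forall i w, is_diff w (fb_coord i) (fb_coord i);
  fb_decomp : forall w, w = \sum_i fb_coord i w *: fb_vec i
}.
Arguments fb_vec {W} _ _.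
Arguments fb_coord {W} _ _.
Arguments fb_diff {W} _ _ _.
Arguments fb_decomp {W} _ _.

Lemma derive_comp_basis V W (B : fbasis W) (f : W -> R) (g : V -> W) x v :
  differentiable g x -> differentiable f (g x) ->
  'D_v (f \o g) x = \sum_i 'D_v (fb_coord B i \o g) x * 'D_(fb_vec B i) f (g x).
Proof.
move=> dg df; rewrite derive_comp// [X in 'd f (g x) X](fb_decomp B) linear_sum.
apply: eq_bigr => i _; rewrite linearZ/= -(deriveE _ df).
congr (_ * _); symmetry; apply: derive_lin_comp => // w; exact: fb_diff.
Qed.

(** Induction on [k]: the derivative of the composite is a finite sum of products of a derivative of
    a coordinate of [g] with a derivative of [f] composed with [g]. The outer function is scalar so
    that these are products in [R]; matrix values are treated entry by entry. *)
Lemma Ck_comp V W (B : fbasis W) k (U : set V) (O : set W) (f : W -> R) (g : V -> W) :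
  open U -> (forall x, U x -> O (g x)) -> Ck k U g -> Ck k O f -> Ck k U (f \o g).
Proof.
move=> oU UO; elim: k f => [|k IH] f.
  by move=> /= Hg Hf x Ux; apply: continuous_comp; [exact: Hg|exact/Hf/UO].
move=> Hg; have Wg := CkW Hg; move: (Hg).
rewrite !CkS => -[dg Dg] [df Df]; split=> [x Ux|v].
  by apply: differentiable_comp; [exact: dg|exact/df/UO].
pose F x := \sum_i 'D_v (fb_coord B i \o g) x * ('D_(fb_vec B i) f \o g) x.
apply: (@Ck_eq _ _ _ _ F) => //.
  by move=> x Ux; rewrite /F (derive_comp_basis B)//; [exact: dg|exact/df/UO].
rewrite /F; apply: Ck_sum => // i; apply: Ck_mul => //; last exact: IH.
have [_] : Ck k.+1 U (fb_coord B i \o g).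
  by apply: Ck_linear => // w; exact: fb_diff.
exact.
Qed.

End Ck_theory.

Arguments fb_vec {R W} _ _.
Arguments fb_coord {R W} _ _.
Arguments fb_diff {R W} _ _ _.
Arguments fb_decomp {R W} _ _.

(** * Finite bases of the model spaces and componentwise smoothness *)

Section bases.
Variable R : realType.
Implicit Types V W X : normedModType R.

Lemma is_diff_linear V W (f : V -> W) x : linear f -> continuous f -> is_diff x f f.
Proof.
move=> lf cf.
pose lM := GRing.isLinear.Build _ _ _ _ _ lf.
pose L : {linear _ -> _} := HB.pack f lM.
rewrite -[f]/(L : _ -> _).
by apply: DiffDef; [exact: linear_differentiable|exact: diff_lin].
Qed.

Lemma is_diff_coord m n (i : 'I_m) (j : 'I_n) (w : 'M[R]_(m, n)) :
  is_diff w (fun A : 'M[R]_(m, n) => A i j : R) (fun A => A i j).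
Proof.
apply: is_diff_linear; last exact: coord_continuous.
by move=> a u v; rewrite !mxE.
Qed.

Lemma is_diff_fst V W (w : V * W) : is_diff w fst fst.
Proof. by apply: is_diff_linear => // -[u v]; exact: cvg_fst. Qed.

Lemma is_diff_snd V W (w : V * W) : is_diff w snd snd.
Proof. by apply: is_diff_linear => // -[u v]; exact: cvg_snd. Qed.

Lemma fbasis_self_diff (w : R) : is_diff w (fun x : R => x) (fun x : R => x).
Proof. exact: is_diff_id. Qed.

Lemma fbasis_self_decomp (w : R) : w = \sum_(i : unit) w *: (1 : R).
Proof. by rewrite big_const card_unit /= addr0 [RHS]mulr1. Qed.

Definition fbasis_self := @FBasis R _ _ (fun _ : unit => 1 : R) (fun _ (x : R) => x)
  (fun _ => fbasis_self_diff) fbasis_self_decomp.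

Lemma fbasis_rV_decomp n (w : 'rV[R]_n) :
  w = \sum_(i < n) w 0 i *: (delta_mx 0 i : 'rV[R]_n).
Proof. exact: row_sum_delta. Qed.

Definition fbasis_rV n := @FBasis R _ _
  (fun i : 'I_n => delta_mx 0 i : 'rV[R]_n) (fun i (w : 'rV[R]_n) => w 0 i)
  (@is_diff_coord 1 n 0) (@fbasis_rV_decomp n).

Lemma is_diff_coord_fst V W (B : fbasis V) i (w : V * W) :
  is_diff w (fun w => fb_coord B i w.1) (fun w => fb_coord B i w.1).
Proof. exact: (is_diff_comp (is_diff_fst w) (fb_diff B i w.1)). Qed.

Lemma is_diff_coord_snd V W (B : fbasis W) i (w : V * W) :
  is_diff w (fun w => fb_coord B i w.2) (fun w => fb_coord B i w.2).
Proof. exact: (is_diff_comp (is_diff_snd w) (fb_diff B i w.2)). Qed.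

Definition fb_prod_vec V W (B : fbasis V) (C : fbasis W)
    (i : fb_idx B + fb_idx C) : V * W :=
  match i with inl i => (fb_vec B i, 0) | inr j => (0, fb_vec C j) end.

Definition fb_prod_coord V W (B : fbasis V) (C : fbasis W)
    (i : fb_idx B + fb_idx C) : V * W -> R :=
  match i with
  | inl i => fun w => fb_coord B i w.1
  | inr j => fun w => fb_coord C j w.2
  end.

Lemma fb_prod_diff V W (B : fbasis V) (C : fbasis W) i (w : V * W) :
  is_diff w (fb_prod_coord (B := B) (C := C) i) (fb_prod_coord i).
Proof. by case: i => i; [exact: is_diff_coord_fst|exact: is_diff_coord_snd]. Qed.

Lemma fb_prod_decomp V W (B : fbasis V) (C : fbasis W) (w : V * W) :
  w = \sum_i fb_prod_coord (B := B) (C := C) i w *: fb_prod_vec i.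
Proof.
case: w => [u v]; rewrite big_sumType/=.
have H1 (I : finType) (a : I -> R) (b : I -> V) :
    \sum_i a i *: (b i, 0 : W) = (\sum_i a i *: b i, 0).
  elim: (index_enum I) => [|i r IH]; first by rewrite !big_nil.
  by rewrite !big_cons IH; congr (_, _) => /=; rewrite scaler0 addr0.
have H2 (I : finType) (a : I -> R) (b : I -> W) :
    \sum_i a i *: (0 : V, b i) = (0, \sum_i a i *: b i).
  elim: (index_enum I) => [|i r IH]; first by rewrite !big_nil.
  by rewrite !big_cons IH; congr (_, _) => /=; rewrite scaler0 addr0.
rewrite H1 H2 -(fb_decomp B u) -(fb_decomp C v).
by congr (_, _) => /=; rewrite ?addr0 ?add0r.
Qed.

Definition fbasis_prod V W (B : fbasis V) (C : fbasis W) :=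
  @FBasis R _ _ (@fb_prod_vec V W B C) (@fb_prod_coord V W B C)
  (@fb_prod_diff V W B C) (@fb_prod_decomp V W B C).

Lemma Ck_pair V W X k (U : set V) (f : V -> W) (g : V -> X) : open U ->
  Ck k U f -> Ck k U g -> Ck k U (fun x => (f x, g x)).
Proof.
move=> oU; elim: k f g => [|k IH] f g.
  move=> /= H1 H2 x Ux; apply: (@cvg_pair _ _ _ _ (nbhs (f x)) (nbhs (g x))).
    exact: H1.
  exact: H2.
rewrite !CkS => -[H1 H2] [H3 H4]; split=> [x Ux|v].
  by apply: differentiable_pair; [exact: H1|exact: H3].
apply: Ck_eq (IH _ _ (H2 v) (H4 v)) => // x Ux.
have d1 := H1 x Ux; have d3 := H3 x Ux.
by rewrite [RHS]deriveE ?diff_pair ?deriveE//; exact: differentiable_pair.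
Qed.

Lemma Ck_id V k (U : set V) : open U -> Ck k U id.
Proof.
move=> oU; case: k => [|k]; first by move=> x _; exact: cvg_id.
split=> [x _|v]; first by have [] := is_diff_id x.
by apply: Ck_eq (Ck_cst k U v) => // x _; rewrite derive_id.
Qed.

Lemma Ck_fst V W k (U : set (V * W)) : open U -> Ck k U fst.
Proof.
by move=> oU; exact: (Ck_linear oU (@is_diff_fst V W) (Ck_id k oU)).
Qed.

Lemma Ck_snd V W k (U : set (V * W)) : open U -> Ck k U snd.
Proof.
by move=> oU; exact: (Ck_linear oU (@is_diff_snd V W) (Ck_id k oU)).
Qed.

Lemma Ck_mxP V m n k (U : set V) (F : V -> 'M[R]_(m, n)) : open U ->
  (Ck k U F <-> forall i j, Ck k U (fun x => F x i j : R)).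
Proof.
move=> oU; split=> [H i j|H].
  have := @Ck_linear _ _ _ _ _ U (fun A : 'M[R]_(m, n) => A i j) F oU.
  by apply=> // w; exact: is_diff_coord.
pose G x := \sum_(p : 'I_m * 'I_n) F x p.1 p.2 *: delta_mx p.1 p.2.
apply: (@Ck_eq _ _ _ _ _ G) => //.
  move=> x _; rewrite [RHS]matrix_sum_delta /G.
  by rewrite (pair_bigA _ (fun i j => F x i j *: delta_mx i j)).
apply: Ck_sum => // p.
have := Ck_linear oU (fun w : R => is_diff_scalel w (delta_mx p.1 p.2 : 'M[R]_(m, n))) (H p.1 p.2).
exact.
Qed.

End bases.

(** * Mean value theorem and symmetry of second derivatives *)

Section calculus.
Variable R : realType.
Implicit Types V W X : normedModType R.

Lemma is_derive_line V W (f : V -> W) x v (s : R) :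
  derivable f (x + s *: v) v ->
  is_derive s 1 (fun t : R => f (x + t *: v)) ('D_v f (x + s *: v)).
Proof.
move=> df.
have E : (fun h : R => h^-1 *: (((fun t : R => f (x + t *: v)) \o shift s) (h *: 1) -
      f (x + s *: v))) =
    (fun h : R => h^-1 *: ((f \o shift (x + s *: v)) (h *: v) - f (x + s *: v))).
  apply/funext => h /=; congr (_ *: (f _ - _)).
  by rewrite [h%:A]mulr1 scalerDl addrCA addrA.
by split; rewrite /derivable /derive E.
Qed.

Lemma MVT_line V (f : V -> R) x v (s : R) : 0 < s ->
  (forall t, 0 <= t <= s -> derivable f (x + t *: v) v) ->
  exists2 c, 0 < c < s & f (x + s *: v) - f x = s * 'D_v f (x + c *: v).
Proof.
move=> s0 df.
have H t : t \in `[0, s]%R ->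
    is_derive t 1 (fun t : R => f (x + t *: v)) ('D_v f (x + t *: v)).
  by rewrite in_itv /= => /df; exact: is_derive_line.
have cont : {within `[0, s], continuous (fun t : R => f (x + t *: v))}.
  by apply: derivable_within_continuous => t /H [].
have H' : forall t, t \in `]0, s[%R ->
    is_derive t 1 (fun t : R => f (x + t *: v)) ('D_v f (x + t *: v)).
  by move=> t ts; apply: H; exact: subset_itv_oo_cc ts.
have [c cs E] := MVT s0 H' cont.
exists c; first by move: cs; rewrite in_itv.
by move: E; rewrite scale0r addr0 subr0 mulrC.
Qed.

Lemma dist_halves (a b c e : R) : `|a - c| < e / 2 -> `|b - c| < e / 2 -> `|a - b| <= e.
Proof.
move=> h1 h2; rewrite (splitr e) -(subrKA c) (le_trans (ler_normD _ _))//.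
by rewrite lerD// ltW// distrC.
Qed.

(** Mean value theorem twice: for [y |-> f (y + s *: v) - f y] along [u], then for the derivative of
    [f] in direction [u] along [v]. *)
Lemma second_difference V (U : set V) (f : V -> R) x u v (s : R) : 0 < s ->
  (forall a b, 0 <= a <= s -> 0 <= b <= s -> U (x + a *: u + b *: v)) -> Ck 2 U f ->
  exists a b, [/\ 0 < a < s, 0 < b < s &
    f (x + s *: u + s *: v) - f (x + s *: u) - (f (x + s *: v) - f x) =
    s * (s * 'D_v (fun y => 'D_u f y) (x + a *: u + b *: v))].
Proof.
move=> s0 Us [df D1]; have [dDu _] := D1 u.
have ss : 0 <= s <= s by rewrite lexx ltW.
have s00 : 0 <= (0 : R) <= s by rewrite lexx ltW.
pose g y := f (y + s *: v) - f y.
have Eg t : 0 <= t <= s -> is_derive (x + t *: u) u g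
    ('D_u f (x + t *: u + s *: v) - 'D_u f (x + t *: u)).
  move=> ts.
  have U1 : U (x + t *: u + s *: v) by exact: (Us t s ts ss).
  have U0 : U (x + t *: u) by have := Us t 0 ts s00; rewrite scale0r addr0.
  have d1 : differentiable (f \o shift (s *: v)) (x + t *: u).
    apply: differentiable_comp; last exact: (df _ U1).
    by apply: differentiableD => //; exact: differentiable_cst.
  have Ed : 'D_u (f \o shift (s *: v)) (x + t *: u) = 'D_u f (x + t *: u + s *: v).
    have E0 : (fun h : R => h^-1 *: (((f \o shift (s *: v)) \o shift (x + t *: u)) (h *: u) -
          (f \o shift (s *: v)) (x + t *: u))) =
        (fun h : R => h^-1 *: ((f \o shift (x + t *: u + s *: v)) (h *: u) -
          f (x + t *: u + s *: v))).
      by apply/funext => h /=; rewrite -!addrA.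
    by rewrite /derive E0.
  rewrite -Ed; apply: is_deriveB.
    by apply: derivableP; exact: diff_derivable.
  by apply: derivableP; apply: diff_derivable; exact: df.
have [|a a0 E1] := @MVT_line _ g x u s s0.
  by move=> t ts; have [] := Eg t ts.
have a0' : 0 <= a <= s by case/andP: a0 => *; rewrite !ltW.
have [|b b0 E2] := @MVT_line _ (fun y => 'D_u f y) (x + a *: u) v s s0.
  by move=> t ts; apply: diff_derivable; apply: dDu; exact: (Us a t a0' ts).
exists a, b; split=> //.
by rewrite -E2 -(@derive_val _ _ _ _ _ _ _ (Eg a a0')) -E1.
Qed.

(** The second difference is symmetric in [u] and [v], so each mixed derivative, at some point of a
    small parallelogram, equals the same number divided by [s * s]. Continuity of both mixed
    derivatives at [x] concludes. *)
Lemma Schwarz V (U : set V) (f : V -> R) x u v : open U -> U x -> Ck 2 U f ->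
  'D_u (fun y => 'D_v f y) x = 'D_v (fun y => 'D_u f y) x.
Proof.
move=> oU Ux C2; have [_ D1] := C2.
have [_ Cuv] := D1 v; have [_ Cvu] := D1 u.
have c1 := Cuv u x Ux; have c2 := Cvu v x Ux.
apply/eqP; rewrite -subr_eq0 -normr_le0; apply/ler_addgt0Pl => e e0; rewrite addr0.
have e20 : 0 < e / 2 by rewrite divr_gt0.
have /cvgrPdist_lt /(_ _ e20) n1 := c1.
have /cvgrPdist_lt /(_ _ e20) n2 := c2.
have nU : nbhs x U by apply: open_nbhs_nbhs.
have N : \forall y \near x, U y /\
    (`|'D_u (fun y => 'D_v f y) x - 'D_u (fun y => 'D_v f y) y| < e / 2 /\
     `|'D_v (fun y => 'D_u f y) x - 'D_v (fun y => 'D_u f y) y| < e / 2).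
  exact: (filterI nU (filterI n1 n2)).
have [r /= r0 H] := (nbhs_ballP _ _).1 N.
(* With this [s] the whole parallelogram of sides [s *: u] and [s *: v] stays within [r / 2] of [x];
   the summand 1 guards against [u = v = 0]. *)
pose s := r / (2 * (`|u| + `|v| + 1)).
have K0 : 0 < `|u| + `|v| + 1 by rewrite ltr_wpDl// addr_ge0.
have s0 : 0 < s by rewrite divr_gt0// mulr_gt0.
have B a b : 0 <= a <= s -> 0 <= b <= s -> ball x r (x + a *: u + b *: v).
  move=> /andP[a0 a1] /andP[b0 b1]; rewrite -ball_normE /=.
  rewrite -addrA opprD addNKr normrN (le_lt_trans (ler_normD _ _))//.
  rewrite !normrZ (ger0_norm a0) (ger0_norm b0).
  have h1 : a * `|u| <= s * `|u| by rewrite ler_wpM2r.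
  have h2 : b * `|v| <= s * `|v| by rewrite ler_wpM2r.
  have h3 : s * (`|u| + `|v| + 1) = r / 2.
    by rewrite /s; field; rewrite gt_eqF.
  by move: h1 h2 h3; nra.
have B' a b : 0 <= b <= s -> 0 <= a <= s -> ball x r (x + a *: v + b *: u).
  by move=> *; rewrite addrAC; exact: B.
have [|a [b [ha hb E1]]] := @second_difference _ U f x u v s s0 _ C2.
  by move=> a b h1 h2; exact: (H _ (B a b h1 h2)).1.
have [|a' [b' [ha' hb' E2]]] := @second_difference _ U f x v u s s0 _ C2.
  by move=> a' b' h1 h2; exact: (H _ (B' a' b' h2 h1)).1.
have E : 'D_v (fun y => 'D_u f y) (x + a *: u + b *: v) =
    'D_u (fun y => 'D_v f y) (x + a' *: v + b' *: u).
  apply: (mulfI (lt0r_neq0 s0)); apply: (mulfI (lt0r_neq0 s0)).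
  apply: etrans (esym E1) _; apply: etrans _ E2; rewrite (addrAC x (s *: v) (s *: u)).
  move: (f _) (f _) (f _) (f _) => p1 p2 p3 p4; ring.
have w0 t : 0 < t < s -> 0 <= t <= s by case/andP=> *; rewrite !ltW.
have [_ [_ n2']] := H _ (B a b (w0 _ ha) (w0 _ hb)).
have [_ [n1' _]] := H _ (B' a' b' (w0 _ hb') (w0 _ ha')).
rewrite -E in n1'.
exact: (dist_halves n1' n2').
Qed.
End calculus.

(** * Primitives, uniformity over compact intervals, and differentials from remainder estimates *)

Section calculus2.
Variable R : realType.
Implicit Types V W X : normedModType R.

Lemma primitive (p : R -> R) : continuous p ->
  exists2 F : R -> R, F 0 = 0 & forall t : R, 0 <= t -> is_derive t 1 F (p t).
Proof.
move=> cp.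
(* The lower limit is [-1] rather than 0 so that [t = 0] is interior to the interval of integration
   and the derivative there is two-sided; the value at 0 is subtracted afterwards. *)
pose F0 (x : R) : R := (\int[@lebesgue_measure R]_(t in [set` `[(-1)%R, x]]) (p t))%R.
have H (t : R) : 0 <= t -> derivable F0 t 1 /\ derive1 F0 t = p t.
  move=> t0.
  have tu : t < t + 1 by rewrite ltrDl.
  have at_ : (-1 < t)%R by apply: lt_le_trans t0; rewrite ltrN10.
  apply: (@continuous_FTC1_closed _ p (-1) t (t + 1) tu) => //; last exact: cp.
  apply: continuous_compact_integrable; first exact: segment_compact.
  by apply: continuous_subspaceT => x; exact: cp.
exists (fun t => F0 t - F0 0); first by rewrite subrr.
move=> t t0; have [d1 d2] := H t t0.
rewrite -d2 derive1E.
have d3 : is_derive t 1 F0 ('D_1 F0 t) by exact: derivableP.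
have := is_deriveB d3 (is_derive_cst (F0 0) t 1).
by rewrite subr0.
Qed.

Lemma constant_on_ball V (f : V -> R) x r :
  (forall y v, ball x r y -> derivable f y v /\ 'D_v f y = 0) ->
  forall y, ball x r y -> f y = f x.
Proof.
move=> H y By.
have r0 : 0 < r.
  by move: By; rewrite -ball_normE /=; apply: le_lt_trans.
have B t : 0 <= t <= 1 -> ball x r (x + t *: (y - x)).
  move=> /andP[t0 t1]; move: By; rewrite -ball_normE /=; apply: le_lt_trans.
  rewrite opprD addNKr normrN normrZ ger0_norm// distrC.
  by rewrite -[leRHS]mul1r ler_wpM2r.
have [|c c01 E] := @MVT_line _ _ f x (y - x) 1 ltr01.
  by move=> t t01; exact: (H _ _ (B t t01)).1.
have c01' : 0 <= c <= 1 by case/andP: c01 => *; rewrite !ltW.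
move: E; rewrite (H _ _ (B c c01')).2 mulr0 scale1r (addrC x) subrK => /eqP.
by rewrite subr_eq0 => /eqP.
Qed.

Lemma derive_rV n (f : 'rV[R]_n -> R) y v : differentiable f y ->
  'D_v f y = \sum_i v 0 i * 'D_(delta_mx 0 i) f y.
Proof.
move=> df; rewrite (deriveE _ df) [X in 'd f y X](row_sum_delta v) linear_sum.
by apply: eq_bigr => i _; rewrite linearZ /= (deriveE _ df).
Qed.

Lemma ler_coord_norm n (v : 'rV[R]_n) i : `|v 0 i| <= `|v|.
Proof.
by rewrite [leRHS]/Num.Def.normr /= mx_normrE; exact: (le_bigmax _ _ (0, i)).
Qed.

Lemma is_diff_littleo V W (f L : V -> W) x : linear L -> continuous L ->
  (forall e, 0 < e -> \forall v \near (0 : V), `|f (v + x) - f x - L v| <= e * `|v|) ->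
  is_diff x f L.
Proof.
move=> lL cL H.
pose lM := GRing.isLinear.Build _ _ _ _ _ lL.
pose LL : {linear _ -> _} := HB.pack L lM.
have E : f \o shift x = cst (f x) + LL +o_ (0 : V) id.
  apply/eqaddoP => e e0; have := H e e0; apply: filterS => v /=.
  rewrite -![(_ - _ : _ -> _) _]/(_ - _) -![(_ + _ : _ -> _) _]/(_ + _) /=.
  by rewrite /cst opprD addrA.
have D : 'd f x = LL :> (V -> W) by apply: diff_unique.
have df : differentiable f x.
  by apply/diff_locallyP; rewrite D.
exact: DiffDef.
Qed.

(** Compactness of [[0, T]] turns continuity at each point [(t, x)] into one neighbourhood of [x]
    that serves all [t]. *)
Lemma tube V (G : R -> V -> R) x (T e : R) : 0 < e ->
  (forall t : R, 0 <= t <= T -> {for (t, x), continuous (fun z : R * V => G z.1 z.2)}) ->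
  \forall y \near x, forall t, 0 <= t <= T -> `|G t y - G t x| < e.
Proof.
move=> e0 cG.
have /compact_near_coveringP K := @segment_compact R 0 T.
have e20 : 0 < e / 2 by rewrite divr_gt0.
have H : forall t, [set` `[0, T]%R] t ->
    \forall t' \near t & y \near x, `|G t' y - G t' x| < e.
  move=> t; rewrite /= in_itv /= => tT.
  have := cG t tT; move=> /cvgrPdist_lt /(_ _ e20) [[A B] /= [nA nB] AB].
  exists (A, B) => // -[t' y] /= [At' By].
  have h1 : `|G t x - G t' y| < e / 2 by exact: (AB (t', y)).
  have h2 : `|G t x - G t' x| < e / 2.
    by apply: (AB (t', x)); split=> //; exact: nbhs_singleton nB.
  rewrite (splitr e) -(subrKA (G t x)) (le_lt_trans (ler_normD _ _))//.
  by rewrite ltrD// distrC.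
have := K V (nbhs x) (fun y t => `|G t y - G t x| < e) (nbhs_filter x) H.
apply: filterS => y Hy t tT.
by apply: Hy; rewrite /= in_itv.
Qed.

End calculus2.

Section calculus3.
Variable R : realType.
Implicit Types V W X : normedModType R.

Lemma is_derive_fin_sum (I : finType) (c : I -> R) (h dh : I -> R -> R) (t : R) :
  (forall i, is_derive t 1 (h i) (dh i t)) ->
  is_derive t 1 (fun t => \sum_i c i * h i t) (\sum_i c i * dh i t).
Proof.
move=> H; elim: (index_enum I) => [|i r IH].
  have -> : (fun t => \sum_(i <- [::]) c i * h i t) = cst 0.
    by apply/funext => s; rewrite big_nil.
  by rewrite big_nil; exact: is_derive_cst.
have -> : (fun t => \sum_(j <- i :: r) c j * h j t) =
    (fun t => c i * h i t + \sum_(j <- r) c j * h j t).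
  by apply/funext => s; rewrite big_cons.
rewrite big_cons; apply: is_deriveD.
Qed.

Lemma pairing_sum n (v : 'rV[R]_n) (w : 'cV[R]_n) : (v *m w) 0 0 = \sum_i v 0 i * w i 0.
Proof. by rewrite mxE. Qed.

Lemma pairing_linear n (w : 'cV[R]_n) : linear (fun v : 'rV[R]_n => (v *m w) 0 0 : R).
Proof. by move=> a u v; rewrite mulmxDl -scalemxAl !mxE. Qed.

Lemma pairing_continuous n (w : 'cV[R]_n) :
  continuous (fun v : 'rV[R]_n => (v *m w) 0 0 : R).
Proof.
have : Ck 0 setT (fun v : 'rV[R]_n => \sum_i v 0 i * w i 0).
  apply: Ck_sum; first exact: openT.
  move=> i; apply: Ck_mul; first exact: openT.
    by move=> x _; exact: coord_continuous.
  exact: Ck_cst.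
move=> H x; have := H x I.
have -> : (fun v : 'rV[R]_n => \sum_i v 0 i * w i 0) = (fun v : 'rV[R]_n => (v *m w) 0 0).
  by apply/funext => v; rewrite pairing_sum.
exact.
Qed.

Lemma MVT_bound (D dD : R -> R) (T K : R) : 0 < T -> D 0 = 0 ->
  (forall t : R, 0 <= t <= T -> is_derive t 1 D (dD t)) ->
  (forall t, 0 <= t <= T -> `|dD t| <= K) -> `|D T| <= T * K.
Proof.
move=> T0 D0 H HK.
have cD : {within `[0, T], continuous D}.
  apply: derivable_within_continuous => t; rewrite in_itv /= => tT.
  by have [] := H t tT.
have H' : forall t, t \in `]0, T[%R -> is_derive t 1 D (dD t).
  by move=> t; rewrite in_itv /= => /andP[*]; apply: H; rewrite !ltW.
have [c cT E] := MVT T0 H' cD.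
move: E; rewrite D0 !subr0 => ->; rewrite normrM mulrC (gtr0_norm T0).
apply: ler_wpM2l; first exact: ltW.
apply: HK.
by move: cT; rewrite in_itv /= => /andP[*]; rewrite !ltW.
Qed.

(* The difference between the increment of [H t] and its expected linear part
   vanishes at [t = 0] and has a small derivative in [t], uniformly on [[0, T]],
   so the mean value theorem in [t] replaces differentiation under an integral. *)
Lemma leibniz n (U : set 'rV[R]_n) (P H : R -> 'rV[R]_n -> R)
    (G : 'I_n -> R -> 'rV[R]_n -> R) (q : R -> 'cV[R]_n) x (T : R) :
  0 < T -> open U -> U x ->
  (forall t y, 0 <= t <= T -> U y -> differentiable (P t) y) ->
  (forall t y i, 0 <= t <= T -> U y -> 'D_(delta_mx 0 i) (P t) y = G i t y) ->
  (forall i (t : R), 0 <= t <= T ->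
     {for (t, x), continuous (fun z : R * 'rV[R]_n => G i z.1 z.2)}) ->
  (forall (t : R) y, 0 <= t <= T -> U y -> is_derive t 1 (H^~ y) (P t y)) ->
  (forall y, H 0 y = 0) ->
  (forall i (t : R), 0 <= t <= T -> is_derive t 1 (fun t => q t i 0) (G i t x)) ->
  is_diff x (H T) (fun v => (v *m (q T - q 0)) 0 0).
Proof.
move=> T0 oU Ux dP GP cG dH H0 dq.
apply: is_diff_littleo; [exact: pairing_linear|exact: pairing_continuous|].
move=> e e0.
(* The bound on the derivative in [t] is a sum of [n] terms of size [e1] times the norm of [v], and
   the mean value theorem multiplies it by [T]. The extra 1 keeps the denominator positive when
   [n = 0]. *)
pose e1 := e / (T * (n%:R + 1)).
have n0 : 0 < n%:R + 1 :> R by rewrite ltr_wpDl// ler0n.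
have e10 : 0 < e1 by rewrite divr_gt0// mulr_gt0.
have N1 : \forall y \near x, forall i t, 0 <= t <= T -> `|G i t y - G i t x| < e1.
  have h i := tube e10 (cG i).
  exact: (filter_forall (nbhs_filter x) h).
have N2 : \forall y \near x, U y by exact: (open_near oU Ux).
have [r /= r0 N] := (nbhs_ballP _ _).1 (filterI N1 N2).
apply/nbhs_ballP; exists r => // v; rewrite -ball_normE /= sub0r normrN => vr.
have Bc c : 0 <= c <= 1 -> ball x r (x + c *: v).
  move=> /andP[c0 c1]; rewrite -ball_normE /= opprD addNKr normrN normrZ ger0_norm//.
  by apply: le_lt_trans vr; rewrite -[leRHS]mul1r ler_wpM2r.
have Uc c : 0 <= c <= 1 -> U (x + c *: v) by move=> /Bc /N [].
have Uv : U (v + x) by have := Uc 1; rewrite scale1r addrC; apply; rewrite lexx ler01.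
pose D t := H t (v + x) - H t x - \sum_i v 0 i * (q t i 0 - q 0 i 0).
pose dD t := P t (v + x) - P t x - \sum_i v 0 i * G i t x.
have -> : H T (v + x) - H T x - (v *m (q T - q 0)) 0 0 = D T.
  by rewrite /D pairing_sum; congr (_ - _); apply: eq_bigr => i _; rewrite !mxE.
have -> : e * `|v| = T * ((n%:R + 1) * (`|v| * e1)).
  by rewrite /e1; field; rewrite !gt_eqF.
apply: (MVT_bound (dD := dD)) => //.
- by rewrite /D !H0 subrr sub0r big1 ?oppr0// => i _; rewrite subrr mulr0.
- move=> t tT; apply: is_deriveB.
    by apply: is_deriveB; exact: dH.
  apply: (@is_derive_fin_sum _ (fun i => v 0 i) (fun i t => q t i 0 - q 0 i 0)
    (fun i t => G i t x) t) => i.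
  have := is_deriveB (dq i t tT) (is_derive_cst (q 0 i 0) t 1).
  by rewrite subr0.
- move=> t tT.
  have [|c c01 E] := @MVT_line _ _ (P t) x v 1 ltr01.
    by move=> s s01; apply: diff_derivable; apply: dP => //; exact: Uc.
  have c01' : 0 <= c <= 1 by case/andP: c01 => *; rewrite !ltW.
  rewrite scale1r mul1r in E.
  rewrite /dD (addrC v) E derive_rV; last by apply: dP => //; exact: Uc.
  rewrite -sumrB (le_trans (ler_norm_sum _ _ _))//.
  apply: (@le_trans _ _ (\sum_(i < n) (`|v| * e1))).
    apply: ler_sum => i _; rewrite GP//; last exact: Uc.
    rewrite -mulrBr normrM ler_pM//; first exact: ler_coord_norm.
    by apply: ltW; have [h _] := N _ (Bc c c01'); exact: h.
  rewrite sumr_const card_ord -[leLHS]mulr_natl ler_wpM2r// ?lerDl//.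
  by rewrite mulr_ge0// ltW.
Qed.

End calculus3.

(** * Bump functions *)

Section bump.
Variable R : realType.

(* The derivatives of e^(-1/x) are combinations of these functions. *)
Definition flat (n : nat) (x : R) : R :=
  if 0 < x then x^-1 ^+ n * expR (- x^-1) else 0.

Lemma flat_ge0 n x : 0 <= flat n x.
Proof.
rewrite /flat; case: ifPn => // x0.
by rewrite mulr_ge0 ?expR_ge0// exprn_ge0// invr_ge0 ltW.
Qed.

(** With [z = 1/x] this reads [z^(n+1) <= (n+1)! e^z], a single term of the exponential series. *)
Lemma flat_le n x : flat n x <= (n.+1)`!%:R * `|x|.
Proof.
rewrite /flat; case: ifPn => x0; last by rewrite mulr_ge0.
rewrite gtr0_norm//.
have z0 : 0 < x^-1 by rewrite invr_gt0.
move: (x^-1) z0 (invrK x) => z z0 <-.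
have N0 : 0 < (n.+1)`!%:R :> R by rewrite ltr0n fact_gt0.
have := expR_ge1Dxn n (ltW z0).
rewrite expRN ler_pdivrMr ?expR_gt0// mulrAC ler_pdivlMr// -exprSr => H.
rewrite mulrC -ler_pdivrMr//; apply: le_trans H.
by rewrite lerDr.
Qed.

Lemma flatM n x : x * flat n.+1 x = flat n x.
Proof.
rewrite /flat; case: ifPn => x0; last by rewrite mulr0.
by rewrite exprS !mulrA mulfV ?mul1r// gt_eqF.
Qed.

(** Only [x = 0] is delicate: there [flat n x = x * flat n.+1 x], and the linear bound on the second
    factor makes the whole quadratically small, so that the derivative is 0. *)
Lemma is_derive_flat n (x : R) :
  is_derive x 1 (flat n) (flat n.+2 x - n%:R * flat n.+1 x).
Proof.
case: (ltgtP 0 x) => [x0|x0|<-].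
- have xn0 : x != 0 by rewrite gt_eqF.
  have d1 : is_derive x 1 (fun x : R => x^-1) (- x ^- 2).
    have := @is_deriveV R id x 1 1 xn0 (is_derive_id x 1).
    by rewrite scaler1.
  have d2 : is_derive x 1 (fun x : R => expR (- x^-1)) (expR (- x^-1) * x ^- 2).
    have d2 : is_derive x 1 (fun x : R => - x^-1) (x ^- 2).
      by have := is_deriveN d1; rewrite opprK.
    exact: (@is_derive1_comp R expR (fun x : R => - x^-1) x _ _ (is_derive_expR (- x^-1)) d2).
  have := is_deriveM (is_deriveX n d1) d2; rewrite exprfctE /= => d3.
  have E : flat n.+2 x - n%:R * flat n.+1 x =
     (x^-1 ^+ n *: (expR (- x^-1) * x ^- 2) + expR (- x^-1) *: (n%:R * x^-1 ^+ n.-1 *: - x ^- 2)).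
    rewrite /flat x0 -exprVn /GRing.scale /=; move: (x^-1) => z; move: (expR _) => w.
    case: (n) => [|n'] /=; rewrite !exprS ?expr0; first by ring.
    by rewrite -[n'.+1%:R]natr1; ring.
  rewrite E; refine (near_eq_is_derive _ d3).
  near=> y; rewrite /flat; have -> // : 0 < y.
  by near: y; exact: lt_nbhsr.
- have d3 := is_derive_cst (0 : R) x 1.
  rewrite /flat !ltNge (ltW x0) /= mulr0 subrr.
  refine (near_eq_is_derive _ d3).
  near=> y; have /ltW : y < 0 by near: y; exact: lt_nbhsl.
  by rewrite leNgt => /negbTE ->.
- have D : is_diff (0 : R) (flat n) (fun=> 0).
    apply: is_diff_littleo => [a u v||e e0]; first by rewrite scaler0 addr0.
      exact: cst_continuous.
    have K0 : 0 < (n.+2)`!%:R :> R by rewrite ltr0n fact_gt0.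
    apply/nbhs_ballP; exists (e / (n.+2)`!%:R); first by rewrite /= divr_gt0.
    move=> v; rewrite -ball_normE /= sub0r normrN => vr.
    rewrite addr0 /flat ltxx !subr0 -/(flat n v) -flatM normrM mulrC.
    apply: ler_wpM2r => //; rewrite ger0_norm ?flat_ge0//.
    apply: le_trans (flat_le _ _) _.
    by rewrite mulrC -ler_pdivlMr// ltW.
  have [d1 d2] := D.
  rewrite /flat ltxx mulr0 subrr.
  by split; [exact: diff_derivable|rewrite deriveE// d2].
Unshelve. all: by end_near. Qed.

Lemma Ck_flat k n (U : set R) : open U -> Ck k U (flat n).
Proof.
move=> oU.
have D m x : differentiable (flat m) x.
  by apply/derivable1_diffP; have [] := is_derive_flat m x.
elim: k n => [|k IH] n.
  by move=> x _; apply: differentiable_continuous; exact: D.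
split=> [x _|v]; first exact: D.
apply: (@Ck_eq _ _ _ _ _ (fun x => v * (flat n.+2 x - n%:R * flat n.+1 x))) => //.
  move=> x _; rewrite (deriveE _ (D n x)).
  have [_ E1] := is_derive_flat n x.
  rewrite (deriveE _ (D n x)) in E1.
  have E2 : 'd (flat n) x (v *: (1 : R)) = v *: 'd (flat n) x 1 by rewrite linearZ.
  by rewrite E1 /GRing.scale /= mulr1 in E2.
apply: Ck_mul => //; first exact: Ck_cst.
apply: Ck_add => //; apply: Ck_opp => //; apply: Ck_mul => //; exact: Ck_cst.
Qed.

Lemma bump n (y0 : 'rV[R]_n) (r : R) : 0 < r -> exists B : 'rV[R]_n -> R,
  [/\ forall k, Ck k setT B, B y0 != 0 & forall y, B y != 0 -> ball y0 r y].
Proof.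
move=> r0.
(* The norm of row vectors is the sup norm, so the ball in the statement is a cube. The bump is
   [e^(-1/q)], supported on the inscribed Euclidean ball, since a squared Euclidean distance is a
   polynomial and hence smooth. *)
pose q (y : 'rV[R]_n) := r ^+ 2 - \sum_i (y 0 i - y0 0 i) * (y 0 i - y0 0 i).
have oT : open [set: 'rV[R]_n] by exact: openT.
have Cc k i : Ck k setT (fun y : 'rV[R]_n => y 0 i - y0 0 i).
  apply: Ck_add => //; last exact: Ck_cst.
  exact: (Ck_linear oT (fb_diff (fbasis_rV R n) i) (Ck_id k oT)).
exists (flat 0 \o q); split.
- move=> k; apply: (Ck_comp (fbasis_self R) (O := setT)) => //.
    apply: Ck_add => //; first exact: Ck_cst.
    by apply: Ck_opp => //; apply: Ck_sum => // i; apply: Ck_mul.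
  by apply: Ck_flat; exact: openT.
- rewrite /= /flat /q big1; last by move=> i _; rewrite subrr mul0r.
  by rewrite subr0 exprn_gt0// expr0 mul1r gt_eqF// expR_gt0.
- move=> y; rewrite /= /flat; case: ifPn => [qy _|]; last by rewrite eqxx.
  rewrite -ball_normE /= [ltLHS]/Num.Def.normr /= mx_normrE.
  apply: bigmax_lt => // -[i j] _ /=; rewrite !mxE ord1.
  have sq (a : R) : 0 <= a * a by rewrite -expr2 sqr_ge0.
  rewrite -(ltr_pXn2r (n := 2)) ?nnegrE ?(ltW r0)//.
  move: qy; rewrite /q subr_gt0; apply: le_lt_trans.
  rewrite (bigD1 j)//= real_normK ?num_real// -sqrrN opprB -expr2.
  by rewrite lerDl sumr_ge0.
Qed.
End bump.

(** * Integrals of arbitrary functions *)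

Section integrals.
Context d (T : measurableType d) (R : realType).
Variable mu : {measure set T -> \bar R}.
Local Open Scope ereal_scope.
Import HBNNSimple.

(** The integral of a nonnegative function is by definition a supremum over simple functions below
    it, so comparisons can be made on simple functions alone, for integrands of any kind. *)
Lemma ge0_integral_le_sup (f : T -> \bar R) y : (forall x, 0 <= f x) ->
  (forall h : {nnsfun T >-> R}, (forall x, (h x)%:E <= f x) ->
     \int[mu]_x (h x)%:E <= y) -> \int[mu]_x f x <= y.
Proof.
move=> f0 H; rewrite ge0_integralTE//; apply: ge_ereal_sup => _ [h /= hf <-].
by rewrite -integralT_nnsfun; exact: H.
Qed.

Lemma nnsfun_le_integral (f : T -> \bar R) (h : {nnsfun T >-> R}) :
  (forall x, (h x)%:E <= f x) -> \int[mu]_x (h x)%:E <= \int[mu]_x f x.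
Proof.
move=> hf; have f0 x : 0 <= f x by apply: le_trans (hf x); rewrite lee_fin.
rewrite (ge0_integralTE _ f0) integralT_nnsfun; apply: ereal_sup_ubound.
by exists h.
Qed.

Lemma ge0_le_integral_sup (f g : T -> \bar R) :
  (forall x, 0 <= f x) -> (forall x, f x <= g x) ->
  \int[mu]_x f x <= \int[mu]_x g x.
Proof.
move=> f0 fg; apply: ge0_integral_le_sup => // h hf.
by apply: nnsfun_le_integral => x; exact: le_trans (hf x) (fg x).
Qed.

(** A simple function below [f] vanishes off [U], hence almost everywhere. *)
Lemma ge0_integral_null (U : set T) (f : T -> \bar R) :
  measurable U -> mu U = 0 -> (forall x, 0 <= f x) ->
  (forall x, ~ U x -> f x = 0) -> \int[mu]_x f x = 0.
Proof.
move=> mU U0 f0 fU; apply/eqP; rewrite eq_le; apply/andP; split; last exact: integral_ge0.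
apply: ge0_integral_le_sup => // h hf.
have -> : \int[mu]_x (h x)%:E = \int[mu]_x (cst 0 x).
  apply: ge0_ae_eq_integral => //.
    by apply/measurable_EFinP.
    by move=> x _; rewrite lee_fin.
  exists U; split => // x /= /not_implyP[_ hx].
  apply: contrapT => nU; apply: hx; apply/eqP; rewrite eq_le.
  by rewrite -(fU x nU) hf fU//= lee_fin.
by rewrite integral0.
Qed.

Lemma integral_null (U : set T) (f : T -> \bar R) :
  measurable U -> mu U = 0 -> (forall x, ~ U x -> f x = 0) -> \int[mu]_x f x = 0.
Proof.
move=> mU U0 fU; rewrite integralE.
rewrite (ge0_integral_null mU U0) ?(ge0_integral_null mU U0) ?sube0//.
- by move=> x nU; rewrite funenegE fU// oppe0 maxxx.
- by move=> x nU; rewrite funeposE fU// maxxx.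
Qed.

(** Markov's inequality at level [e]. *)
Lemma measure0_of_integral0 (U : set T) (f : T -> \bar R) (e : R) :
  measurable U -> (0 < e)%R -> (forall x, 0 <= f x) -> (forall x, U x -> e%:E <= f x) ->
  \int[mu]_x f x = 0 -> mu U = 0.
Proof.
move=> mU e0 f0 fU If.
have h1 : \int[mu]_x (e * \1_U x)%:E <= 0.
  rewrite -If; apply: ge0_le_integral_sup => x.
    by rewrite lee_fin mulr_ge0// ltW.
  rewrite indicE; case: (boolP (x \in U)) => [/set_mem/fU|_]; first by rewrite mulr1.
  by rewrite mulr0.
have h2 : \int[mu]_x (e * \1_U x)%:E = e%:E * mu U.
  under eq_integral do rewrite EFinM.
  rewrite ge0_integralZl_EFin//; last 2 first.
    by apply/measurable_EFinP; exact: measurable_indic.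
    exact: ltW.
  by rewrite integral_indic// setIT.
apply/eqP; rewrite eq_le measure_ge0 andbT.
by move: h1; rewrite h2 pmule_rle0// lte_fin.
Qed.

(** A simple function [h] below [f] has the same integral as [h] composed with [phi], which lies
    below [f] composed with [phi]. A simple function below the latter need not factor through [phi],
    so this argument yields one inequality only. *)
Lemma ge0_integral_preserving_le (phi : T -> T) (f : T -> \bar R) :
  measurable_fun setT phi -> (forall A, measurable A -> mu (phi @^-1` A) = mu A) ->
  (forall x, 0 <= f x) -> \int[mu]_x f x <= \int[mu]_x f (phi x).
Proof.
move=> mphi inv f0; apply: ge0_integral_le_sup => // h hf.
pose phiM := isMeasurableFun.Build _ _ _ _ _ mphi.
pose phiP : {mfun _ >-> _} := HB.pack phi phiM.
have -> : \int[mu]_x (h x)%:E = \int[pushforward mu phiP]_x (h x)%:E.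
  by apply: eq_measure_integral => A mA _; rewrite /= /pushforward inv.
rewrite (ge0_integral_pushforward mphi) //; last 2 first.
- by apply/measurable_EFinP.
- by move=> x _; rewrite lee_fin.
by apply: ge0_le_integral_sup => x /=; [rewrite lee_fin|exact: hf].
Qed.

(** The one-sided inequality for [psi], applied to [f] composed with [phi], is the reverse
    inequality. The general case follows by splitting into positive and negative parts. *)
Lemma integral_preserving (phi psi : T -> T) (f : T -> \bar R) :
  measurable_fun setT phi -> measurable_fun setT psi -> cancel psi phi ->
  (forall A, measurable A -> mu (phi @^-1` A) = mu A) ->
  (forall A, measurable A -> mu (psi @^-1` A) = mu A) ->
  \int[mu]_x f (phi x) = \int[mu]_x f x.
Proof.
move=> mphi mpsi K inv inv'.
have H (g : T -> \bar R) : (forall x, 0 <= g x) ->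
    \int[mu]_x g (phi x) = \int[mu]_x g x.
  move=> g0; apply/eqP; rewrite eq_le; apply/andP; split; last first.
    exact: ge0_integral_preserving_le.
  have := ge0_integral_preserving_le mpsi inv' (fun x => g0 (phi x)).
  by under [X in _ <= X -> _]eq_integral do rewrite K.
rewrite integralE [RHS]integralE.
rewrite -(H (f^\+) (funepos_ge0 f)) -(H (f^\-) (funeneg_ge0 f)).
by congr (_ - _); apply: eq_integral => x _; rewrite ?funeposE ?funenegE.
Qed.

End integrals.

(** * Smooth maps into manifolds *)

Lemma Ck_comp_mx (R : realType) (V W : normedModType R) (B : fbasis W) k p q
    (U : set V) (O : set W) (f : W -> 'M[R]_(p, q)) (g : V -> W) :
  open U -> open O -> (forall x, U x -> O (g x)) -> Ck k U g -> Ck k O f -> Ck k U (f \o g).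
Proof.
move=> oU oO UO Cg Cf; apply/Ck_mxP => // i j.
have Cfij := (Ck_mxP k f oO).1 Cf i j.
exact: (Ck_comp B oU UO Cg Cfij).
Qed.

Lemma open_preim (T S : topologicalType) (U : set T) (A : set S) (phi : T -> S) :
  open U -> open A -> (forall v, U v -> {for v, continuous phi}) ->
  open [set v | U v /\ A (phi v)].
Proof.
move=> oU oA c; rewrite openE => v [Uv Av].
have n1 : nbhs v U by apply: open_nbhs_nbhs.
have n2 : nbhs v (phi @^-1` A) by apply: (c v Uv); apply: open_nbhs_nbhs.
by apply: filterS (filterI n1 n2) => w [].
Qed.

Section charts.
Variables (R : realType) (m : nat) (M : manifold R m).
Implicit Types (c d : chart R m M) (V W : normedModType R).

Lemma cimgP c y : cimg c y -> cdom c (cinv c y) /\ cmap c (cinv c y) = y.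
Proof. by case=> x cx <-; rewrite cmapK. Qed.

Lemma cimg_map c x : cdom c x -> cimg c (cmap c x).
Proof. by move=> cx; exists x. Qed.

Lemma open_cimg c : open (cimg c).
Proof. exact: cimg_open. Qed.

(** The source is an open part of any normed space, so that curves, inverse charts and flows written
    in coordinates on [R * 'rV_m] fall under one notion. *)
Definition smooth_into V (U : set V) (phi : V -> M) : Prop :=
  (forall v, U v -> {for v, continuous phi}) /\
  forall d, @atlas R m M d -> smooth_on [set v | U v /\ cdom d (phi v)] (cmap d \o phi).

(* The image of w under the differential of phi at v, as a vector of T_(phi v) M. *)
Definition tvec V (phi : V -> M) (v w : V) : 'rV[R]_m :=
  'D_w (cmap (chart_at (phi v)) \o phi) v.

Lemma overlap_open c d : open (cmap c @` (cdom c `&` cdom d)).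
Proof.
have -> : cmap c @` (cdom c `&` cdom d) = [set y | cimg c y /\ cdom d (cinv c y)].
  apply/seteqP; split=> [_ [x [cx dx] <-]|y [cy dy]] /=.
    by split; [exact: cimg_map|rewrite cmapK].
  by have [h1 h2] := cimgP cy; exists (cinv c y).
apply: open_preim; [exact: open_cimg|exact: cdom_open|].
by move=> y cy; exact: (@cinv_continuous _ _ _ c).
Qed.

Lemma overlap_in c d x : cdom c x -> cdom d x -> (cmap c @` (cdom c `&` cdom d)) (cmap c x).
Proof. by move=> cx dx; exists x. Qed.

Lemma smooth_change V (U : set V) (phi : V -> M) c d k : open U ->
  @atlas R m M c -> @atlas R m M d ->
  (forall v, U v -> cdom c (phi v)) -> (forall v, U v -> cdom d (phi v)) ->
  Ck k U (cmap c \o phi) -> Ck k U (cmap d \o phi).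
Proof.
move=> oU ac ad cU dU Cc.
apply: (@Ck_eq _ _ _ _ _ ((cmap d \o cinv c) \o (cmap c \o phi))) => //.
  by move=> v Uv /=; rewrite cmapK//; exact: cU.
apply: (Ck_comp_mx (fbasis_rV R m) oU (@overlap_open c d)) => //.
  by move=> v Uv; apply: overlap_in; [exact: cU|exact: dU].
exact: atlas_compat.
Qed.

Lemma smooth_into_local V (U : set V) (phi : V -> M) : open U ->
  (forall v, U v -> {for v, continuous phi}) ->
  (forall v, U v -> exists c (U' : set V), [/\ open U', U' v, @atlas R m M c,
     forall w, U' w -> cdom c (phi w) & smooth_on U' (cmap c \o phi)]) ->
  smooth_into U phi.
Proof.
move=> oU cphi H; split=> // d ad k; apply: Ck_local => v [Uv dv].
have [c [U' [oU' U'v ac cU' sU']]] := H v Uv.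
exists (U' `&` [set w | U w /\ cdom d (phi w)]) => //.
apply: (@smooth_change _ _ phi c d) => //.
- by apply: openI => //; apply: open_preim => //; exact: cdom_open.
- by move=> w [U'w _]; exact: cU'.
- by move=> w [_ []].
- by apply: Ck_sub (sU' k) => w [].
Qed.

Lemma smooth_into_open V (U : set V) (phi : V -> M) d : open U ->
  smooth_into U phi -> open [set v | U v /\ cdom d (phi v)].
Proof. by move=> oU [h _]; apply: open_preim => //; exact: cdom_open. Qed.

Lemma smooth_into_cst V (U : set V) (x : M) : smooth_into U (fun=> x).
Proof.
split=> [v _|d ad k]; first exact: cst_continuous.
exact: (Ck_cst k _ (cmap d x)).
Qed.

Lemma smooth_into_cinv c : @atlas R m M c -> smooth_into (cimg c) (cinv c).
Proof.
move=> ac; split=> [y cy|d ad k]; first exact: (@cinv_continuous _ _ _ c).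
apply: Ck_sub (atlas_compat ac ad k) => y [cy dy].
by have [h1 h2] := cimgP cy; exists (cinv c y).
Qed.

Lemma smooth_into_precomp V W (B : fbasis W) (U : set V) (O : set W) (phi : W -> M) (g : V -> W) :
  open U -> open O -> (forall v, U v -> O (g v)) -> smooth_on U g ->
  smooth_into O phi -> smooth_into U (phi \o g).
Proof.
move=> oU oO UO sg sphi; have [cphi dphi] := sphi.
have cg v : U v -> {for v, continuous g} by exact: (sg 0).
have co v : U v -> {for v, continuous (phi \o g)}.
  by move=> Uv; apply: continuous_comp; [exact: cg|apply: cphi; exact: UO].
split=> // d ad k.
apply: (@Ck_comp_mx R V W B k 1 m [set v | U v /\ cdom d (phi (g v))]
  [set v | O v /\ cdom d (phi v)] (cmap d \o phi) g).
- by apply: open_preim oU _ co; exact: cdom_open.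
- exact: smooth_into_open.
- by move=> v [Uv dv]; split=> //; exact: UO.
- by apply: Ck_sub (sg k) => v [].
- exact: dphi.
Qed.

Lemma smooth_into_continuous V (U : set V) (phi : V -> M) v :
  smooth_into U phi -> U v -> {for v, continuous phi}.
Proof. by case=> h _; exact: h. Qed.

Lemma smooth_into_diff V (U : set V) (phi : V -> M) v d :
  smooth_into U phi -> U v -> @atlas R m M d -> cdom d (phi v) ->
  differentiable (cmap d \o phi) v.
Proof. by move=> [_ h] Uv ad dv; have [h1 _] := h d ad 1; exact: (h1 v (conj Uv dv)). Qed.

(** [tvec] is expressed in [chart_at (phi v)], which may jump as [v] moves. In a fixed chart [d] the
    jump is confined to the factor [frame], the same factor that [form1_in] and [bilinear_in]
    contain; this is how pairings of a smooth form with [tvec] become smooth functions. *)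
Lemma tvec_frame V (phi : V -> M) v w d : @atlas R m M d -> cdom d (phi v) ->
  {for v, continuous phi} -> differentiable (cmap d \o phi) v ->
  tvec phi v w = 'D_w (cmap d \o phi) v *m frame d (cmap d (phi v)).
Proof.
move=> ad dv cphi df; rewrite /tvec /frame cmapK//.
set c := chart_at (phi v).
have cv : cdom c (phi v) by exact: chart_at_dom.
have ac : atlas c by exact: chart_at_atlas.
have dch : differentiable (cmap c \o cinv d) (cmap d (phi v)).
  have [h _] := atlas_compat ad ac 1; apply: h; exact: overlap_in.
have -> : 'D_w (cmap c \o phi) v = 'D_w ((cmap c \o cinv d) \o (cmap d \o phi)) v.
  apply: near_eq_derive.
  have n : \forall u \near v, cdom d (phi u).
    by apply: cphi; apply: open_nbhs_nbhs; split=> //; exact: cdom_open.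
  by apply: filterS n => u du /=; rewrite cmapK.
by rewrite (derive_comp _ df dch) -(deriveEjacobian _ dch) (deriveE _ dch).
Qed.

Lemma tvec_chart_at (x : M) w :
  tvec (cinv (chart_at x)) (cmap (chart_at x) x) w = w.
Proof.
set c := chart_at x; have cx : cdom c x by exact: chart_at_dom.
rewrite /tvec cmapK//.
have -> : 'D_w (cmap (chart_at x) \o cinv c) (cmap c x) = 'D_w id (cmap c x).
  apply: (derive_open_eq w (@open_cimg c) (cimg_map cx)) => y cy /=.
  by have [] := cimgP cy.
exact: derive_id.
Qed.

Lemma frame_tvec c y w : @atlas R m M c -> cimg c y -> w *m frame c y = tvec (cinv c) y w.
Proof.
move=> ac cy; rewrite /tvec /frame deriveEjacobian//.
apply: (smooth_into_diff (smooth_into_cinv ac) cy); [exact: chart_at_atlas|exact: chart_at_dom].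
Qed.

Lemma frame_chart_at (x : M) : frame (chart_at x) (cmap (chart_at x) x) = 1%:M.
Proof.
apply/row_matrixP => i; rewrite !rowE mulmx1 frame_tvec ?tvec_chart_at//.
  exact: chart_at_atlas.
by apply: cimg_map; exact: chart_at_dom.
Qed.

(** The Jacobian of the opposite transition map is a left inverse. *)
Lemma frame_unit c y : @atlas R m M c -> cimg c y -> frame c y \in unitmx.
Proof.
move=> ac cy; have [cx Ey] := cimgP cy.
set x := cinv c y in cx Ey *; set d := chart_at x.
have dx : cdom d x by exact: chart_at_dom.
have ad : atlas d by exact: chart_at_atlas.
have xE : cinv d (cmap d x) = x by exact: cmapK.
have sd := smooth_into_cinv ad; have dd := cimg_map dx.
have df : differentiable (cmap c \o cinv d) (cmap d x).
  by apply: (smooth_into_diff sd dd) => //; rewrite xE.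
have E : jacobian (cmap c \o cinv d) (cmap d x) *m frame c y = 1%:M.
  apply/row_matrixP => i; rewrite !rowE mulmx1 mulmxA -deriveEjacobian//.
  have cdx : cdom c (cinv d (cmap d x)) by rewrite xE.
  have T := tvec_frame (delta_mx 0 i) ac cdx (smooth_into_continuous sd dd) df.
  rewrite xE Ey in T.
  by rewrite -T; exact: tvec_chart_at.
by have [] := mulmx1_unit E.
Qed.

End charts.

(** * Smooth maps between manifolds and their differentials *)

Section morphisms.
Variables (R : realType).
Implicit Types (V W : normedModType R).

(** The form of smoothness that the slices of a [smooth_map2] provide directly: a chart is fixed on
    the source only. *)
Definition smooth_mor m n (M : manifold R m) (N : manifold R n) (F : M -> N) : Prop :=
  forall c, @atlas R m M c -> smooth_into (cimg c) (F \o cinv c).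

Lemma smooth_into_map2 m n p (M : manifold R m) (N : manifold R n) (P : manifold R p)
    (F : M -> N -> P) V (U : set V) (phi : V -> M) (psi : V -> N) :
  smooth_map2 F -> open U -> smooth_into U phi -> smooth_into U psi ->
  smooth_into U (fun v => F (phi v) (psi v)).
Proof.
move=> [cF dF] oU sphi spsi.
have co v : U v -> {for v, continuous (fun v => F (phi v) (psi v))}.
  move=> Uv.
  have h : {for v, continuous (fun v => (phi v, psi v))}.
    apply: (@cvg_pair _ _ _ _ (nbhs (phi v)) (nbhs (psi v))).
      exact: smooth_into_continuous sphi Uv.
    exact: smooth_into_continuous spsi Uv.
  exact: (@continuous_comp _ _ _ (fun v => (phi v, psi v)) (fun z => F z.1 z.2) v h (cF _)).
apply: smooth_into_local => // v Uv.
set c := chart_at (phi v); set c' := chart_at (psi v).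
set d := chart_at (F (phi v) (psi v)).
have ac : atlas c by exact: chart_at_atlas.
have ac' : atlas c' by exact: chart_at_atlas.
have ad : atlas d by exact: chart_at_atlas.
have o1 : open [set v | U v /\ cdom c (phi v)] by exact: smooth_into_open.
have o2 : open [set v | U v /\ cdom c' (psi v)] by exact: smooth_into_open.
have o3 : open [set v | U v /\ cdom d (F (phi v) (psi v))].
  by apply: open_preim => //; exact: cdom_open.
pose U' := [set v | U v /\ cdom c (phi v)] `&` [set v | U v /\ cdom c' (psi v)] `&`
  [set v | U v /\ cdom d (F (phi v) (psi v))].
have oU' : open U' by do 2! [apply: openI => //].
have inO w : U' w -> [/\ cimg c (cmap c (phi w)), cimg c' (cmap c' (psi w)) &
    cdom d (F (cinv c (cmap c (phi w))) (cinv c' (cmap c' (psi w))))].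
  move=> [[[Uw cw] [_ c'w]] [_ dw]].
  by split; [exact: cimg_map|exact: cimg_map|rewrite !cmapK].
exists d, U'; split=> //.
- by split; first split; split=> //; exact: chart_at_dom.
- by move=> w [_ []].
move=> k.
set O := [set y : 'rV[R]_m * 'rV[R]_n | [/\ cimg c y.1, cimg c' y.2 &
                      cdom d (F (cinv c y.1) (cinv c' y.2))]].
have oO : open O.
  pose O' := (cimg c : set 'rV[R]_m) `*` (cimg c' : set 'rV[R]_n).
  have oO' : open O'.
    have -> : O' = [set y | [set: 'rV[R]_m * 'rV[R]_n] y /\ cimg c y.1] `&`
        [set y | [set: 'rV[R]_m * 'rV[R]_n] y /\ cimg c' y.2].
      by apply/seteqP; split=> y /=; [case|case=> -[_ ?] [_ ?]].
    apply: openI; apply: open_preim openT (@open_cimg _ _ _ _) _ => -[? ?] _.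
      exact: cvg_fst.
    exact: cvg_snd.
  have -> : O = [set y | O' y /\ cdom d (F (cinv c y.1) (cinv c' y.2))].
    by apply/seteqP; split=> y /=; [case=> *; split|case=> -[? ?] ?; split].
  apply: (open_preim oO'); first exact: cdom_open.
  move=> y [cy c'y].
  have h : {for y, continuous (fun y : 'rV[R]_m * 'rV[R]_n => (cinv c y.1, cinv c' y.2))}.
    apply: (@cvg_pair _ _ _ _ (nbhs (cinv c y.1)) (nbhs (cinv c' y.2))).
      apply: (@continuous_comp _ _ _ fst (cinv c)); first by case: y {cy c'y} => ? ?; exact: cvg_fst.
      exact: cinv_continuous.
    apply: (@continuous_comp _ _ _ snd (cinv c')); first by case: y {cy c'y} => ? ?; exact: cvg_snd.
    exact: cinv_continuous.
  exact: (@continuous_comp _ _ _ _ (fun z => F z.1 z.2) y h (cF _)).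
apply: (@Ck_eq _ _ _ _ _ ((fun y => cmap d (F (cinv c y.1) (cinv c' y.2))) \o
    (fun w => (cmap c (phi w), cmap c' (psi w))))) => //.
  by move=> w [[[Uw cw] [_ c'w]] _] /=; rewrite !cmapK.
apply: (@Ck_comp_mx R V _ (fbasis_prod (fbasis_rV R m) (fbasis_rV R n)) k 1 p U' O) => //.
  apply: Ck_pair => //.
    by have [_ h] := sphi; apply: Ck_sub (h c ac k) => w [[]].
  by have [_ h] := spsi; apply: Ck_sub (h c' ac' k) => w [[]].
exact: dF.
Qed.

Lemma smooth_into_curve m (M : manifold R m) (gam : R -> M) :
  smooth_curve gam -> smooth_into setT gam.
Proof.
move=> [c h]; split=> [t _|d ad k]; first exact: c.
by apply: Ck_sub (h d ad k) => t [].
Qed.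

Lemma velocity_tvec m (M : manifold R m) (gam : R -> M) t :
  velocity gam t = tvec gam t 1.
Proof. by rewrite /velocity derive1E. Qed.

Section one_map.
Variables (m n : nat) (M : manifold R m) (N : manifold R n) (F : M -> N).
Hypothesis sF : smooth_mor F.

Lemma smooth_mor_continuous : continuous F.
Proof.
move=> x; have ac := @chart_at_atlas _ _ M x; have cx := @chart_at_dom _ _ M x.
have sc := sF ac; have cc := cimg_map cx.
have h := smooth_into_continuous sc cc.
have h1 : {for x, continuous (F \o cinv (chart_at x) \o cmap (chart_at x))}.
  by apply: continuous_comp => //; exact: cmap_continuous.
rewrite /continuous_at -[in F x](cmapK cx).
apply: cvg_trans h1; apply: near_eq_cvg.
by apply: (open_near (@cdom_open _ _ _ _) cx) => y cy /=; rewrite cmapK.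
Qed.

Lemma smooth_into_comp V (U : set V) (phi : V -> M) : open U ->
  smooth_into U phi -> smooth_into U (F \o phi).
Proof.
move=> oU sphi.
have co v : U v -> {for v, continuous (F \o phi)}.
  move=> Uv; apply: continuous_comp; first exact: smooth_into_continuous sphi Uv.
  exact: smooth_mor_continuous.
apply: smooth_into_local => // v Uv.
set c := chart_at (phi v); set d := chart_at (F (phi v)).
have ac : atlas c by exact: chart_at_atlas.
have ad : atlas d by exact: chart_at_atlas.
pose U' := [set v | U v /\ cdom c (phi v)] `&` [set v | U v /\ cdom d (F (phi v))].
have oU' : open U'.
  apply: openI; first exact: smooth_into_open.
  by apply: (open_preim oU _ co); exact: cdom_open.
exists d, U'; split=> //.
- by split; split=> //; exact: chart_at_dom.
- by move=> w [_ []].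
move=> k.
apply: (@Ck_eq _ _ _ _ _ ((cmap d \o (F \o cinv c)) \o (cmap c \o phi))) => //.
  by move=> w [[_ cw] _] /=; rewrite cmapK.
apply: (@Ck_comp_mx R V _ (fbasis_rV R m) k 1 n U'
    [set y | cimg c y /\ cdom d ((F \o cinv c) y)]) => //.
- exact: (smooth_into_open d (@open_cimg _ _ _ c) (sF ac)).
- move=> w [[Uw cw] [_ dw]]; split; first exact: cimg_map.
  by rewrite /= cmapK.
- by have [_ h] := sphi; apply: Ck_sub (h c ac k) => w [].
- by have [_ h] := sF ac; exact: h.
Qed.

Lemma tvec_comp V (U : set V) (phi : V -> M) v w : open U ->
  smooth_into U phi -> U v ->
  tvec (F \o phi) v w = tvec phi v w *m tangent_map F (phi v).
Proof.
move=> oU sphi Uv; rewrite /tvec /tangent_map.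
set c := chart_at (phi v); set d := chart_at (F (phi v)).
have ac : atlas c by exact: chart_at_atlas.
have ad : atlas d by exact: chart_at_atlas.
have cv : cdom c (phi v) by exact: chart_at_dom.
have dv : cdom d (F (phi v)) by exact: chart_at_dom.
have df : differentiable (cmap c \o phi) v := smooth_into_diff sphi Uv ac cv.
have dF : differentiable (cmap d \o (F \o cinv c)) (cmap c (phi v)).
  by apply: (smooth_into_diff (sF ac) (cimg_map cv)) => //=; rewrite cmapK.
have o := smooth_into_open c oU sphi.
have -> : 'D_w (cmap d \o (F \o phi)) v =
    'D_w ((cmap d \o (F \o cinv c)) \o (cmap c \o phi)) v.
  apply: (derive_open_eq w o) => //= u [_ cu]; by rewrite /= cmapK.
by rewrite (derive_comp _ df dF) -(deriveEjacobian _ dF) (deriveE _ dF).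
Qed.

End one_map.

Section functions.
Variables (m : nat) (M : manifold R m).

Lemma smooth_on_fun (h : M -> R) V (U : set V) (phi : V -> M) : open U ->
  smooth_fun h -> smooth_into U phi -> smooth_on U (h \o phi).
Proof.
move=> oU sh sphi k; apply: Ck_local => v Uv.
have ac := @chart_at_atlas _ _ M (phi v).
set c := chart_at (phi v) in ac *.
exists [set v | U v /\ cdom c (phi v)]; first by split=> //; exact: chart_at_dom.
have o := smooth_into_open c oU sphi.
apply: (@Ck_eq _ _ _ _ _ ((h \o cinv c) \o (cmap c \o phi))) => //.
  by move=> w [_ cw] /=; rewrite cmapK.
apply: (Ck_comp (fbasis_rV R m) o (O := cimg c)).
- by move=> w [_ cw]; exact: cimg_map.
- by have [_ h1] := sphi; exact: h1.
- exact: sh.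
Qed.

Lemma derive_d0 (h : M -> R) V (U : set V) (phi : V -> M) v w : open U ->
  smooth_fun h -> smooth_into U phi -> U v ->
  'D_w (h \o phi) v = pairing (tvec phi v w) (d0 h (phi v)).
Proof.
move=> oU sh sphi Uv.
have ac := @chart_at_atlas _ _ M (phi v); have cv := @chart_at_dom _ _ M (phi v).
rewrite /pairing pairing_sum /d0 /tvec /partial.
set c := chart_at (phi v) in ac cv *.
have df : differentiable (cmap c \o phi) v := smooth_into_diff sphi Uv ac cv.
have dh : differentiable (h \o cinv c) (cmap c (phi v)).
  by have [h1 _] := sh c ac 1; apply: h1; exact: cimg_map.
have o := smooth_into_open c oU sphi.
have -> : 'D_w (h \o phi) v = 'D_w ((h \o cinv c) \o (cmap c \o phi)) v.
  by apply: (derive_open_eq w o) => //= u [_ cu]; rewrite /= cmapK.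
rewrite (derive_comp _ df dh) -(deriveE _ dh) (derive_rV _ dh).
by apply: eq_bigr => i _; rewrite !mxE.
Qed.

(** In a fixed chart the pairing is the sum of derivatives of the coordinates of [phi] times the
    coefficients of [b], both smooth, although neither factor of the original pairing need depend
    continuously on the point. *)
Lemma smooth_on_pairing (b : form1 M) V (U : set V) (phi : V -> M) w : open U ->
  smooth_form1 b -> smooth_into U phi ->
  smooth_on U (fun v => pairing (tvec phi v w) (b (phi v))).
Proof.
move=> oU sb sphi k; apply: Ck_local => v Uv.
have ac := @chart_at_atlas _ _ M (phi v).
set c := chart_at (phi v) in ac *.
set U' := [set v | U v /\ cdom c (phi v)].
exists U'; first by split=> //; exact: chart_at_dom.
have o : open U' := smooth_into_open c oU sphi.
have C1 k' : Ck k' U' (cmap c \o phi) by have [_ h] := sphi; exact: h.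
apply: (@Ck_eq _ _ _ _ _ (fun v => \sum_i ('D_w (cmap c \o phi) v) 0 i *
    form1_in c b (cmap c (phi v)) i 0)) => //.
  move=> u [Uu cu]; rewrite /pairing.
  rewrite (tvec_frame w ac cu (smooth_into_continuous sphi Uu)
    (smooth_into_diff sphi Uu ac cu)).
  by rewrite -mulmxA pairing_sum /form1_in cmapK.
apply: Ck_sum => // i; apply: Ck_mul => //.
  by have [_ h] := C1 k.+1; exact: ((Ck_mxP k (fun v => 'D_w (cmap c \o phi) v) o).1 (h w) 0 i).
have h : Ck k U' (form1_in c b \o (cmap c \o phi)).
  apply: (Ck_comp_mx (fbasis_rV R m) o (@open_cimg _ _ _ c)) => //.
    by move=> u [_ cu]; exact: cimg_map.
  exact: sb.
exact: ((Ck_mxP k _ o).1 h i 0).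
Qed.

End functions.
End morphisms.

(** * Pullbacks of closed forms *)

Lemma sum3_rot (R : ringType) m (f : 'I_m -> 'I_m -> 'I_m -> R) :
  \sum_a \sum_b \sum_c f a b c = \sum_c \sum_a \sum_b f a b c.
Proof.
rewrite [RHS]exchange_big /=; apply: eq_bigr => a _; exact: exchange_big.
Qed.

(** The algebra behind the commutation of [d] with the pullback of a 2-form. The [d1], [d2], [d3]
    stand for first derivatives of the coordinates of a map in three directions, [d12], [d13], [d23]
    for the mixed second ones, [b] for the coefficients of the form and [db] for their
    derivatives. *)
Lemma cyclic_sum (R : comRingType) m (d1 d2 d3 d12 d13 d23 : 'I_m -> R)
    (b : 'I_m -> 'I_m -> R) (db : 'I_m -> 'I_m -> 'I_m -> R) :
  (forall i j, b i j = - b j i) ->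
  (forall i j k, db i j k + db j k i + db k i j = 0) ->
  \sum_i \sum_j ((d12 i * d3 j + d2 i * d13 j) * b i j +
     d2 i * d3 j * (\sum_k d1 k * db k i j)) +
  \sum_i \sum_j ((d23 i * d1 j + d3 i * d12 j) * b i j +
     d3 i * d1 j * (\sum_k d2 k * db k i j)) +
  \sum_i \sum_j ((d13 i * d2 j + d1 i * d23 j) * b i j +
     d1 i * d2 j * (\sum_k d3 k * db k i j)) = 0.
Proof.
move=> alt cyc.
(* [S] evaluates the form on two vectors and collects the second derivatives, which cancel in pairs
   by antisymmetry; [T] evaluates the derivative of the form and vanishes in cyclic sum by
   closedness. *)
pose S (x y : 'I_m -> R) := \sum_i \sum_j x i * y j * b i j.
pose T (x y z : 'I_m -> R) := \sum_k \sum_i \sum_j x k * y i * z j * db k i j.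
have SC x y : S x y = - S y x.
  rewrite /S [in RHS]exchange_big /= -sumrN; apply: eq_bigr => i _.
  rewrite -sumrN; apply: eq_bigr => j _; rewrite (alt i j); ring.
have E (x y z xy xz : 'I_m -> R) :
    \sum_i \sum_j ((xy i * z j + y i * xz j) * b i j + y i * z j * (\sum_k x k * db k i j)) =
    S xy z + S y xz + T x y z.
  rewrite /T -sum3_rot /S -!big_split /=; apply: eq_bigr => i _.
  rewrite -!big_split /=; apply: eq_bigr => j _.
  rewrite mulrDl big_distrr /=; congr (_ + _); apply: eq_bigr => k _; ring.
have T0 : T d1 d2 d3 + T d2 d3 d1 + T d3 d1 d2 = 0.
  have -> : T d2 d3 d1 = \sum_k \sum_i \sum_j d2 i * d3 j * d1 k * db i j k.
    by rewrite /T sum3_rot.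
  have -> : T d3 d1 d2 = \sum_k \sum_i \sum_j d3 j * d1 k * d2 i * db j k i.
    by rewrite /T -sum3_rot.
  rewrite /T -!big_split /= big1// => k _; rewrite -!big_split /= big1// => i _.
  rewrite -!big_split /= big1// => j _.
  transitivity (d1 k * d2 i * d3 j * (db k i j + db i j k + db j k i)); first by ring.
  by rewrite cyc mulr0.
rewrite !E (SC d2 d13) (SC d3 d12) (SC d1 d23) -[RHS]T0; ring.
Qed.

Section euclid.
Variable (R : realType) (V : normedModType R) (m : nat).
Variables (U : set V) (O : set 'rV[R]_m) (psi : V -> 'rV[R]_m) (v : V).
Hypotheses (oU : open U) (Uv : U v) (spsi : smooth_on U psi) (UO : forall u, U u -> O (psi u)).

Lemma is_derive_bigsum (W : normedModType R) (I : finType) (h : I -> W -> R) (dh : I -> R) (x w : W) :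
  (forall i, is_derive x w (h i) (dh i)) ->
  is_derive x w (fun y => \sum_i h i y) (\sum_i dh i).
Proof.
move=> H; elim: (index_enum I) => [|i r IH].
  have -> : (fun y => \sum_(i <- [::]) h i y) = cst 0.
    by apply/funext => s; rewrite big_nil.
  by rewrite big_nil; exact: is_derive_cst.
have -> : (fun y => \sum_(j <- i :: r) h j y) =
    (fun y => h i y + \sum_(j <- r) h j y).
  by apply/funext => s; rewrite big_cons.
by rewrite big_cons; apply: is_deriveD.
Qed.

Lemma is_derive_prod (W : normedModType R) (f g : W -> R) (x w : W) (df dg : R) :
  is_derive x w f df -> is_derive x w g dg ->
  is_derive x w (fun y => f y * g y) (df * g x + f x * dg).
Proof.
move=> hf hg; have := is_deriveM hf hg.
by rewrite addrC /GRing.scale /= (mulrC (g x)).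
Qed.

Let p i u := psi u 0 i : R.

Lemma coord_smooth i : smooth_on U (p i).
Proof. by move=> k; exact: (Ck_mxP k psi oU).1 (spsi k) 0 i. Qed.

Lemma coord_derive w u i : U u -> ('D_w psi u) 0 i = 'D_w (p i) u.
Proof.
move=> Uu; symmetry.
have h : forall w : 'rV[R]_m, is_diff w (fun A : 'rV[R]_m => A 0 i : R) (fun A => A 0 i).
  by move=> x; exact: is_diff_coord.
apply: (derive_lin_comp w h).
by have [h1 _] := spsi 1; exact: h1.
Qed.

Lemma is_derive_dp i w1 w2 :
  is_derive v w1 (fun u => 'D_w2 (p i) u) ('D_w1 (fun u => 'D_w2 (p i) u) v).
Proof.
apply: derivableP; apply: diff_derivable.
have [_ h1] := coord_smooth i 2; have [h2 _] := h1 w2; exact: h2.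
Qed.

Lemma is_derive_bpsi (b : 'rV[R]_m -> R) w : Ck 1 O b ->
  is_derive v w (fun u => b (psi u)) (\sum_k 'D_w (p k) v * partial k b (psi v)).
Proof.
move=> [Cb _].
have dpsi : differentiable psi v by have [h1 _] := spsi 1; exact: h1.
have db : differentiable b (psi v) by apply: Cb; exact: UO.
have H : derivable (b \o psi) v w.
  by apply: diff_derivable; exact: differentiable_comp.
have := derivableP H.
by rewrite (derive_comp_basis (fbasis_rV R m) w dpsi db).
Qed.

Lemma schwarz_p i w1 w2 :
  'D_w1 (fun u => 'D_w2 (p i) u) v = 'D_w2 (fun u => 'D_w1 (p i) u) v.
Proof. exact: (Schwarz _ _ oU Uv (coord_smooth i 2)). Qed.

(** By the product rule each side splits into second derivatives of [psi], symmetric by Schwarz, and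
    first derivatives of the coefficients, symmetric by closedness. *)
Lemma closed_pullback_rV (b : 'I_m -> 'rV[R]_m -> R) w1 w2 :
  (forall i, Ck 1 O (b i)) ->
  (forall i j, partial i (b j) (psi v) = partial j (b i) (psi v)) ->
  'D_w1 (fun u => \sum_i 'D_w2 (p i) u * b i (psi u)) v =
  'D_w2 (fun u => \sum_i 'D_w1 (p i) u * b i (psi u)) v.
Proof.
move=> Cb sym.
have E a1 a2 : 'D_a1 (fun u => \sum_i 'D_a2 (p i) u * b i (psi u)) v =
    \sum_i 'D_a1 (fun u => 'D_a2 (p i) u) v * b i (psi v) +
    \sum_i \sum_k 'D_a2 (p i) v * 'D_a1 (p k) v * partial k (b i) (psi v).
  have H := is_derive_bigsum (fun i => is_derive_prod (is_derive_dp i a1 a2)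
     (is_derive_bpsi a1 (Cb i))).
  rewrite (derive_val (is_derive := H)) big_split /=; congr (_ + _).
  by apply: eq_bigr => i _; rewrite big_distrr /=; apply: eq_bigr => k _; rewrite mulrA.
have Q1 : \sum_i 'D_w1 (fun u => 'D_w2 (p i) u) v * b i (psi v) =
    \sum_i 'D_w2 (fun u => 'D_w1 (p i) u) v * b i (psi v).
  by apply: eq_bigr => i _; rewrite schwarz_p.
have Q2 : \sum_i \sum_k 'D_w2 (p i) v * 'D_w1 (p k) v * partial k (b i) (psi v) =
    \sum_i \sum_k 'D_w1 (p i) v * 'D_w2 (p k) v * partial k (b i) (psi v).
  rewrite exchange_big /=; apply: eq_bigr => i _; apply: eq_bigr => k _.
  by rewrite sym; congr (_ * _); rewrite mulrC.
exact: etrans (E w1 w2) (etrans (f_equal2 +%R Q1 Q2) (esym (E w2 w1))).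
Qed.

(** [F] is the pulled back 2-form on constant vector fields; since these commute, the exterior
    derivative reduces to the cyclic sum of derivatives. *)
Lemma closed2_pullback_rV (B : 'I_m -> 'I_m -> 'rV[R]_m -> R) w1 w2 w3 :
  let F a b u := \sum_i \sum_j 'D_a (p i) u * 'D_b (p j) u * B i j (psi u) in
  (forall i j, Ck 1 O (B i j)) ->
  (forall i j, B i j (psi v) = - B j i (psi v)) ->
  (forall i j k, partial i (B j k) (psi v) + partial j (B k i) (psi v) +
     partial k (B i j) (psi v) = 0) ->
  'D_w1 (F w2 w3) v + 'D_w2 (F w3 w1) v + 'D_w3 (F w1 w2) v = 0.
Proof.
move=> F CB alt cyc.
pose dd a b i := 'D_a (fun u => 'D_b (p i) u) v.
pose db i j k := partial i (B j k) (psi v).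
have E a b c ab ac : dd a b = ab -> dd a c = ac -> 'D_a (F b c) v =
    \sum_i \sum_j ((ab i * 'D_c (p j) v + 'D_b (p i) v * ac j) * B i j (psi v) +
       'D_b (p i) v * 'D_c (p j) v * (\sum_k 'D_a (p k) v * db k i j)).
  move=> <- <-.
  have H := is_derive_bigsum (fun i => is_derive_bigsum (fun j =>
     is_derive_prod (is_derive_prod (is_derive_dp i a b) (is_derive_dp j a c))
     (is_derive_bpsi a (CB i j)))).
  exact: (derive_val (is_derive := H)).
have sw a b : dd a b = dd b a by apply/funext => i; exact: schwarz_p.
rewrite (E w1 w2 w3 (dd w1 w2) (dd w1 w3))//.
rewrite (E w2 w3 w1 (dd w2 w3) (dd w1 w2))//.
rewrite (E w3 w1 w2 (dd w1 w3) (dd w2 w3))//.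
exact: cyclic_sum.
Qed.

End euclid.

Lemma bil_sum (R : realType) m (B : 'M[R]_m) (v w : 'rV[R]_m) :
  bil B v w = \sum_i \sum_j v 0 i * w 0 j * B i j.
Proof.
rewrite /bil mxE exchange_big /=; apply: eq_bigr => j _.
rewrite !mxE big_distrl /=; apply: eq_bigr => i _.
by rewrite -!mulrA; congr (_ * _); exact: mulrC.
Qed.

Lemma bil_delta (R : realType) m (B : 'M[R]_m) i j : bil B (delta_mx 0 i) (delta_mx 0 j) = B i j.
Proof. by rewrite /bil -rowE trmx_delta -colE !mxE. Qed.

Lemma bilDl (R : realType) m (B : 'M[R]_m) u v w : bil B (u + v) w = bil B u w + bil B v w.
Proof. by rewrite /bil !mulmxDl mxE. Qed.

Lemma bilDr (R : realType) m (B : 'M[R]_m) u v w : bil B w (u + v) = bil B w u + bil B w v.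
Proof. by rewrite /bil linearD /= mulmxDr mxE. Qed.

Lemma bil_alt_sym (R : realType) m (B : 'M[R]_m) : (forall v, bil B v v = 0) ->
  forall u v, bil B u v = - bil B v u.
Proof.
move=> alt u v; have := alt (u + v).
by rewrite bilDl !bilDr !alt add0r addr0 => /eqP; rewrite addr_eq0 => /eqP.
Qed.

Lemma bilinear_in_bil (R : realType) m (M : manifold R m) c (B : bilinear_field M) y u v :
  bil (bilinear_in c B y) u v = bil (B (cinv c y)) (u *m frame c y) (v *m frame c y).
Proof. by rewrite /bil /bilinear_in trmx_mul !mulmxA. Qed.

Lemma bilinear_in_alt (R : realType) m (M : manifold R m) c (B : bilinear_field M) y i j :
  (forall x v, bil (B x) v v = 0) -> bilinear_in c B y i j = - bilinear_in c B y j i.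
Proof.
move=> alt; rewrite -!bil_delta; apply: bil_alt_sym => v.
by rewrite bilinear_in_bil.
Qed.

Section closed.
Variables (R : realType) (m : nat) (M : manifold R m).
Variables (V : normedModType R) (U : set V) (phi : V -> M).
Hypotheses (oU : open U) (sphi : smooth_into U phi).

Lemma pairing_chart (b : form1 M) c u w : @atlas R m M c -> U u -> cdom c (phi u) ->
  pairing (tvec phi u w) (b (phi u)) =
  \sum_i 'D_w (fun u => (cmap c \o phi) u 0 i) u * form1_in c b (cmap c (phi u)) i 0.
Proof.
move=> ac Uu cu.
rewrite /pairing (tvec_frame w ac cu (smooth_into_continuous sphi Uu)
    (smooth_into_diff sphi Uu ac cu)).
rewrite -mulmxA pairing_sum /form1_in cmapK//; apply: eq_bigr => i _; congr (_ * _).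
have [_ h] := sphi.
exact: (coord_derive (h c ac) w i (conj Uu cu)).
Qed.

Lemma bil_chart (B : bilinear_field M) c u w1 w2 :
  @atlas R m M c -> U u -> cdom c (phi u) ->
  bil (B (phi u)) (tvec phi u w1) (tvec phi u w2) =
  \sum_i \sum_j 'D_w1 (fun u => (cmap c \o phi) u 0 i) u *
     'D_w2 (fun u => (cmap c \o phi) u 0 j) u * bilinear_in c B (cmap c (phi u)) i j.
Proof.
move=> ac Uu cu.
have T w := tvec_frame w ac cu (smooth_into_continuous sphi Uu) (smooth_into_diff sphi Uu ac cu).
have [_ h] := sphi.
have D w i := coord_derive (h c ac) w i (conj Uu cu).
have -> : bil (B (phi u)) (tvec phi u w1) (tvec phi u w2) =
    bil (bilinear_in c B (cmap c (phi u))) ('D_w1 (cmap c \o phi) u) ('D_w2 (cmap c \o phi) u).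
  by rewrite !T /bil /bilinear_in cmapK// trmx_mul !mulmxA.
rewrite bil_sum; apply: eq_bigr => i _; apply: eq_bigr => j _.
by rewrite !D.
Qed.

(** Near [v] the map stays in the domain of [chart_at (phi v)], where this is the Euclidean
    statement for the coordinates of [phi]. The directions are constant fields on the source, so no
    bracket term appears. *)
Lemma closed_pullback (b : form1 M) v w1 w2 : closed_form1 b -> U v ->
  'D_w1 (fun u => pairing (tvec phi u w2) (b (phi u))) v =
  'D_w2 (fun u => pairing (tvec phi u w1) (b (phi u))) v.
Proof.
move=> [sb cb] Uv.
have ac := @chart_at_atlas _ _ M (phi v); have cv := @chart_at_dom _ _ M (phi v).
set c := chart_at (phi v) in ac cv.
have o := smooth_into_open c oU sphi.
have E w w' : 'D_w' (fun u => pairing (tvec phi u w) (b (phi u))) v =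
    'D_w' (fun u => \sum_i 'D_w (fun u => (cmap c \o phi) u 0 i) u *
       form1_in c b ((cmap c \o phi) u) i 0) v.
  apply: (derive_open_eq w' o); first by split.
  by move=> u [Uu cu]; exact: pairing_chart.
have [_ h] := sphi.
have oc : open (cimg c) by exact: open_cimg.
have H1 u : [set u | U u /\ cdom c (phi u)] u -> cimg c ((cmap c \o phi) u).
  by move=> [_ cu]; exact: cimg_map.
have H2 i : Ck 1 (cimg c) (fun y => form1_in c b y i 0).
  exact: ((Ck_mxP 1 _ oc).1 (sb c ac 1) i 0).
have H3 i j : partial i (fun y => form1_in c b y j 0) ((cmap c \o phi) v) =
    partial j (fun y => form1_in c b y i 0) ((cmap c \o phi) v).
  apply/eqP; rewrite -subr_eq0; apply/eqP.
  exact: (cb c (cmap c (phi v)) i j ac (cimg_map cv)).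
have K := closed_pullback_rV o (conj Uv cv) (h c ac) H1 w1 w2 H2 H3.
exact: etrans (E w2 w1) (etrans K (esym (E w1 w2))).
Qed.

Lemma closed2_pullback (B : bilinear_field M) v w1 w2 w3 :
  smooth_bilinear B -> (forall x v, bil (B x) v v = 0) ->
  (forall c y i j k, @atlas R m M c -> cimg c y -> d2_in c B y i j k = 0) -> U v ->
  let F a b u := bil (B (phi u)) (tvec phi u a) (tvec phi u b) in
  'D_w1 (F w2 w3) v + 'D_w2 (F w3 w1) v + 'D_w3 (F w1 w2) v = 0.
Proof.
move=> sB alt cB Uv F.
have ac := @chart_at_atlas _ _ M (phi v); have cv := @chart_at_dom _ _ M (phi v).
set c := chart_at (phi v) in ac cv.
have o := smooth_into_open c oU sphi.
have E a b w : 'D_w (F a b) v =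
    'D_w (fun u => \sum_i \sum_j 'D_a (fun u => (cmap c \o phi) u 0 i) u *
       'D_b (fun u => (cmap c \o phi) u 0 j) u * bilinear_in c B ((cmap c \o phi) u) i j) v.
  apply: (derive_open_eq w o); first by split.
  by move=> u [Uu cu]; exact: bil_chart.
have [_ h] := sphi.
have oc : open (cimg c) by exact: open_cimg.
have H1 u : [set u | U u /\ cdom c (phi u)] u -> cimg c ((cmap c \o phi) u).
  by move=> [_ cu]; exact: cimg_map.
have H2 i j : Ck 1 (cimg c) (fun y => bilinear_in c B y i j).
  exact: ((Ck_mxP 1 _ oc).1 (sB c ac 1) i j).
have H3 i j : bilinear_in c B ((cmap c \o phi) v) i j = - bilinear_in c B ((cmap c \o phi) v) j i.
  exact: bilinear_in_alt.
have H4 i j k : partial i (fun y => bilinear_in c B y j k) ((cmap c \o phi) v) +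
    partial j (fun y => bilinear_in c B y k i) ((cmap c \o phi) v) +
    partial k (fun y => bilinear_in c B y i j) ((cmap c \o phi) v) = 0.
  exact: (cB c (cmap c (phi v)) i j k ac (cimg_map cv)).
have K := closed2_pullback_rV o (conj Uv cv) (h c ac) H1 w1 w2 w3 H2 H3 H4.
exact: etrans (f_equal2 +%R (f_equal2 +%R (E w2 w3 w1) (E w3 w1 w2)) (E w1 w2 w3)) K.
Qed.

End closed.

(** * Lie group actions *)

Section slices.
Variables (R : realType).
Implicit Types V W X : normedModType R.

Lemma derive_snd V W X (f : V * W -> X) s y v :
  'D_(0, v) f (s, y) = 'D_v (fun y => f (s, y)) y.
Proof.
have E : (fun h : R => h^-1 *: ((f \o shift (s, y)) (h *: (0, v)) - f (s, y))) =
    (fun h : R => h^-1 *: (((fun y => f (s, y)) \o shift y) (h *: v) - f (s, y))).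
  apply/funext => h /=; congr (_ *: (f _ - _)).
  by congr (_, _) => /=; rewrite scaler0 add0r.
by rewrite /derive E.
Qed.

Lemma derive_fst V W X (f : V * W -> X) s y v :
  'D_(v, 0) f (s, y) = 'D_v (fun s => f (s, y)) s.
Proof.
have E : (fun h : R => h^-1 *: ((f \o shift (s, y)) (h *: (v, 0)) - f (s, y))) =
    (fun h : R => h^-1 *: (((fun s => f (s, y)) \o shift s) (h *: v) - f (s, y))).
  apply/funext => h /=; congr (_ *: (f _ - _)).
  by congr (_, _) => /=; rewrite scaler0 add0r.
by rewrite /derive E.
Qed.

Lemma derive_shift_arg V X (f : V -> X) s v :
  'D_v f s = 'D_v (fun h => f (h + s)) 0.
Proof.
have E : (fun h : R => h^-1 *: ((f \o shift s) (h *: v) - f s)) =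
    (fun h : R => h^-1 *: (((fun h => f (h + s)) \o shift 0) (h *: v) - f (0 + s))).
  by apply/funext => h /=; rewrite addr0 add0r.
by rewrite /derive E.
Qed.

Lemma Ck_slice V W k (U : set V) (s : W) : open U -> Ck k U (fun y : V => (s, y)).
Proof. by move=> oU; apply: Ck_pair => //; [exact: Ck_cst|exact: Ck_id]. Qed.

Lemma smooth_on_bil m (M : manifold R m) (B : bilinear_field M) V (U : set V)
    (phi : V -> M) w1 w2 : open U -> smooth_bilinear B -> smooth_into U phi ->
  smooth_on U (fun v => bil (B (phi v)) (tvec phi v w1) (tvec phi v w2)).
Proof.
move=> oU sB sphi k; apply: Ck_local => v Uv.
have ac := @chart_at_atlas _ _ M (phi v).
set c := chart_at (phi v) in ac *.
set U' := [set v | U v /\ cdom c (phi v)].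
exists U'; first by split=> //; exact: chart_at_dom.
have o : open U' := smooth_into_open c oU sphi.
have C1 k' : Ck k' U' (cmap c \o phi) by have [_ h] := sphi; exact: h.
have Cp w i : Ck k U' (fun u => 'D_w (fun u => (cmap c \o phi) u 0 i) u).
  have := (Ck_mxP k.+1 _ o).1 (C1 k.+1) 0 i => -[_ h]; exact: h.
have CB : Ck k U' (bilinear_in c B \o (cmap c \o phi)).
  apply: (Ck_comp_mx (fbasis_rV R m) o (@open_cimg _ _ _ c)) => //.
    by move=> u [_ cu]; exact: cimg_map.
  exact: sB.
apply: (@Ck_eq _ _ _ _ _ (fun v => \sum_i \sum_j
   'D_w1 (fun u => (cmap c \o phi) u 0 i) v *
     'D_w2 (fun u => (cmap c \o phi) u 0 j) v * bilinear_in c B (cmap c (phi v)) i j)) => //.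
  by move=> u [Uu cu]; rewrite -(bil_chart sphi).
apply: Ck_sum => // i; apply: Ck_sum => // j; apply: Ck_mul => //; last first.
  exact: ((Ck_mxP k _ o).1 CB i j).
by apply: Ck_mul => //; exact: Cp.
Qed.

End slices.

Section action.
Variables (R : realType) (k m : nat) (G : lieGroup R k) (expG : 'rV[R]_k -> G).
Hypothesis exp_spec : is_exponential expG.
Variables (M : manifold R m) (act : G -> M -> M).
Hypothesis action : smooth_action act.

Lemma gmulVr (a : G) : gmul a (ginv a) = gone.
Proof.
rewrite -[LHS]gmul1 -{1}(gmulV (ginv a)) -gmulA (gmulA (ginv a) a) gmulV.
by rewrite gmul1 gmulV.
Qed.

Lemma gmulr1 (a : G) : gmul a gone = a.
Proof. by rewrite -(gmulV a) gmulA gmulVr gmul1. Qed.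

Lemma gmul_idem (a : G) : gmul a a = a -> a = gone.
Proof.
by move=> h; rewrite -(gmulV a) -{3}h gmulA gmulV gmul1.
Qed.

Lemma actK (a : G) : cancel (act a) (act (ginv a)).
Proof. by move=> x; rewrite -(actM action) gmulV (act1 action). Qed.

Lemma actVK (a : G) : cancel (act (ginv a)) (act a).
Proof. by move=> x; rewrite -(actM action) gmulVr (act1 action). Qed.

Lemma act_smooth_mor a : smooth_mor (act a).
Proof.
move=> c ac; apply: (smooth_into_map2 (act_smooth action) (@open_cimg _ _ _ c)).
  exact: smooth_into_cst.
exact: smooth_into_cinv.
Qed.

Lemma orbit_smooth_mor x : smooth_mor (act^~ x).
Proof.
move=> c ac; apply: (smooth_into_map2 (act_smooth action) (@open_cimg _ _ _ c)).
  exact: smooth_into_cinv.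
exact: smooth_into_cst.
Qed.

Lemma gmul_smooth_mor a : smooth_mor (fun b : G => gmul a b).
Proof.
move=> c ac; apply: (smooth_into_map2 (@gmul_smooth _ _ G) (@open_cimg _ _ _ c)).
  exact: smooth_into_cst.
exact: smooth_into_cinv.
Qed.

Lemma conj_smooth_mor (a b : G) : smooth_mor (fun x : G => gmul (gmul a x) b).
Proof.
move=> c ac; apply: (smooth_into_map2 (@gmul_smooth _ _ G) (@open_cimg _ _ _ c)).
  exact: gmul_smooth_mor.
exact: smooth_into_cst.
Qed.

Variable xi : 'rV[R]_k.

Lemma exp0 : expG (0 *: xi) = gone.
Proof.
have [_ h _] := exp_spec xi; apply: gmul_idem.
by rewrite -h addr0.
Qed.

Lemma exp_smooth_into : smooth_into setT (fun s : R => expG (s *: xi)).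
Proof. by have [h _ _] := exp_spec xi; exact: smooth_into_curve. Qed.

Definition flow (s : R) (x : M) : M := act (expG (s *: xi)) x.

Lemma flow0 x : flow 0 x = x.
Proof. by rewrite /flow exp0 (act1 action). Qed.

Lemma flowD s t x : flow (s + t) x = flow s (flow t x).
Proof. by have [_ h _] := exp_spec xi; rewrite /flow h (actM action). Qed.

Lemma flow_curve x : smooth_into setT (flow^~ x).
Proof.
apply: (smooth_into_map2 (act_smooth action) openT).
  exact: exp_smooth_into.
exact: smooth_into_cst.
Qed.

(** Time and a chart of the source become the two variables of one map on an open subset of a vector
    space, along which closed forms are pulled back; the target needs no chart. *)
Definition flow_in (c : chart R m M) (z : R * 'rV[R]_m) : M := flow z.1 (cinv c z.2).

Definition strip (c : chart R m M) : set (R * 'rV[R]_m) := [set z | cimg c z.2].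

Lemma open_strip c : open (strip c).
Proof.
have -> : strip c = [set z | [set: R * 'rV[R]_m] z /\ cimg c z.2].
  by apply/seteqP; split=> z /=; [|case].
by apply: (open_preim openT (@open_cimg _ _ _ c)) => -[? ?] _; exact: cvg_snd.
Qed.

Lemma flow_in_smooth c : @atlas R m M c -> smooth_into (strip c) (flow_in c).
Proof.
move=> ac; apply: (smooth_into_map2 (act_smooth action) (@open_strip c)).
  apply: (smooth_into_precomp (fbasis_self R) (phi := fun s => expG (s *: xi))
    (g := fst) (@open_strip c) openT) => //.
    by move=> j; apply: Ck_fst; exact: open_strip.
  exact: exp_smooth_into.
apply: (smooth_into_precomp (fbasis_rV R m) (phi := cinv c)
    (g := snd) (@open_strip c) (@open_cimg _ _ _ c)) => //.
  by move=> j; apply: Ck_snd; exact: open_strip.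
exact: smooth_into_cinv.
Qed.

Lemma generator_tvec x : inf_generator expG act xi x = tvec (flow^~ x) 0 1.
Proof. by rewrite /inf_generator velocity_tvec. Qed.

(** By the group law, the orbit of [x] after time [s] is the orbit of [flow s x] from time 0. *)
Lemma flow_tvec s x : tvec (flow^~ x) s 1 = inf_generator expG act xi (flow s x).
Proof.
rewrite generator_tvec /tvec flow0 derive_shift_arg.
have -> : (fun h => (cmap (chart_at (flow s x)) \o flow^~ x) (h + s)) =
    cmap (chart_at (flow s x)) \o flow^~ (flow s x).
  by apply/funext => h /=; rewrite flowD.
by [].
Qed.

(** The flow line is the orbit map composed with the one-parameter subgroup. In this form the linear
    dependence on [xi] is visible, and conjugation in the group acts through [Ad]. *)
Lemma generator_orbit x :
  inf_generator expG act xi x = xi *m tangent_map (act^~ x) gone.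
Proof.
rewrite generator_tvec.
have -> : flow^~ x = (act^~ x) \o (fun s : R => expG (s *: xi)) by [].
rewrite (tvec_comp (orbit_smooth_mor x) (1 : R) openT exp_smooth_into I).
rewrite exp0 -velocity_tvec; have [_ _ ->] := exp_spec xi; by [].
Qed.

Lemma generator_fixed p : (forall a, act a p = p) -> inf_generator expG act xi p = 0.
Proof.
move=> fp; rewrite generator_tvec /tvec.
have -> : flow^~ p = fun=> p by apply/funext => s; exact: fp.
exact: derive_cst.
Qed.

Lemma flow_in_tvec_fst c s y : cimg c y ->
  tvec (flow_in c) (s, y) (1, 0) = inf_generator expG act xi (flow_in c (s, y)).
Proof. by move=> cy; rewrite /tvec derive_fst; exact: flow_tvec. Qed.

Lemma flow_in_tvec_snd c s y v : @atlas R m M c -> cimg c y ->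
  tvec (flow_in c) (s, y) (0, v) =
  v *m frame c y *m tangent_map (flow s) (cinv c y).
Proof.
move=> ac cy; rewrite /tvec derive_snd.
have h := tvec_comp (act_smooth_mor (expG (s *: xi))) v (@open_cimg _ _ _ c)
  (smooth_into_cinv ac) cy.
rewrite frame_tvec//; exact: h.
Qed.

End action.

(** * Exact forms and pullbacks *)

Section forms.
Variables (R : realType) (m : nat) (M : manifold R m).

Lemma pairing_delta (b : 'cV[R]_m) i : pairing (delta_mx 0 i) b = b i 0.
Proof. by rewrite /pairing -rowE mxE. Qed.

Lemma form1_in_pairing c (b : form1 M) y w : @atlas R m M c -> cimg c y ->
  pairing w (form1_in c b y) = pairing (tvec (cinv c) y w) (b (cinv c y)).
Proof. by move=> ac cy; rewrite /pairing /form1_in mulmxA frame_tvec. Qed.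

Lemma form1_inE c (b : form1 M) y i : @atlas R m M c -> cimg c y ->
  form1_in c b y i 0 = pairing (tvec (cinv c) y (delta_mx 0 i)) (b (cinv c y)).
Proof. by move=> ac cy; rewrite -form1_in_pairing// pairing_delta. Qed.

Lemma form1_in_chart_at (b : form1 M) x :
  form1_in (chart_at x) b (cmap (chart_at x) x) = b x.
Proof.
by rewrite /form1_in frame_chart_at mul1mx cmapK//; exact: chart_at_dom.
Qed.

Lemma smooth_form1P (b : form1 M) :
  (forall c i, @atlas R m M c ->
     smooth_on (cimg c) (fun y => pairing (tvec (cinv c) y (delta_mx 0 i)) (b (cinv c y)))) ->
  smooth_form1 b.
Proof.
move=> H c ac k; have o := @open_cimg _ _ _ c.
apply/Ck_mxP => // i j; rewrite ord1.
by apply: Ck_eq (H c i ac k) => // y cy; rewrite form1_inE.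
Qed.

Lemma form1_in_d0 (h : M -> R) c y i : smooth_fun h -> @atlas R m M c -> cimg c y ->
  form1_in c (d0 h) y i 0 = partial i (h \o cinv c) y.
Proof.
move=> sh ac cy; rewrite form1_inE// /partial.
by rewrite (derive_d0 _ (@open_cimg _ _ _ c) sh (smooth_into_cinv ac) cy).
Qed.

Lemma closed_d0 (h : M -> R) : smooth_fun h -> closed_form1 (d0 h).
Proof.
move=> sh; split=> [c ac k|c y i j ac cy].
  have o := @open_cimg _ _ _ c.
  apply/Ck_mxP => // i j; rewrite ord1.
  have [_ h1] := sh c ac k.+1.
  by apply: Ck_eq (h1 (delta_mx 0 i)) => // y cy; rewrite form1_in_d0.
have o := @open_cimg _ _ _ c.
have E i' j' : partial i' (fun z => form1_in c (d0 h) z j' 0) y =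
    partial i' (partial j' (h \o cinv c)) y.
  by apply: (derive_open_eq _ o cy) => z cz; rewrite form1_in_d0.
rewrite /d1_in !E; apply/eqP; rewrite subr_eq0; apply/eqP.
exact: (Schwarz _ _ o cy (sh c ac 2)).
Qed.

Lemma closed_add (a b g : form1 M) : (forall x, g x = a x + b x) ->
  closed_form1 a -> closed_form1 b -> closed_form1 g.
Proof.
move=> gE [sa ca] [sb cb].
have E c y i : form1_in c g y i 0 = form1_in c a y i 0 + form1_in c b y i 0.
  by rewrite /form1_in gE mulmxDr mxE.
split=> [c ac k|c y i j ac cy].
  have o := @open_cimg _ _ _ c.
  apply: Ck_eq (Ck_add o (sa c ac k) (sb c ac k)) => // y cy.
  by apply/colP => i; rewrite E mxE.
have o := @open_cimg _ _ _ c.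
have P i' j' : partial i' (fun z => form1_in c g z j' 0) y =
  partial i' (fun z => form1_in c a z j' 0) y + partial i' (fun z => form1_in c b z j' 0) y.
  have D (f : form1 M) : smooth_form1 f ->
      derivable (fun z => form1_in c f z j' 0 : R) y (delta_mx 0 i').
    move=> sf; apply: diff_derivable.
    by have [h _] := (Ck_mxP 1 _ o).1 (sf c ac 1) j' 0; exact: h.
  rewrite /partial -(deriveD (D a sa) (D b sb)).
  rewrite [in LHS](_ : (fun z => form1_in c g z j' 0) =
    (fun z => form1_in c a z j' 0) + (fun z => form1_in c b z j' 0)) //.
  by apply/funext => z; exact: E.
rewrite /d1_in !P; move: (ca c y i j ac cy) (cb c y i j ac cy).
rewrite /d1_in; move: (partial _ _ _) (partial _ _ _) (partial _ _ _) (partial _ _ _).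
by move=> p q r s h1 h2; rewrite opprD addrACA h1 h2 addr0.
Qed.

Lemma d0_eq0_locally_constant (h : M -> R) : smooth_fun h -> (forall x, d0 h x = 0) ->
  forall x, \forall y \near x, h y = h x.
Proof.
move=> sh dh x; have ac := @chart_at_atlas _ _ M x; have cx := @chart_at_dom _ _ M x.
set c := chart_at x in ac cx.
have o := @open_cimg _ _ _ c; have cy := cimg_map cx.
have [r /= r0 Br] := (nbhs_ballP _ _).1 (open_near o cy (fun y cy => cy)).
have K : forall y, ball (cmap c x) r y -> (h \o cinv c) y = (h \o cinv c) (cmap c x).
  apply: constant_on_ball => y v By; have cy' := Br _ By; split.
    by apply: diff_derivable; have [h1 _] := sh c ac 1; exact: h1.
  rewrite (derive_d0 v o sh (smooth_into_cinv ac) cy') dh /pairing mulmx0.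
  by rewrite mxE.
have n1 : \forall y \near x, ball (cmap c x) r (cmap c y).
  by apply: (cmap_continuous cx); exact: nbhsx_ballx.
have n2 : \forall y \near x, cdom c y by exact: (open_near (@cdom_open _ _ _ _) cx).
apply: filterS (filterI n1 n2) => y [By cdy].
by have := K _ By; rewrite /= !cmapK.
Qed.

(** The level set of [h] through [x] is open and closed, so it contains any connected set that it
    meets. *)
Lemma locally_constant_component (h : M -> R) :
  (forall x, \forall y \near x, h y = h x) ->
  forall x p, connected_component [set: M] x p -> h p = h x.
Proof.
move=> lc x p [A [Ax _ cA] Ap].
have E : A `&` [set y | h y = h x] = A.
  apply: cA.
  - by exists x.
  - exists [set y | h y = h x] => //; rewrite openE => y /= hy.
    by apply: filterS (lc y) => z /= ->.
  - exists [set y | h y = h x] => //; rewrite -openC openE => y /= hy.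
    by apply: filterS (lc y) => z /= ->.
have [_ ] : (A `&` [set y | h y = h x]) p by rewrite E.
exact.
Qed.

Lemma d0_eq0_constant (h : M -> R) : smooth_fun h -> (forall x, d0 h x = 0) ->
  forall x p, connected_component [set: M] x p -> h p = h x.
Proof.
by move=> sh dh; apply: locally_constant_component; exact: d0_eq0_locally_constant.
Qed.

(** Once [h] is differentiable, its directional derivatives are combinations of the coefficients of
    [g] with constant weights, so the smoothness of [g] lifts to [h] one order higher at a time. *)
Lemma smooth_of_gradient (h : M -> R) (g : form1 M) : smooth_form1 g ->
  (forall c y, @atlas R m M c -> cimg c y ->
     is_diff y (h \o cinv c) (fun v => pairing v (form1_in c g y))) ->
  smooth_fun h /\ d0 h = g.
Proof.
move=> sg H.
have D c y v : @atlas R m M c -> cimg c y ->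
    'D_v (h \o cinv c) y = pairing v (form1_in c g y).
  by move=> ac cy; have [d v'] := H c y ac cy; rewrite (deriveE _ d) v'.
split.
  move=> c ac [|k]; have o := @open_cimg _ _ _ c.
    by move=> y cy; apply: differentiable_continuous; have [] := H c y ac cy.
  split=> [y cy|v]; first by have [] := H c y ac cy.
  apply: (@Ck_eq _ _ _ _ _ (fun y => \sum_i v 0 i * form1_in c g y i 0)) => //.
    by move=> y cy; rewrite D// /pairing pairing_sum.
  apply: Ck_sum => // i; apply: Ck_mul => //; first exact: Ck_cst.
  exact: ((Ck_mxP k _ o).1 (sg c ac k) i 0).
apply/funext => x; apply/colP => i; rewrite mxE /partial.
rewrite D ?form1_in_chart_at ?pairing_delta//; first exact: chart_at_atlas.
by apply: cimg_map; exact: chart_at_dom.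
Qed.

Definition pull (F : M -> M) (b : form1 M) : form1 M :=
  fun x => tangent_map F x *m b (F x).

Lemma pairing_pull F b x v : pairing v (pull F b x) = pairing (v *m tangent_map F x) (b (F x)).
Proof. by rewrite /pairing /pull mulmxA. Qed.

Lemma smooth_pull F b : smooth_mor F -> smooth_form1 b -> smooth_form1 (pull F b).
Proof.
move=> sF sb; apply: smooth_form1P => c i ac k; have o := @open_cimg _ _ _ c.
apply: Ck_eq (smooth_on_pairing (delta_mx 0 i) o sb (sF c ac) k) => // y cy.
by rewrite pairing_pull (tvec_comp sF _ o (smooth_into_cinv ac) cy).
Qed.

Lemma smooth_fun_comp F (h : M -> R) : smooth_mor F -> smooth_fun h -> smooth_fun (M := M) (h \o F).
Proof. by move=> sF sh c ac; exact: (smooth_on_fun (@open_cimg _ _ _ c) sh (sF c ac)). Qed.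

Lemma d0_comp F (h : M -> R) : smooth_mor F -> smooth_fun h -> d0 (M := M) (h \o F) = pull F (d0 h).
Proof.
move=> sF sh; apply/funext => x; apply/colP => i.
have ac := @chart_at_atlas _ _ M x; have cx := @chart_at_dom _ _ M x.
set c := chart_at x in ac cx.
have o := @open_cimg _ _ _ c; have cy := cimg_map cx.
rewrite mxE /partial (derive_d0 (h := h) (phi := F \o cinv c) _ o sh (sF c ac) cy).
rewrite (tvec_comp sF _ o (smooth_into_cinv ac) cy) tvec_chart_at -pairing_pull pairing_delta.
by rewrite cmapK.
Qed.

End forms.

(** * The homotopy formula and the contraction of an invariant closed 2-form *)

Section flow_forms.
Variables (R : realType) (k m : nat) (G : lieGroup R k) (expG : 'rV[R]_k -> G).
Hypothesis exp_spec : is_exponential expG.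
Variables (M : manifold R m) (act : G -> M -> M).
Hypothesis action : smooth_action act.
Variable xi : 'rV[R]_k.

Local Notation flow := (@flow R k m G expG M act xi).
Local Notation flow_in := (@flow_in R k m G expG M act xi).
Local Notation X := (inf_generator expG act xi).

Lemma flow_smooth_mor s : smooth_mor (flow s).
Proof. exact: act_smooth_mor. Qed.

Lemma flow_in0 c z : flow_in c (0, z) = cinv c z.
Proof. exact: (flow0 exp_spec action xi (cinv c z)). Qed.

Lemma flow_in_tvec0 c y v : tvec (flow_in c) (0, y) (0, v) = tvec (cinv c) y v.
Proof.
have E d : (fun z => (cmap d \o flow_in c) (0, z)) = cmap d \o cinv c.
  by apply/funext => z; exact: (f_equal (cmap d) (flow_in0 c z)).
by rewrite /tvec derive_snd E flow_in0.
Qed.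

(** The pullback of [b] along [flow_in] is closed, so the [t]-derivative of its spatial coefficient
    [i] is the spatial derivative [i] of its time coefficient, which is the integrand defining [H].
    Integrating over [[0, T]] gives the change of the spatial coefficients as the gradient of
    [H T]. *)
Lemma flow_homotopy (b : form1 M) : closed_form1 b ->
  exists H : R -> M -> R, [/\ forall x, H 0 x = 0,
    forall (t : R) x, 0 <= t -> is_derive t 1 (H^~ x) (pairing (X (flow t x)) (b (flow t x))) &
    forall T : R, 0 < T -> smooth_fun (H T) /\
      d0 (H T) = (fun x => pull (flow T) b x - b x)].
Proof.
move=> cb; have [sb _] := cb.
have cont x : continuous (fun t => pairing (X (flow t x)) (b (flow t x))).
  have h := smooth_on_pairing (1 : R) openT sb (flow_curve exp_spec action xi x) 0.
  have -> : (fun t => pairing (X (flow t x)) (b (flow t x))) =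
      (fun t => pairing (tvec (flow^~ x) t 1) (b (flow t x))).
    by apply/funext => t; rewrite flow_tvec.
  by move=> t; exact: h.
have pr x := primitive (cont x).
(* The primitive is chosen separately on each orbit, so nothing is known yet about its dependence on
   [x]. *)
pose H t x := s2val (cid2 (pr x)) t.
have H0 x : H 0 x = 0 := s2valP (cid2 (pr x)).
have dH (t : R) x : 0 <= t -> is_derive t 1 (H^~ x) (pairing (X (flow t x)) (b (flow t x))).
  exact: (s2valP' (cid2 (pr x))).
exists H; split=> // T T0.
have sg : smooth_form1 (fun x => pull (flow T) b x - b x).
  move=> c ac j; have o := @open_cimg _ _ _ c.
  have := Ck_add o (smooth_pull (flow_smooth_mor T) sb ac j) (Ck_opp o (sb c ac j)).
  by apply: Ck_eq => // y cy; rewrite /form1_in mulmxBr.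
apply: smooth_of_gradient => // c y ac cy.
have o := @open_cimg _ _ _ c; have oS := @open_strip R m M c.
have sPhi := flow_in_smooth exp_spec action xi ac.
(* [P0] and [Q0 i] are the time and space coefficients of the pullback of [b] along [flow_in]. *)
pose P0 (z : R * 'rV[R]_m) := pairing (tvec (flow_in c) z (1, 0)) (b (flow_in c z)).
pose Q0 i (z : R * 'rV[R]_m) :=
  pairing (tvec (flow_in c) z (0, delta_mx 0 i)) (b (flow_in c z)).
have sP : smooth_on (strip c) P0 := smooth_on_pairing _ oS sb sPhi.
have sQ i : smooth_on (strip c) (Q0 i) := smooth_on_pairing _ oS sb sPhi.
pose q t : 'cV[R]_m := \col_i Q0 i (t, y).
have qE t : q t = form1_in c (pull (flow t) b) y.
  apply/colP => i; rewrite mxE /Q0 (flow_in_tvec_snd expG action xi t _ ac cy).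
  apply: etrans _ (esym (form1_inE (pull (flow t) b) i ac cy)).
  rewrite -(frame_tvec (delta_mx 0 i) ac cy).
  exact: (esym (pairing_pull (flow t) b (cinv c y) _)).
have q0 : q 0 = form1_in c b y.
  apply/colP => i; rewrite mxE /Q0 flow_in_tvec0 flow_in0.
  exact: (esym (form1_inE b i ac cy)).
have -> : (fun v => pairing v (form1_in c (fun x => pull (flow T) b x - b x) y)) =
    (fun v => (v *m (q T - q 0)) 0 0).
  by apply/funext => v; rewrite qE q0 /pairing /form1_in mulmxBr.
have sy (t : R) : smooth_on (cimg c) (fun z : 'rV[R]_m => (t, z)) by move=> j; exact: Ck_slice.
apply: (@leibniz R m (cimg c) (fun t z => P0 (t, z)) (fun t z => H t (cinv c z))
  (fun i t z => 'D_(0, delta_mx 0 i) P0 (t, z)) q y T T0 o cy).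
- move=> t z tT cz.
  have K := Ck_comp (fbasis_prod (fbasis_self R) (fbasis_rV R m)) o
    (fun z (cz : cimg c z) => cz : strip c (t, z)) (sy t 1) (sP 1).
  have [h _] := K; exact: (h z cz).
- by move=> t z i tT cz; rewrite derive_snd.
- move=> i t tT; have [_ h] := sP 1.
  have E : (fun z : R * 'rV[R]_m => 'D_(0, delta_mx 0 i) P0 (z.1, z.2)) =
      (fun z => 'D_(0, delta_mx 0 i) P0 z) by apply/funext => -[].
  by rewrite E; exact: (h (0, delta_mx 0 i) (t, y) cy).
- move=> t z /andP[t0 _] cz; rewrite /P0 flow_in_tvec_fst//; exact: dH.
- by move=> z; exact: H0.
- move=> i t tT.
  have -> : (fun t => q t i 0) = (fun t => Q0 i (t, y)).
    by apply/funext => s; rewrite mxE.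
  (* Closedness exchanges the spatial derivative of the time coefficient with the time derivative of
     the spatial one. *)
  rewrite -(closed_pullback oS sPhi _ _ cb (v := (t, y)) cy) derive_fst.
  apply: derivableP; apply: diff_derivable.
  have [h _] : Ck 1 setT (Q0 i \o (fun s : R => (s, y))).
    apply: (Ck_comp (fbasis_prod (fbasis_self R) (fbasis_rV R m)) openT _ _ (sQ i 1)) => //.
    by apply: Ck_pair; [exact: openT|exact: Ck_id openT|exact: Ck_cst].
  exact: h.
Qed.

(** Closedness of the pullback of [B] along [flow_in], taken in the time direction and two
    coordinate directions at time 0, has three terms. Invariance kills the time derivative, and the
    two others are, up to the sign from antisymmetry, the exterior derivative of the contraction. *)
Lemma contraction_closed (B : bilinear_field M) :
  smooth_bilinear B -> (forall x v, bil (B x) v v = 0) ->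
  (forall c y i j k, @atlas R m M c -> cimg c y -> d2_in c B y i j k = 0) ->
  (forall a, preserves_bilinear (act a) B) ->
  closed_form1 (fun x => (X x *m B x)^T : 'cV[R]_m).
Proof.
move=> sB alt cB inv.
set al := (fun x => _).
have alE x v : pairing v (al x) = bil (B x) (X x) v.
  by rewrite /pairing /al /bil -[v *m _]trmxK trmx_mul trmxK mxE.
have alc c y i : @atlas R m M c -> cimg c y -> form1_in c al y i 0 =
    bil (B (flow_in c (0, y))) (tvec (flow_in c) (0, y) (1, 0))
      (tvec (flow_in c) (0, y) (0, delta_mx 0 i)).
  move=> ac cy; rewrite (form1_inE al i ac cy) alE flow_in_tvec0.
  by rewrite (flow_in_tvec_fst exp_spec action xi 0 cy) flow_in0.
have sy (c : chart R m M) : smooth_on (cimg c) (fun z : 'rV[R]_m => (0 : R, z)).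
  by move=> j; apply: Ck_slice; exact: open_cimg.
have toS (c : chart R m M) z : cimg c z -> strip c (0 : R, z) by [].
pose e i' : R * 'rV[R]_m := (0, delta_mx 0 i').
pose e1 : R * 'rV[R]_m := (1, 0).
split=> [c ac j|c y i j ac cy]; have o := @open_cimg _ _ _ c; have oS := @open_strip R m M c;
  have sPhi := flow_in_smooth exp_spec action xi ac.
  apply/Ck_mxP => // i i'; rewrite ord1.
  have K := Ck_comp (fbasis_prod (fbasis_self R) (fbasis_rV R m)) o
    (toS c) (sy c j) (smooth_on_bil e1 (e i) oS sB sPhi j).
  by apply: Ck_eq K => // y cy; rewrite alc.
pose F a b z := bil (B (flow_in c z)) (tvec (flow_in c) z a) (tvec (flow_in c) z b).
have P i' j' : partial i' (fun z => form1_in c al z j' 0) y = 'D_(e i') (F e1 (e j')) (0, y).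
  rewrite derive_snd; apply: (derive_open_eq _ o cy) => z cz; exact: alc.
(* On two spatial directions the pulled back form is the pullback of [B] by the flow at time [s],
   which does not depend on [s] by invariance. *)
have S0 : 'D_e1 (F (e i) (e j)) (0, y) = 0.
  rewrite derive_fst.
  have -> : (fun s => F (e i) (e j) (s, y)) = (fun=> F (e i) (e j) (0, y)); last exact: derive_cst.
  apply/funext => s; rewrite /F /e !(flow_in_tvec_snd expG action xi _ _ ac cy).
  exact: etrans (inv _ _ _ _) (esym (inv _ _ _ _)).
have K : 'D_e1 (F (e i) (e j)) (0, y) + 'D_(e i) (F (e j) e1) (0, y) +
    'D_(e j) (F e1 (e i)) (0, y) = 0 := closed2_pullback oS sPhi e1 (e i) (e j) sB alt cB (toS c y cy).
have FN : F (e j) e1 = - F e1 (e j).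
  by apply/funext => z; exact: (bil_alt_sym (alt _)).
have dF : derivable (F e1 (e j)) (0, y) (e i).
  have [h _] := smooth_on_bil e1 (e j) oS sB sPhi 1.
  by apply: diff_derivable; exact: (h _ (toS c y cy)).
have FD : 'D_(e i) (F (e j) e1) (0, y) = - 'D_(e i) (F e1 (e j)) (0, y).
  by rewrite FN; exact: (deriveN dF).
have fin (a b b' d p q : R) : a + b' + d = 0 -> a = 0 -> b' = - b -> p = b -> q = d -> p - q = 0.
  by move=> h a0 h1 -> ->; rewrite -[RHS]oppr0 -h a0 h1; ring.
exact: (fin _ _ _ _ _ _ K S0 FD (P i j) (P j i)).
Qed.

End flow_forms.

(** * Isometries *)

Lemma continuous_borel (T S : ptopologicalType) (F : T -> S) :
  continuous F -> measurable_fun setT (F : borel T -> borel S).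
Proof.
move=> /continuousP cF.
apply: (@measurability _ _ (borel T) (borel S) _ _ (@open S)) => //.
move=> _ [A oA <-]; rewrite setTI.
by apply: sub_sigma_algebra; exact: cF.
Qed.

Section linear_algebra.
Variables (R : realType) (m : nat).

Lemma bil_eq (A B : 'M[R]_m) : (forall v w, bil A v w = bil B v w) -> A = B.
Proof. by move=> H; apply/matrixP => i j; rewrite -!bil_delta H. Qed.

Lemma pos_unitmx (g : 'M[R]_m) : (forall v, v != 0 -> 0 < bil g v v) -> g \in unitmx.
Proof.
move=> pos; rewrite -row_free_unit -kermx_eq0; apply/negP => /negP /rowV0Pn [v vk v0].
have := pos v v0; rewrite /bil; move/sub_kermxP: vk => ->.
by rewrite mul0mx mxE ltxx.
Qed.

(** The inner product of covectors has the inverse of the metric as its matrix; this is its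
    transformation rule under an isometry with differential [T]. *)
Lemma invmx_congr (T g : 'M[R]_m) : T \in unitmx -> g \in unitmx ->
  T^T *m invmx (T *m g *m T^T) *m T = invmx g.
Proof.
move=> uT ug.
have uTg : T *m g *m T^T \in unitmx by rewrite !unitmx_mul uT ug unitmx_tr.
apply: (can_inj (mulKmx ug)); rewrite mulmxV//.
apply: (can_inj (mulKmx uT)); rewrite mulmx1 !mulmxA mulmxV// mul1mx.
by [].
Qed.

End linear_algebra.

Section isometry.
Variables (R : realType) (m : nat) (M : manifold R m).
Variables (F F' : M -> M) (g : bilinear_field M).
Variable lam : {measure set (borel M) -> \bar R}.
Hypotheses (sF : smooth_mor F) (sF' : smooth_mor F').
Hypotheses (FK : cancel F F') (FK' : cancel F' F).
Hypothesis rg : riemannian_metric g.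
Hypothesis Fg : preserves_bilinear F g.
Hypothesis Flam : forall A : set M, @measurable _ (borel M) A -> lam (F @^-1` A) = lam A.
Hypothesis Flam' : forall A : set M, @measurable _ (borel M) A -> lam (F' @^-1` A) = lam A.

Lemma metric_unit x : g x \in unitmx.
Proof. by apply: pos_unitmx => v; exact: metric_pos. Qed.

Lemma tangent_mapK x : tangent_map F x *m tangent_map F' (F x) = 1%:M.
Proof.
have ac := @chart_at_atlas _ _ M x; have cx := @chart_at_dom _ _ M x.
set c := chart_at x in ac cx.
have o := @open_cimg _ _ _ c; have cy := cimg_map cx.
apply/row_matrixP => i; rewrite !rowE mulmx1 mulmxA.
have h1 := tvec_comp sF (delta_mx 0 i) o (smooth_into_cinv ac) cy.
have h2 := tvec_comp sF' (delta_mx 0 i) o (sF ac) cy.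
have E : F' \o (F \o cinv c) = cinv c by apply/funext => z /=; rewrite FK.
by rewrite E h1 tvec_chart_at /= cmapK// in h2.
Qed.

Lemma tangent_map_unit x : tangent_map F x \in unitmx.
Proof. exact: (mulmx1_unit (tangent_mapK x)).1. Qed.

Lemma inner_form1_pull a b x :
  inner_form1 g (pull F a) (pull F b) x = inner_form1 g a b (F x).
Proof.
have E : g x = tangent_map F x *m g (F x) *m (tangent_map F x)^T.
  apply: bil_eq => v w; rewrite -Fg /bil trmx_mul !mulmxA; by [].
rewrite /inner_form1 /pull E trmx_mul.
rewrite -(invmx_congr (tangent_map_unit x) (metric_unit (F x))).
by rewrite !mulmxA.
Qed.

Lemma F_measurable : measurable_fun setT (F : borel M -> borel M).
Proof. by apply: continuous_borel; exact: smooth_mor_continuous. Qed.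

Lemma F'_measurable : measurable_fun setT (F' : borel M -> borel M).
Proof. by apply: continuous_borel; exact: smooth_mor_continuous. Qed.

Lemma integral_isometry (f : M -> \bar R) :
  (\int[lam]_x f (F x) = \int[lam]_x f x)%E.
Proof.
have := @integral_preserving _ (borel M) R lam F F' f F_measurable F'_measurable FK' Flam Flam'.
exact.
Qed.

Lemma L2_form1_pull b : L2_form1 lam g b -> L2_form1 lam g (pull F b).
Proof.
rewrite /L2_form1 /L2norm unlock /=.
have -> : (fun x : borel M => (`|(norm_form1 g (pull F b) x)%:E| `^ 2)%E) =
    (fun x => ((`|(norm_form1 g b (F x))%:E| `^ 2)%E)).
  by apply/funext => x; rewrite /norm_form1 inner_form1_pull.
by rewrite (integral_isometry (fun x => (`|(norm_form1 g b x)%:E| `^ 2)%E)).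
Qed.

Lemma compact_support_comp (phi : M -> R) :
  compact (closure [set x : M | phi x != 0]) ->
  compact (closure [set x : M | (phi \o F') x != 0]).
Proof.
move=> cphi; set K := closure [set x | phi x != 0] in cphi *.
have cF := smooth_mor_continuous sF; have cF' := smooth_mor_continuous sF'.
have cK : compact (F @` K).
  by apply: continuous_compact => //; apply: continuous_subspaceT => x; exact: cF.
apply: (subclosed_compact _ cK); first exact: closed_closure.
have clK : closed (F @` K).
  by apply: compact_closed => //; exact: carrier_hausdorff.
rewrite [X in _ `<=` X](closure_id _).1//; apply: closureS => x /= px.
exists (F' x); last exact: FK'.
exact: subset_closure.
Qed.

(** Testing the pullback against [phi] amounts to testing [b] against [phi] composed with [F'],
    since [F] preserves both metric and measure. The new test function is smooth and, [F] being a
    homeomorphism, compactly supported. *)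
Lemma codiff_pull b : is_codiff lam g b (fun=> 0) -> is_codiff lam g (pull F b) (fun=> 0).
Proof.
move=> cb phi sphi kphi.
have sphi' : smooth_fun (M := M) (phi \o F') := smooth_fun_comp sF' sphi.
have h := cb _ sphi' (compact_support_comp kphi).
have E : d0 phi = pull F (d0 (M := M) (phi \o F')).
  have -> : phi = (phi \o F') \o F by apply/funext => x /=; rewrite FK.
  rewrite d0_comp//; congr (pull F (d0 _)).
  by apply/funext => x /=; rewrite FK.
rewrite /L2_inner E.
have -> : (fun x => (inner_form1 g (pull F (d0 (M := M) (phi \o F'))) (pull F b) x)%:E) =
   (fun x => (inner_form1 g (d0 (M := M) (phi \o F')) b (F x))%:E).
  by apply/funext => x; rewrite inner_form1_pull.
rewrite (integral_isometry (fun x => (inner_form1 g (d0 (M := M) (phi \o F')) b x)%:E)).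
rewrite -/(L2_inner lam g _ b) h.
by apply: eq_integral => x _; rewrite !mulr0.
Qed.

End isometry.

(** * Harmonic forms *)

Section cohomology.
Variables (R : realType) (m : nat) (M : manifold R m).
Variables (g : bilinear_field M) (lam : {measure set (borel M) -> \bar R}).
Hypothesis H3 : forall C : set (form1 M), de_rham_H1 C ->
     exists! chi : form1 M,
       [/\ C chi, harmonic lam g chi & L2_form1 lam g chi].

Lemma harmonic_unique (a b : form1 M) (h : M -> R) :
  harmonic lam g a -> L2_form1 lam g a -> harmonic lam g b -> L2_form1 lam g b ->
  smooth_fun h -> (fun x => b x - a x) = d0 h -> b = a.
Proof.
move=> ha la hb lb sh E.
pose C := [set beta : form1 M | closed_form1 beta /\
            exact_form1 ((fun x => beta x - a x) : form1 M)].
have HC : de_rham_H1 C by exists a => //; exact: ha.1.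
have [chi [_ uni]] := H3 HC.
have Ca : C a.
  split; first exact: ha.1.
  exists (fun=> 0); first by move=> c ac k; exact: Ck_cst.
  apply/funext => x; rewrite subrr; apply/colP => i; rewrite !mxE.
  by rewrite /partial; symmetry; exact: derive_cst.
have Cb : C b by split; [exact: hb.1|exists h].
by rewrite -(uni a) // -(uni b).
Qed.

End cohomology.

(** * Harmonic forms vanish on infinitesimal generators *)

Section vanishing.
Variables (R : realType) (k m : nat) (G : lieGroup R k) (expG : 'rV[R]_k -> G).
Hypothesis exp_spec : is_exponential expG.
Variables (M : manifold R m) (act : G -> M -> M).
Hypothesis action : smooth_action act.
Variables (g : bilinear_field M) (lam : {measure set (borel M) -> \bar R}).
Hypothesis rg : riemannian_metric g.
Hypothesis g_inv : forall a, preserves_bilinear (act a) g.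
Hypothesis lam_inv : invariant_measure act lam.
Hypothesis H3 : forall C : set (form1 M), de_rham_H1 C ->
     exists! chi : form1 M,
       [/\ C chi, harmonic lam g chi & L2_form1 lam g chi].
Hypothesis H5 : forall x : M, exists2 p : M, connected_component [set: M] x p &
     forall a : G, act a p = p.

Lemma harmonic_generator0 xi (b : form1 M) x : harmonic lam g b -> L2_form1 lam g b ->
  pairing (inf_generator expG act xi x) (b x) = 0.
Proof.
move=> hb lb; have [cb codb] := hb.
have [H [H0 dH HT]] := flow_homotopy exp_spec action xi cb.
have dHT0 T : 0 < T -> forall y, d0 (H T) y = 0.
  move=> T0 y; have [sH E] := HT T T0.
  set F := flow expG act xi T.
  have hp : harmonic lam g (pull F b).
    split.
      (* The homotopy formula writes the pullback as [b] plus an exact form, so its closedness comes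
         for free. *)
      apply: (closed_add (a := b) (b := d0 (H T))) cb (closed_d0 sH) => z.
      by rewrite E addrC subrK.
    apply: (codiff_pull (act_smooth_mor action _) (act_smooth_mor action _)
       (actK action _) (actVK action _) rg (g_inv _) (lam_inv _) (lam_inv _) codb).
  have lp : L2_form1 lam g (pull F b).
    apply: (L2_form1_pull (act_smooth_mor action _) (act_smooth_mor action _)
       (actK action _) (actVK action _) rg (g_inv _) (lam_inv _) (lam_inv _) lb).
  have P := harmonic_unique H3 hb lb hp lp sH (esym E).
  by rewrite E -/F P subrr.
have HT0 T y : 0 < T -> H T y = 0.
  move=> T0; have [p cp fp] := H5 y; have [sH _] := HT T T0.
  rewrite -(d0_eq0_constant sH (dHT0 T T0) cp).
  have D (t : R) : 0 <= t <= T -> is_derive t 1 (H^~ p) 0.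
    move=> /andP[t0 _]; have := dH t p t0.
    have -> : flow expG act xi t p = p by exact: fp.
    by rewrite (generator_fixed expG xi fp) /pairing mul0mx mxE.
  have B0 (t : R) : 0 <= t <= T -> `|0 : R| <= 0 by rewrite normr0.
  have := MVT_bound T0 (H0 p) D B0.
  by rewrite mulr0 normr_le0 => /eqP.
(* Since [H t y] vanishes for all [t > 0], so does its derivative at the interior time 1, which is
   the pairing at [phi_1 y]; taking [y = phi_(-1) x] reaches [x]. *)
have K y : pairing (inf_generator expG act xi (flow expG act xi 1 y))
    (b (flow expG act xi 1 y)) = 0.
  have D := dH 1 y ler01.
  rewrite -(derive_val (is_derive := D)).
  rewrite (near_eq_derive (g := fun=> 0)); first exact: derive_cst.
  by near=> t; apply: HT0; near: t; exact: lt_nbhsr.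
have := K (flow expG act xi (-1) x).
by rewrite -(flowD exp_spec action) subrr (flow0 exp_spec action).
Unshelve. all: by end_near. Qed.

End vanishing.

Lemma compact_closed_ball_rV (R : realType) n (y : 'rV[R]_n) r : 0 < r -> compact (closed_ball y r).
Proof.
move=> r0; apply: bounded_closed_compact; last exact: closed_ball_closed.
exists (`|y| + r); split; first exact: num_real.
move=> N hN x; rewrite (closed_ballE y r0) /= => xr.
rewrite -[x](subrK y) (le_trans (ler_normD _ _))// addrC.
by apply: le_trans (ltW hN); rewrite lerD2l distrC.
Qed.

(** * Bump functions on a manifold *)

Section bump_on_manifold.
Variables (R : realType) (m : nat) (M : manifold R m).

(** The support lies in the image [K] of a closed ball of half the radius of a ball inside the
    chart. [K] is compact, hence closed in the Hausdorff space [M], which makes extension by zero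
    smooth. The index [i] records that the dimension is positive and provides a direction in which
    the bump varies. *)
Lemma bump_on_manifold (U : set M) x0 (i : 'I_m) : open U -> U x0 ->
  exists (phi : M -> R) (K : set M),
    [/\ smooth_fun phi, K `<=` U, closed K, forall x, ~ K x -> phi x = 0 &
      exists x, d0 phi x != 0].
Proof.
move=> oU Ux0.
have ac := @chart_at_atlas _ _ M x0; have cx := @chart_at_dom _ _ M x0.
set c := chart_at x0 in ac cx.
have o := @open_cimg _ _ _ c; have cy0 := cimg_map cx.
set y0 := cmap c x0 in cy0.
have xy0 : cinv c y0 = x0 by exact: cmapK.
have oV : open [set y | cimg c y /\ U (cinv c y)].
  by apply: open_preim => // y cy; exact: (@cinv_continuous _ _ _ c).
have Vy0 : [set y | cimg c y /\ U (cinv c y)] y0 by split; rewrite ?xy0.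
have [r /= r0 Br] := (nbhs_ballP _ _).1 (open_near oV Vy0 (fun y Vy => Vy)).
have r20 : 0 < r / 2 by rewrite divr_gt0.
have r2r : r / 2 < r by rewrite ltr_pdivrMr// mulr_natr mulr2n ltrDl.
have [B [sB B0 suppB]] := bump y0 r20.
pose D := closed_ball y0 (r / 2).
have DV y : D y -> cimg c y /\ U (cinv c y).
  by move=> Dy; apply: Br; exact: (closed_ball_subset r20 r2r).
pose K := cinv c @` D.
have cK : compact K.
  apply: continuous_compact; last exact: compact_closed_ball_rV r20.
  apply: continuous_in_subspaceT => y /set_mem /DV [cy _].
  exact: (@cinv_continuous _ _ _ c).
have clK : closed K by apply: compact_closed => //; exact: carrier_hausdorff.
have Kc x : K x -> cdom c x by move=> [y /DV [cy _] <-]; have [] := cimgP cy.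
pose phi (x : M) : R := if `[< cdom c x >] then B (cmap c x) else 0.
have phic x : cdom c x -> phi x = B (cmap c x) by move=> h; rewrite /phi asboolT.
have phiK x : ~ K x -> phi x = 0.
  rewrite /phi; case: asboolP => // cdx nK; apply/eqP/negPn/negP => Bx; apply: nK.
  exists (cmap c x); last exact: cmapK.
  by apply: subset_closed_ball; exact: suppB.
have sphi : smooth_fun phi.
  move=> c' ac' j; apply: Ck_local => y cy.
  have [c'y yE] := cimgP cy.
  have [cdy|ncdy] := pselect (cdom c (cinv c' y)).
    exists (cmap c' @` (cdom c' `&` cdom c)); first by exists (cinv c' y).
    apply: (@Ck_eq _ _ _ _ _ (B \o (cmap c \o cinv c'))); first exact: overlap_open.
      by move=> _ [x [c'x cdx] <-] /=; rewrite !cmapK// phic.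
    apply: (Ck_comp (fbasis_rV R m) (O := setT) (@overlap_open _ _ _ c' c)) => //.
    exact: atlas_compat.
  (* A point outside the domain of [c] is outside the closed set [K], so [phi] vanishes near it. *)
  exists [set z | cimg c' z /\ (~` K) (cinv c' z)].
    by split=> // /Kc.
  apply: (@Ck_eq _ _ _ _ _ (fun=> 0)); last exact: Ck_cst.
    apply: open_preim; [exact: open_cimg|exact: closed_openC|].
    by move=> z cz; exact: (@cinv_continuous _ _ _ c').
  by move=> z [cz nK] /=; rewrite phiK.
exists phi, K; split=> //.
  by move=> _ [y /DV [_ Uy] <-].
apply: contrapT => nex.
have d0z x : d0 phi x = 0.
  by apply: contrapT => dx; apply: nex; exists x; apply/eqP.
have cst : forall y, ball y0 r y -> (phi \o cinv c) y = (phi \o cinv c) y0.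
  apply: constant_on_ball => y v By; have [cy _] := Br _ By; split.
    by apply: diff_derivable; have [h1 _] := sphi c ac 1; exact: h1.
  rewrite (derive_d0 v o sphi (smooth_into_cinv ac) cy) d0z /pairing mulmx0.
  by rewrite mxE.
(* At sup distance exactly [r / 2] from [y0]: outside the open ball supporting [B], yet inside the
   ball of radius [r] on which a vanishing differential would make the bump constant and nonzero. *)
pose y1 := y0 + (r / 2) *: delta_mx 0 i.
have y1i : y1 0 i - y0 0 i = r / 2.
  by rewrite /y1 !mxE !eqxx /= mulr1 addrC addKr.
have By1 : ball y0 r y1.
  rewrite -ball_normE /= /y1 opprD addNKr normrN normrZ (gtr0_norm r20).
  apply: le_lt_trans r2r; rewrite -[leRHS]mulr1; apply: ler_wpM2l; first exact: ltW.
  rewrite [leLHS]/Num.Def.normr /= mx_normrE; apply: bigmax_le => // -[a b] _ /=.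
  by rewrite !mxE; case: (_ && _); rewrite ?normr1 ?normr0.
have [cy1 _] := Br _ By1.
have := cst y1 By1; rewrite /= xy0 (phic x0 cx) -/y0.
have [cdy1 y1E] := cimgP cy1; rewrite (phic _ cdy1) y1E => E.
have : ball y0 (r / 2) y1 by apply: suppB; rewrite E.
rewrite -ball_normE /= => h.
have := le_lt_trans (ler_coord_norm _ i) h.
have -> : (y0 - y1) 0 i = - (r / 2) by rewrite -y1i !mxE opprB.
by rewrite normrN gtr0_norm// ltxx.
Qed.

End bump_on_manifold.

Lemma open_borel (T : ptopologicalType) (U : set T) : open U -> @measurable _ (borel T) U.
Proof. by move=> oU; apply: sub_sigma_algebra. Qed.

(** * Positivity of the measure on open sets and vanishing of forms of zero norm *)

Section positivity.
Variables (R : realType) (m : nat) (M : manifold R m).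
Variables (g : bilinear_field M) (lam : {measure set (borel M) -> \bar R}).
Hypothesis rg : riemannian_metric g.
Hypothesis H3 : forall C : set (form1 M), de_rham_H1 C ->
     exists! chi : form1 M,
       [/\ C chi, harmonic lam g chi & L2_form1 lam g chi].

(** Both the codifferential and the norm are tested by integrals whose integrands vanish off the
    null set [U]. *)
Lemma harmonic_null (U : set M) (a : form1 M) : @measurable _ (borel M) U -> lam U = 0%E ->
  closed_form1 a -> (forall x, ~ U x -> a x = 0) -> harmonic lam g a /\ L2_form1 lam g a.
Proof.
move=> mU U0 ca aU; split.
  split=> // phi _ _; rewrite /L2_inner.
  rewrite (@integral_null _ (borel M) R lam U) //.
    symmetry; under eq_integral do rewrite mulr0.
    exact: integral0.
  by move=> x nU; rewrite /inner_form1 aU// mulmx0 mxE.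
rewrite /L2_form1 /L2norm unlock /=.
rewrite (@integral_null _ (borel M) R lam U) //.
  by apply: poweR_lty; rewrite ltry.
move=> x nU; rewrite /norm_form1 /inner_form1 aU// mulmx0 mxE sqrtr0 normr0.
by rewrite powR0// pnatr_eq0.
Qed.

(** The index [i] is there because in dimension 0 the only 1-form is zero, and uniqueness of
    harmonic representatives then says nothing about the measure. *)
Lemma open_measure_neq0 (U : set M) x0 (i : 'I_m) : open U -> U x0 -> lam U <> 0%E.
Proof.
move=> oU Ux0 U0; have mU := open_borel oU.
have [phi [K [sphi KU clK phiK [x dx]]]] := bump_on_manifold i oU Ux0.
have dK y : ~ U y -> d0 phi y = 0.
  move=> nU; have nK : ~ K y by move=> /KU.
  have ac := @chart_at_atlas _ _ M y; have cy := @chart_at_dom _ _ M y.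
  set c := chart_at y in ac cy.
  have o : open [set z | cimg c z /\ (~` K) (cinv c z)].
    apply: open_preim; [exact: open_cimg|exact: closed_openC|].
    by move=> z cz; exact: (@cinv_continuous _ _ _ c).
  apply/colP => j; rewrite !mxE /partial.
  rewrite (derive_open_eq (g := fun=> 0) _ o); first exact: derive_cst.
    by split; [exact: cimg_map|rewrite /= cmapK].
  by move=> z [_ nKz] /=; exact: phiK.
have [h1 l1] := harmonic_null mU U0 (closed_d0 sphi) dK.
have s0 : smooth_fun (fun _ : M => 0 : R) by move=> c ac j; exact: Ck_cst.
have z0 : d0 (fun _ : M => 0 : R) = fun=> 0.
  apply/funext => y; apply/colP => j; rewrite !mxE /partial; exact: derive_cst.
have [h2 l2] := harmonic_null mU U0 (closed_d0 s0) (fun y _ => f_equal (@^~ y) z0).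
have E : (fun x => d0 phi x - d0 (fun _ : M => 0 : R) x) = d0 phi.
  by apply/funext => y; rewrite z0 subr0.
have := harmonic_unique H3 h2 l2 h1 l1 sphi E.
by move=> P; move: dx; rewrite P z0 eqxx.
Qed.

Lemma dual_form_ge0 (g0 : 'M[R]_m) (a : 'cV[R]_m) :
  (forall u w, bil g0 u w = bil g0 w u) -> (forall u, u != 0 -> 0 < bil g0 u u) ->
  0 <= (a^T *m invmx g0 *m a) 0 0.
Proof.
move=> sym pos; have ug := pos_unitmx pos.
have -> : (a^T *m invmx g0 *m a) 0 0 = bil g0 (a^T *m invmx g0) (a^T *m invmx g0).
  rewrite /bil trmx_mul trmxK mulmxKV// trmx_inv.
  have -> : g0^T = g0 by apply/matrixP => i j; rewrite mxE -!bil_delta sym.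
  by rewrite mulmxA.
have [->|/pos/ltW//] := eqVneq (a^T *m invmx g0) 0.
by rewrite /bil !mul0mx mxE.
Qed.

(** Let [w] be the vector dual to [a] under [g0]. The pairing is the product of [v] with [w], and
    the norm of the covector is the norm of [w], so this is the usual inequality for [g0]. *)
Lemma cauchy_schwarz_form (g0 : 'M[R]_m) (a : 'cV[R]_m) (v : 'rV[R]_m) :
  (forall u w, bil g0 u w = bil g0 w u) -> (forall u, u != 0 -> 0 < bil g0 u u) ->
  pairing v a ^+ 2 <= (a^T *m invmx g0 *m a) 0 0 * bil g0 v v.
Proof.
move=> sym pos; have ug := pos_unitmx pos.
have gT : g0^T = g0.
  by apply/matrixP => i j; rewrite mxE -!bil_delta sym.
pose w : 'rV[R]_m := (invmx g0 *m a)^T.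
have Ea u : bil g0 u w = pairing u a.
  by rewrite /bil /w trmxK -mulmxA mulKVmx.
have EN : (a^T *m invmx g0 *m a) 0 0 = bil g0 w w.
  by rewrite Ea /pairing /w trmx_mul trmx_inv gT.
have ge0 u : 0 <= bil g0 u u.
  have [->|/pos/ltW//] := eqVneq u 0.
  by rewrite /bil !mul0mx mxE.
rewrite EN -Ea.
have [w0|w0] := eqVneq w 0.
  by rewrite /bil w0 trmx0 !mulmx0 mxE expr0n /= mul0r.
have ww := pos w w0.
have Z (s t : R) u u' : bil g0 (s *: u + t *: u') (s *: u + t *: u') =
    s ^+ 2 * bil g0 u u + 2 * s * t * bil g0 u u' + t ^+ 2 * bil g0 u' u'.
  have Zl s' x y : bil g0 (s' *: x) y = s' * bil g0 x y.
    by rewrite /bil -!scalemxAl mxE.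
  have Zr s' x y : bil g0 x (s' *: y) = s' * bil g0 x y by rewrite sym Zl sym.
  rewrite bilDl !bilDr !Zl !Zr (sym u' u); ring.
(* With [p = g0(w,w)], [q = g0(v,w)] and [r = g0(v,v)], the square of [p v - q w] is
   [p (p r - q^2)]. *)
have := ge0 (bil g0 w w *: v + (- bil g0 v w) *: w); rewrite Z.
move: (bil g0 w w) (bil g0 v w) (bil g0 v v) ww => p q r p0 h.
have : 0 <= p * (p * r - q ^+ 2) by apply: le_trans h _; rewrite le_eqVlt; apply/orP; left; apply/eqP; ring.
by rewrite pmulr_rge0// subr_ge0.
Qed.

(** Where [a] is nonzero, some coefficient [a_i] is nonzero, and Cauchy-Schwarz bounds the squared
    norm below by [a_i^2 / g_ii]. This bound involves only the continuous coefficients of [a] and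
    [g], not the inverse matrix. It keeps the norm away from 0 on an open set, which must then be
    null. *)
Lemma harmonic_norm0 (a : form1 M) : smooth_form1 a ->
  (\int[lam]_x (inner_form1 g a a x)%:E = 0)%E -> forall x, a x = 0.
Proof.
move=> sa I0 x0; apply: contrapT => ax0.
have ac := @chart_at_atlas _ _ M x0; have cx := @chart_at_dom _ _ M x0.
set c := chart_at x0 in ac cx.
have o := @open_cimg _ _ _ c; have cy := cimg_map cx.
have [i ai] : exists i, a x0 i 0 != 0.
  apply: contrapT => nex; apply: ax0; apply/colP => i; rewrite mxE.
  by apply: contrapT => h; apply: nex; exists i; apply/eqP.
pose A y := form1_in c a y i 0 ^+ 2.
pose B y := bilinear_in c g y i i.
have fr : frame c (cmap c x0) = 1%:M := frame_chart_at x0.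
have A0 : 0 < A (cmap c x0).
  by rewrite /A /form1_in fr mul1mx cmapK// exprn_even_gt0.
have dn0 : (delta_mx 0 i : 'rV[R]_m) != 0.
  apply/eqP => /rowP /(_ i); rewrite !mxE !eqxx => /eqP; by rewrite oner_eq0.
have B0 : 0 < B (cmap c x0).
  rewrite /B /bilinear_in fr trmx1 mulmx1 mul1mx cmapK// -bil_delta.
  exact: (metric_pos rg).
(* Half the ratio [a_i^2 / g_ii] at [x0], so that the open condition [a_i^2 > e g_ii] holds at
   [x0]. *)
pose e := A (cmap c x0) / (2 * B (cmap c x0)).
have e0 : 0 < e by rewrite divr_gt0// mulr_gt0.
pose D y := A y - e * B y.
have cD y : cimg c y -> {for y, continuous D}.
  have CA : Ck 0 (cimg c) (fun y => form1_in c a y i 0) := (Ck_mxP 0 _ o).1 (sa c ac 0) i 0.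
  have CB : Ck 0 (cimg c) B := (Ck_mxP 0 _ o).1 (metric_smooth rg ac 0) i i.
  have : Ck 0 (cimg c) D.
    apply: Ck_add => //; first by apply: Ck_mul.
    by apply: Ck_opp => //; apply: Ck_mul => //; exact: Ck_cst.
  by apply.
pose U := [set x | cdom c x /\ [set t : R | 0 < t] ((D \o cmap c) x)].
have oU : open U.
  apply: open_preim; [exact: cdom_open|exact: open_gt|] => x cdx.
  by apply: continuous_comp; [exact: cmap_continuous|apply: cD; exact: cimg_map].
have Ux0 : U x0.
  split=> //=; rewrite /D.
  have -> : e * B (cmap c x0) = A (cmap c x0) / 2.
    by rewrite /e; field; rewrite gt_eqF.
  by rewrite subr_gt0 ltr_pdivrMr// mulr_natr mulr2n ltrDl.
apply: (open_measure_neq0 i oU Ux0).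
have pos x u : u != 0 -> 0 < bil (g x) u u by exact: (metric_pos rg).
have CS x v := cauchy_schwarz_form (a x) v (metric_sym rg x) (pos x).
apply: (@measure0_of_integral0 _ (borel M) R lam U _ e (open_borel oU) e0 _ _ I0).
  by move=> x; rewrite lee_fin; exact: (dual_form_ge0 (a x) (metric_sym rg x) (pos x)).
move=> x [cdx /= Dx]; rewrite lee_fin.
have Ex : cinv c (cmap c x) = x by exact: cmapK.
have := CS x (delta_mx 0 i *m frame c (cmap c x)).
have -> : pairing (delta_mx 0 i *m frame c (cmap c x)) (a x) = form1_in c a (cmap c x) i 0.
  by rewrite -pairing_delta /form1_in Ex /pairing mulmxA.
have -> : bil (g x) (delta_mx 0 i *m frame c (cmap c x)) (delta_mx 0 i *m frame c (cmap c x)) =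
    B (cmap c x).
  by rewrite /B -bil_delta bilinear_in_bil Ex.
have Bx : 0 < B (cmap c x).
  rewrite /B -bil_delta bilinear_in_bil Ex; apply: pos; apply/eqP => Z.
  have := f_equal (fun w => w *m invmx (frame c (cmap c x))) Z.
  rewrite mulmxK ?mul0mx; last by apply: frame_unit => //; exact: cimg_map.
  by move=> Z'; move: dn0; rewrite Z' eqxx.
rewrite /inner_form1; move: Dx; rewrite /D /A subr_gt0 => Dx h.
by rewrite -(ler_pM2r Bx); apply: le_trans h; exact: ltW.
Qed.

End positivity.

(** * Momentum maps *)

Section compatible.
Variables (R : realType) (m : nat) (om g J : 'M[R]_m).
Hypothesis alt : forall v, bil om v v = 0.
Hypothesis sym : forall v w, bil g v w = bil g w v.
Hypothesis JJ : J *m J = - 1%:M.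
Hypothesis comp : forall v w, bil g v w = bil om v (w *m J).
Hypothesis ug : g \in unitmx.

Lemma compatible_gE : g = J *m om^T.
Proof.
have E : g = om *m J^T.
  by apply: bil_eq => v w; rewrite comp /bil trmx_mul !mulmxA.
have gT : g^T = g by apply/matrixP => i j; rewrite mxE -!bil_delta sym.
by rewrite -gT E trmx_mul trmxK.
Qed.

(** Compatibility reads [g = om J^T] for row vectors. Transposing the symmetric [g] gives
    [g = J om^T = - J om], and multiplication by [J] recovers [om]. *)
Lemma compatible_omE : om = J *m g.
Proof.
have omT : om^T = - om.
  by apply/matrixP => i j; rewrite !mxE -!bil_delta (bil_alt_sym alt).
by rewrite compatible_gE mulmxA JJ mulNmx mul1mx omT opprK.
Qed.

Lemma inner_contraction (X : 'rV[R]_m) (a : 'cV[R]_m) :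
  (((X *m om)^T)^T *m invmx g *m a) 0 0 = pairing X (J *m a).
Proof.
rewrite trmxK /pairing {1}compatible_omE (mulmxA X J g) -(mulmxA (X *m J)) mulmxV//.
by rewrite mulmx1 mulmxA.
Qed.

Lemma inner_contraction_self (X : 'rV[R]_m) :
  (((X *m om)^T)^T *m invmx g *m (X *m om)^T) 0 0 = bil g X X.
Proof.
rewrite inner_contraction /pairing /bil trmx_mul compatible_gE.
by rewrite !mulmxA.
Qed.

End compatible.

Section momentum.
Variables (R : realType) (k m : nat) (G : lieGroup R k) (expG : 'rV[R]_k -> G).
Hypothesis exp_spec : is_exponential expG.
Variables (M : manifold R m) (act : G -> M -> M).
Hypothesis action : smooth_action act.
Variable om : bilinear_field M.
Hypothesis om_inv : forall a, preserves_bilinear (act a) om.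

Local Notation X := (inf_generator expG act).

Definition contraction xi : form1 M := fun x => (X xi x *m om x)^T.

Lemma pairing_contraction xi x v : pairing v (contraction xi x) = bil (om x) (X xi x) v.
Proof. by rewrite /pairing /contraction /bil -[v *m _]trmxK trmx_mul trmxK mxE. Qed.

(** Linearity in [xi]: potentials are needed for the basis elements only. *)
Lemma contraction_sum xi x : contraction xi x = \sum_i xi 0 i *: contraction (delta_mx 0 i) x.
Proof.
rewrite /contraction (generator_orbit exp_spec action).
rewrite {1}(row_sum_delta xi) !mulmx_suml linear_sum /=; apply: eq_bigr => i _.
rewrite -!scalemxAl linearZ /=; congr (_ *: (_ *m _)^T).
by rewrite (generator_orbit exp_spec action).
Qed.

Lemma ginvK (a : G) : ginv (ginv a) = a.
Proof. by rewrite -[LHS](gmulr1) -(gmulV a) gmulA gmulV gmul1. Qed.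

(** Differentiate at [s = 0] the identity [exp(s xi) a x = a (a^-1 exp(s xi) a) x]; the middle
    factor is a curve through the identity whose velocity is the image of [xi] under the adjoint
    action of [a^-1]. *)
Lemma generator_conj (a : G) xi x :
  X xi (act a x) = X (xi *m Ad (ginv a)) x *m tangent_map (act a) x.
Proof.
pose e (s : R) := expG (s *: xi).
pose cj (b : G) := gmul (gmul (ginv a) b) (ginv (ginv a)).
have se : smooth_into setT e := exp_smooth_into exp_spec xi.
have e0 : e 0 = gone := exp0 exp_spec xi.
have scj : smooth_mor cj := @conj_smooth_mor _ _ G (ginv a) (ginv (ginv a)).
have sc := smooth_into_comp scj openT se.
have c0 : cj (e 0) = gone by rewrite e0 /cj gmulr1 gmulVr.
have so := orbit_smooth_mor action x.
have sco := smooth_into_comp so openT sc.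
have T1 := tvec_comp scj (1 : R) openT se (v := 0) I.
have T2 := tvec_comp so (1 : R) openT sc (v := 0) I.
have T3 := tvec_comp (act_smooth_mor action a) (1 : R) openT sco (v := 0) I.
have E : (act a) \o ((act^~ x) \o (cj \o e)) = flow expG act xi ^~ (act a x).
  apply/funext => s /=; rewrite /flow /cj -/(e s) ginvK -!(actM action) !gmulA.
  by rewrite gmulVr gmul1.
rewrite (generator_tvec expG act xi) -E T3 T2 T1 /=.
have [_ _ v0] := exp_spec xi.
rewrite -velocity_tvec /e v0 -/e -/(e 0) c0 e0 (act1 action).
rewrite (generator_orbit exp_spec action); congr (_ *m _ *m _).
Qed.

Lemma pull_contraction (a : G) xi :
  pull (act a) (contraction xi) = contraction (xi *m Ad (ginv a)).
Proof.
apply/funext => x; apply/colP => i; rewrite -!pairing_delta.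
by rewrite pairing_pull !pairing_contraction generator_conj om_inv.
Qed.

End momentum.

(** * Locally constant functions *)

Section locally_constant.
Variables (R : realType) (m : nat) (M : manifold R m).

Definition locally_constant (f : M -> R) := forall x, \forall y \near x, f y = f x.

(** The order of quantifiers is the point: the neighbourhood, a ball in a chart, is chosen before
    [f], on whose restriction to the ball the mean value theorem acts along segments. *)
Lemma locally_constant_near x :
  \forall y \near x, forall f, locally_constant f -> f y = f x.
Proof.
have ac := @chart_at_atlas _ _ M x; have cx := @chart_at_dom _ _ M x.
set c := chart_at x in ac cx.
have o := @open_cimg _ _ _ c; have cy := cimg_map cx.
have [r /= r0 Br] := (nbhs_ballP _ _).1 (open_near o cy (fun y cy => cy)).
have n1 : \forall y \near x, ball (cmap c x) r (cmap c y).
  by apply: (cmap_continuous cx); exact: nbhsx_ballx.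
have n2 : \forall y \near x, cdom c y by exact: (open_near (@cdom_open _ _ _ _) cx).
apply: filterS (filterI n1 n2) => y [By cdy] f lf.
have K : forall z, ball (cmap c x) r z -> (f \o cinv c) z = (f \o cinv c) (cmap c x).
  apply: constant_on_ball => z v Bz; have cz := Br _ Bz.
  have n : \forall w \near z, cst (f (cinv c z)) w = (f \o cinv c) w.
    have n0 : \forall w \near z, f (cinv c w) = f (cinv c z).
      exact: (@cinv_continuous _ _ _ c z cz _ (lf (cinv c z))).
    by apply: filterS n0 => w /= ->.
  have dc : derivable (cst (f (cinv c z))) z v by exact: derivable_cst.
  split; first exact: (near_eq_derivable n dc).
  by rewrite -(near_eq_derive v n); exact: derive_cst.
by have := K _ By; rewrite /= !cmapK.
Qed.

Lemma smooth_sub_locally_constant (h r : M -> R) : smooth_fun h -> locally_constant r ->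
  smooth_fun (fun x => h x - r x) /\ d0 (fun x => h x - r x) = d0 h.
Proof.
move=> sh lr.
have L c y : @atlas R m M c -> cimg c y -> exists U, [/\ open U, U y, U `<=` cimg c &
    forall z, U z -> h (cinv c z) - r (cinv c y) = h (cinv c z) - r (cinv c z)].
  move=> ac cy; have o := @open_cimg _ _ _ c.
  have n : nbhs y [set z | cimg c z /\ r (cinv c z) = r (cinv c y)].
    apply: filterI; first exact: (open_near o cy).
    exact: (@cinv_continuous _ _ _ c y cy _ (lr (cinv c y))).
  exists [set z | cimg c z /\ r (cinv c z) = r (cinv c y)]°; split.
  - exact: open_interior.
  - exact: n.
  - by move=> z /interior_subset [].
  - by move=> z /interior_subset [_ ->].
have sC c U y k : open U -> U `<=` cimg c -> @atlas R m M c ->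
    Ck k U (fun z => h (cinv c z) - r (cinv c y)).
  move=> oU Uc ac; apply: Ck_add => //; last exact: Ck_cst.
  by apply: Ck_sub (sh c ac k).
split.
  move=> c ac k; apply: Ck_local => y cy; have [U [oU Uy Uc E]] := L c y ac cy.
  by exists U => //; apply: Ck_eq (sC c U y k oU Uc ac).
apply/funext => x; apply/colP => i; rewrite !mxE /partial.
have ac := @chart_at_atlas _ _ M x; have cx := @chart_at_dom _ _ M x.
set c := chart_at x in ac cx *; set y := cmap c x.
have cy : cimg c y := cimg_map cx.
have [U [oU Uy Uc E]] := L c y ac cy.
rewrite -(derive_open_eq _ oU Uy E).
have d1 : derivable (h \o cinv c) y (delta_mx 0 i).
  by apply: diff_derivable; have [h1 _] := sh c ac 1; exact: h1.
have d2 := is_deriveB (derivableP d1) (is_derive_cst (r (cinv c y)) y (delta_mx 0 i)).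
by rewrite subr0 in d2; exact: (derive_val (is_derive := d2)).
Qed.

Lemma smooth_fun_lin (I : finType) (a : I -> R) (h : I -> M -> R) :
  (forall i, smooth_fun (h i)) -> smooth_fun (fun x => \sum_i a i * h i x) /\
  forall x, d0 (fun x => \sum_i a i * h i x) x = \sum_i a i *: d0 (h i) x.
Proof.
move=> sh; split=> [c ac k|x].
  have o := @open_cimg _ _ _ c.
  by apply: Ck_sum => // i; apply: Ck_mul => //; [exact: Ck_cst|exact: sh].
have ac := @chart_at_atlas _ _ M x; have cx := @chart_at_dom _ _ M x.
set c := chart_at x in ac cx *; have cy := cimg_map cx.
apply/colP => j; rewrite mxE summxE /partial.
have D i : is_derive (cmap c x) (delta_mx 0 j) (fun z => a i * (h i \o cinv c) z)
    (a i * 'D_(delta_mx 0 j) (h i \o cinv c) (cmap c x)).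
  apply: (is_deriveZ (a i)); apply: derivableP; apply: diff_derivable.
  by have [h1 _] := sh i c ac 1; exact: h1.
rewrite -/c; apply: etrans (derive_val (is_derive := is_derive_bigsum D)) _.
by apply: eq_bigr => i _; rewrite !mxE.
Qed.

Lemma locally_constant_diff (f1 f2 : M -> R) : smooth_fun f1 -> smooth_fun f2 ->
  (forall x, d0 f1 x = d0 f2 x) -> locally_constant (fun x => f1 x - f2 x).
Proof.
move=> s1 s2 E.
have E1 : (fun x => f1 x - f2 x) = (fun x => \sum_(b : bool) (if b then 1 else -1) *
    (if b then f1 else f2) x).
  by apply/funext => x; rewrite big_bool /= mul1r mulN1r.
have [s d] := @smooth_fun_lin bool (fun b => if b then 1 else -1)
  (fun b => if b then f1 else f2) (fun b => match b with true => s1 | false => s2 end).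
rewrite E1; apply: d0_eq0_locally_constant => // x.
by rewrite d big_bool /= E scale1r scaleN1r subrr.
Qed.

End locally_constant.

(** * Normalised potentials and equivariance of the momentum map *)

Section momentum_map.
Variables (R : realType) (k m : nat) (G : lieGroup R k) (expG : 'rV[R]_k -> G).
Hypothesis exp_spec : is_exponential expG.
Variables (M : manifold R m) (act : G -> M -> M).
Hypothesis action : smooth_action act.
Variable om : bilinear_field M.
Hypothesis om_inv : forall a, preserves_bilinear (act a) om.
Hypothesis H5 : forall x : M, exists2 p : M, connected_component [set: M] x p &
     forall a : G, act a p = p.
Hypothesis potential : forall i, exists2 h : M -> R, smooth_fun h &
  d0 h = contraction expG act om (delta_mx 0 i).

(* Quasi-components replace connected components here: that they are open follows
   from convexity of small balls, without connectedness of their images in M. *)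
Definition fixed_near (x : M) : set M :=
  [set q | (forall a, act a q = q) /\ forall f : M -> R, locally_constant f -> f q = f x].

Lemma fixed_nearP x : fixed_near x (get (fixed_near x)).
Proof.
apply: getPex; have [p cp fp] := H5 x; exists p; split=> // f lf.
exact: (locally_constant_component lf cp).
Qed.

Lemma fixed_near_eq x y : (forall f : M -> R, locally_constant f -> f y = f x) ->
  fixed_near y = fixed_near x.
Proof.
move=> E; apply/seteqP; split=> q [fq lq]; split=> // f lf.
  by rewrite lq// E.
by rewrite lq// -E.
Qed.

Lemma fixed_near_get x : get (fixed_near (get (fixed_near x))) = get (fixed_near x).
Proof. by rewrite (fixed_near_eq (fixed_nearP x).2). Qed.

Lemma hamiltonian_of_potentials : hamiltonian expG act om.
Proof.
pose h i := s2val (cid2 (potential i)).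
have sh i : smooth_fun (h i) := s2valP (cid2 (potential i)).
have dh i : d0 (h i) = contraction expG act om (delta_mx 0 i) := s2valP' (cid2 (potential i)).
(* [get] depends only on the set, so all points of a quasi-component receive the same fixed point,
   and that fixed point receives itself. Subtracting the value at [base x] thus changes a potential
   by a locally constant function. *)
pose base x := get (fixed_near x).
have lb i : locally_constant (fun x => h i (base x)).
  move=> x; apply: filterS (locally_constant_near x) => y E.
  by rewrite /base (fixed_near_eq E).
pose K i x := h i x - h i (base x).
have sK i : smooth_fun (K i) := (smooth_sub_locally_constant (sh i) (lb i)).1.
have dK i : d0 (K i) = contraction expG act om (delta_mx 0 i).
  by rewrite -dh; exact: (smooth_sub_locally_constant (sh i) (lb i)).2.
pose mu x : 'cV[R]_k := \col_i K i x.
have muE xi : (fun x => pairing xi (mu x)) = (fun x => \sum_i xi 0 i * K i x).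
  by apply/funext => x; rewrite /pairing pairing_sum; apply: eq_bigr => i _; rewrite mxE.
have smu xi : smooth_fun (fun x => pairing xi (mu x)).
  by rewrite muE; exact: (smooth_fun_lin (fun i => xi 0 i) sK).1.
have dmu xi : d0 (fun x => pairing xi (mu x)) = contraction expG act om xi.
  apply/funext => x; rewrite muE (smooth_fun_lin (fun i => xi 0 i) sK).2.
  rewrite (contraction_sum exp_spec action); apply: eq_bigr => i _.
  by rewrite dK.
have mu0 q : base q = q -> mu q = 0.
  by move=> bq; apply/colP => i; rewrite !mxE /K bq subrr.
exists mu; split.
- move=> c ac j; have o := @open_cimg _ _ _ c.
  apply/Ck_mxP => // i i'; rewrite ord1.
  by apply: Ck_eq (sK i c ac j) => // y cy; rewrite mxE.
- move=> a x xi.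
  have s1 : smooth_fun (M := M) ((fun x => pairing xi (mu x)) \o act a).
    exact: smooth_fun_comp (act_smooth_mor action a) (smu xi).
  have s2 := smu (xi *m Ad (ginv a)).
  have E z : d0 (M := M) ((fun x => pairing xi (mu x)) \o act a) z =
      d0 (fun x => pairing (xi *m Ad (ginv a)) (mu x)) z.
    rewrite (d0_comp (act_smooth_mor action a) (smu xi)) !dmu.
    by rewrite (pull_contraction exp_spec action om_inv).
  (* The two sides of the equivariance identity have equal differentials, so their difference is
     locally constant. It can be evaluated at the fixed point [base x], where both sides vanish
     because [mu] does. *)
  have lc := locally_constant_diff s1 s2 E.
  have [fb lq] := fixed_nearP x.
  have := lq _ lc; rewrite /= fb mu0; last exact: fixed_near_get.
  rewrite /pairing !mulmx0 mxE subr0 => /esym/eqP.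
  by rewrite subr_eq0 => /eqP.
- by move=> xi x v; rewrite dmu pairing_contraction.
Qed.

End momentum_map.

(** * Vanishing of the harmonic part of the contracted form *)

Theorem theorem1 (R : realType) (k m : nat)
  (G : lieGroup R k) (expG : 'rV[R]_k -> G)
  (G_compact : compact [set: G]) (G_connected : connected [set: G])
  (exp_spec : is_exponential expG)
  (M : manifold R m)
  (omega g : bilinear_field M) (J : endo_field M)
  (triple : compatible_triple omega g J)
  (act : G -> M -> M) (action : smooth_action act)
  (triple_inv : invariant_triple act omega g J)
  (vol : {measure set (borel M) -> \bar R}) (vol_spec : riemannian_volume g vol)
  (f : M -> R) (f_smooth : smooth_fun f)
  (f_bounded : exists B : R, forall x, `|f x| <= B)
  (lam : {measure set (borel M) -> \bar R})
  (lam_density : forall A : set M, @measurable _ (borel M) A ->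
     lam A = (\int[vol]_(x in A) (f x)%:E)%E)
  (lam_inv : invariant_measure act lam)
  (H1 : forall xi : 'rV[R]_k, L2_vect lam g (inf_generator expG act xi))
  (H2 : forall alpha : form1 M, closed_form1 alpha -> L2_form1 lam g alpha ->
     exists (h : M -> R) (chi : form1 M),
       [/\ smooth_fun h, L2_fun lam h & L2_form1 lam g (d0 h)] /\
       [/\ harmonic lam g chi, L2_form1 lam g chi,
           forall x, alpha x = d0 h x + chi x &
           L2_inner lam g (d0 h) chi = 0%E])
  (H3 : forall C : set (form1 M), de_rham_H1 C ->
     exists! chi : form1 M,
       [/\ C chi, harmonic lam g chi & L2_form1 lam g chi])
  (H4 : forall chi : form1 M, harmonic lam g chi -> L2_form1 lam g chi ->
     harmonic lam g (J_form1 J chi) /\ L2_form1 lam g (J_form1 J chi))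
  (H5 : forall x : M, exists2 p : M, connected_component [set: M] x p &
     forall a : G, act a p = p) :
  hamiltonian expG act omega.
Proof.
have [so rg aJ comp] := triple.
have om_inv a : preserves_bilinear (act a) omega by have [] := triple_inv a.
have g_inv a : preserves_bilinear (act a) g by have [] := triple_inv a.
apply: (hamiltonian_of_potentials exp_spec action om_inv H5) => i.
set xi := delta_mx 0 i; set al := contraction expG act omega xi.
have cal : closed_form1 al.
  exact: (contraction_closed exp_spec action xi (symp_smooth so) (symp_alt so)
    (symp_closed so) om_inv).
have inner_al chi x : inner_form1 g al chi x =
    pairing (inf_generator expG act xi x) (J_form1 J chi x).
  exact: (inner_contraction (symp_alt so x) (metric_sym rg x) (ac_square aJ x) (comp x)
    (metric_unit rg x)).
have Lal : L2_form1 lam g al.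
  have := H1 xi; rewrite /L2_form1 /L2_vect.
  have -> // : norm_vect g (inf_generator expG act xi) = norm_form1 g al.
  apply/funext => x; congr Num.sqrt; symmetry.
  exact: (inner_contraction_self (symp_alt so x) (metric_sym rg x) (ac_square aJ x) (comp x)
    (metric_unit rg x)).
have [h [chi [[sh _ _] [hchi lchi E ortho]]]] := H2 _ cal Lal.
have [hJ lJ] := H4 _ hchi lchi.
have dhE x : inner_form1 g (d0 h) chi x = - inner_form1 g chi chi x.
  (* The inner product is [J chi] evaluated on the generator, and harmonicity of [J chi] lets the
     vanishing result apply to it. *)
  have Z : inner_form1 g al chi x = 0.
    by rewrite inner_al; exact: (harmonic_generator0 exp_spec action rg g_inv lam_inv H3 H5).
  apply/eqP; rewrite -addr_eq0 -Z /inner_form1 E (linearD _ (d0 h x)) /= !mulmxDl [X in _ == X]mxE.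
  exact: eqxx.
have pos x : 0 <= inner_form1 g chi chi x.
  apply: (dual_form_ge0 (chi x) (metric_sym rg x)) => v; exact: (metric_pos rg).
(* Orthogonality of the decomposition, combined with the pointwise identity, says that the squared
   norm of [chi] has integral 0. *)
have chi0 : forall x, chi x = 0.
  apply: (harmonic_norm0 rg H3 (proj1 (proj1 hchi))).
  have := ortho; rewrite /L2_inner.
  have -> : (fun x => (inner_form1 g (d0 h) chi x)%:E) =
      (fun x => - (inner_form1 g chi chi x)%:E)%E.
    by apply/funext => x; rewrite dhE.
  rewrite (@integral_ge0N _ (borel M) R lam setT); last by move=> x _; rewrite lee_fin.
  by move=> /eqP; rewrite oppe_eq0 => /eqP.
exists h => //; apply/funext => x.
by rewrite -/al E chi0 addr0.
Qed.
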